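(* Let $p\ge1$, $\beta>1/p$, and let $\xi=(\mathcal T_0,\mu_0)$ be a random string of beads of length $L$ with $\mathbb E[L^p]<\infty$. For $k\ge0$, to obtain $(\mathcal T_{k+1},\mu_{k+1})$ conditionally given $(\mathcal T_j,\mu_j)$, $0\le j\le k$, pick an atom $J_k\in\mathcal T_k$ from (i.e. with distribution) $\mu_k$, and attach at $J_k$ an independent isometric copy of $\xi$ with metric rescaled by $\mu_k(J_k)^\beta$ and mass measure rescaled by $\mu_k(J_k)$ (the rescaled mass measure of the copy replacing the atom at $J_k$). Then there exists a compact CRT $(\mathcal T,\mu)$ such that $$\lim_{k\to\infty}(\mathcal T_k,\mu_k)=(\mathcal T,\mu)\quad\text{a.s. in the Gromov-Hausdorff-Prokhorov topology on }\mathbb T_{\rm w}.$$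
   Context: Trees. An $\mathbb R$-tree is a separable metric space $(T,d)$ in which any two points $x,y$ are joined by a unique injective path $[[x,y]]$ (up to reparametrisation), this path being isometric to $[0,d(x,y)]$. All trees are rooted at a distinguished point $\rho$. A weighted $\mathbb R$-tree $(T,d,\rho,\mu)$ carries in addition a Borel probability measure $\mu$ on $T$. $\mathbb T_{\rm w}$ is the set of equivalence classes of compact weighted rooted $\mathbb R$-trees under root- and measure-preserving isometries, with the Gromov-Hausdorff-Prokhorov metric $$d_{\rm GHP}((T,d,\rho,\mu),(T',d',\rho',\mu'))=\inf_{\varphi,\varphi'}\max\{\delta(\varphi(\rho),\varphi'(\rho')),\delta_{\rm H}(\varphi(T),\varphi'(T')),\delta_{\rm P}(\varphi_*\mu,\varphi'_*\mu')\},$$ the infimum being over all isometric embeddings $\varphi,\varphi'$ of $T,T'$ into a common metric space $(\mathcal M,\delta)$; $\delta_{\rm H}$ and $\delta_{\rm P}$ are the Hausdorff and Prokhorov distances. Continuum trees. A leaf of $T$ is a point $x\in T\setminus\{\rho\}$ such that $T\setminus\{x\}$ is connected; ${\rm Lf}(T)$ is the set of leaves. A weighted $\mathbb R$-tree is a continuum tree if (i) $\mu$ is supported by ${\rm Lf}(T)$ (i.e. $\mu(T\setminus{\rm Lf}(T))=0$), (ii) $\mu$ has no atoms, (iii) $\mu(T_x)>0$ for every $x\in T\setminus{\rm Lf}(T)$, where $T_x=\{\sigma\in T: x\in[[\rho,\sigma]]\}$. A continuum random tree (CRT) is a random weighted $\mathbb R$-tree that is almost surely a continuum tree. Strings of beads.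 A string of beads is a weighted interval $([0,\ell],\sum_{i\ge1}p_i\delta_{x_i})$, rooted at $0$, with $\ell>0$, distinct $x_i\in[0,\ell]$, $\ell=\sup\{x_i:p_i>0\}$, and $1>p_1\ge p_2\ge\cdots\ge0$, $\sum_i p_i=1$. Its length is $\ell$. A random string of beads is a random variable valued in such strings. Attaching. ''Attaching a copy of $\xi$ at $x$'' means taking the disjoint union and identifying the left endpoint $0$ (root) of the copy with $x$, using the resulting path metric; the root of each $\mathcal T_k$ is the left endpoint of $\mathcal T_0$. The copies used in all steps are independent of each other and of the past (including the choice of $J_k$), and $\mathcal T_k\subset\mathcal T_{k+1}$. *)

(* Defs.v *)
From HB Require Import structures.
From mathcomp Require Import all_boot all_order all_algebra.
From mathcomp Require Import all_classical all_reals all_analysis.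
From mathcomp Require Import lra.

Set Implicit Arguments.
Unset Strict Implicit.
Unset Printing Implicit Defensive.

Import Order.TTheory GRing.Theory Num.Theory.
Import numFieldNormedType.Exports.

Local Open Scope classical_set_scope.
Local Open Scope ring_scope.

(* The root of a rooted metric space is its [point]. *)
#[short(type="rootedMetricType")]
HB.structure Definition RootedMetric (R : numDomainType) :=
  {M of Pointed M & Metric R M}.

Definition borel (R : realType) (X : rootedMetricType R) :=
  g_sigma_algebraType (@open X).

Record weighted (R : realType) := Weighted {
  wsort :> rootedMetricType R ;
  wmass : probability (borel wsort) R }.

Section GHP.
Context {R : realType}.
Local Open Scope ereal_scope.

Definition isometric (X Y : metricType R) (f : X -> Y) :=
  forall x y, mdist (f x) (f y) = mdist x y.

Definition thick (M : metricType R) (e : R) (A : set M) : set M :=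
  [set y | exists2 x, A x & (mdist x y < e)%R].

Definition hausdorff_dist (M : metricType R) (A B : set M) : \bar R :=
  ereal_inf [set e%:E | e in
    [set e : R | [/\ (0 < e)%R, A `<=` thick e B & B `<=` thick e A]]].

Definition prokhorov_dist (M : metricType R) (mu nu : set M -> \bar R) : \bar R :=
  ereal_inf [set e%:E | e in
    [set e : R | (0 < e)%R /\ forall C : set M, closed C ->
       mu C <= nu (thick e C) + e%:E /\ nu C <= mu (thick e C) + e%:E]].

(* The push-forwards are written as plain set functions, [M] having no root
   to make it a [measurableType]; isometries are continuous, so that this is
   the image measure on the Borel sets of [M]. *)
Definition dGHP (X Y : weighted R) : \bar R :=
  ereal_inf [set r | exists (M : metricType R) (f : X -> M) (g : Y -> M),
    [/\ isometric f, isometric g &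
        r = maxe (mdist (f point) (g point))%:E
           (maxe (hausdorff_dist (range f) (range g))
                 (prokhorov_dist (fun A => wmass X (f @^-1` A))
                                 (fun A => wmass Y (g @^-1` A))))]].

End GHP.

Section Rtrees.
Context {R : realType}.

Definition separable (X : topologicalType) :=
  exists2 D : set X, countable D & dense D.

Definition geodesic (X : metricType R) (x y : X) (g : R -> X) :=
  [/\ g 0 = x, g (mdist x y) = y &
      {in `[0, mdist x y] &, forall s t, mdist (g s) (g t) = `|s - t|}].

Definition injective_path (X : metricType R) (x y : X) (q : R -> X) :=
  [/\ {within `[0, 1], continuous q}, {in `[0, 1] &, injective q},
      q 0 = x & q 1 = y].

Definition reparametrisation (l : R) (theta : R -> R) :=
  [/\ {within `[0, 1], continuous theta},
      {in `[0, 1] &, {homo theta : s t / s < t}}, theta 0 = 0 & theta 1 = l].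

Definition Rtree (X : metricType R) :=
  separable X /\
  forall x y : X, exists2 g : R -> X, geodesic x y g &
    forall q, injective_path x y q -> exists2 theta : R -> R,
      reparametrisation (mdist x y) theta & {in `[0, 1], q =1 g \o theta}.

Definition segment (X : metricType R) (x y : X) : set X :=
  [set z | exists2 g, geodesic x y g & (g @` `[0, mdist x y]) z].

Definition leaf (X : rootedMetricType R) : set X :=
  [set x | x != point /\ connected (~` [set x])].

Definition subtree (X : rootedMetricType R) (x : X) : set X :=
  [set y | segment point y x].

Definition continuum_tree (X : weighted R) :=
  [/\ Rtree X,
      (wmass X).-negligible (~` @leaf X),
      forall x : X, wmass X [set x] = 0%E &
      forall x : X, ~ leaf x -> (0 < wmass X (subtree x))%E].

End Rtrees.

(* Compact weighted R-trees stand for their equivalence classes under root-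
   and measure-preserving isometries: equivalent trees are at GHP distance 0,
   so that a GHP-open set is a union of classes. *)
Record compact_tree (R : realType) := CompactTree {
  ctree :> weighted R ;
  ctree_compact : compact [set: ctree] ;
  ctree_Rtree : Rtree ctree }.

Definition GHP_open (R : realType) (U : set (compact_tree R)) :=
  forall X, U X -> exists2 e : R, 0 < e &
    forall Y : compact_tree R, (dGHP X Y < e%:E)%E -> U Y.

(* Measurability for the Borel sigma-algebra of the GHP topology. *)
Definition random_tree d (Omega : measurableType d) (R : realType)
    (T : Omega -> compact_tree R) :=
  forall U, GHP_open U -> measurable (T @^-1` U).

(* A finite number of beads is obtained when [bead_mass] is eventually 0;
   the positions of the beads of mass 0 are then irrelevant. *)
Record beads (R : realType) := Beads {
  bead_len : R ;
  bead_pos : nat -> R ;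
  bead_mass : nat -> R ;
  bead_len_gt0 : 0 < bead_len ;
  bead_pos_inj : injective bead_pos ;
  bead_pos_itv : forall i, 0 <= bead_pos i <= bead_len ;
  bead_lenE : bead_len = sup [set bead_pos i | i in [set i | 0 < bead_mass i]] ;
  bead_mass_lt1 : bead_mass 0 < 1 ;
  bead_mass_ni : nonincreasing_seq bead_mass ;
  bead_mass_ge0 : forall i, 0 <= bead_mass i ;
  bead_mass_sum : (\sum_(i <oo) (bead_mass i)%:E = 1)%E }.

Section bead_measure.
Context {R : realType} d (Y : measurableType d).
Variables (b : beads R) (f : R -> Y).

(* The image of the mass measure [\sum_i p_i \d_(x_i)] of [b] under [f]. *)
Definition bead_image : set Y -> \bar R :=
  mseries (fun i => mscale (NngNum (bead_mass_ge0 b i))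
                           (dirac (f (bead_pos b i)))) 0.

HB.instance Definition _ := Measure.on bead_image.

Lemma bead_imageE A :
  bead_image A = (\sum_(i <oo) ((bead_mass b i)%:E * \d_(f (bead_pos b i)) A))%E.
Proof. by []. Qed.

Lemma bead_image_setT : bead_image setT = 1%E.
Proof.
rewrite bead_imageE -(bead_mass_sum b); apply: eq_eseriesr => i _.
by rewrite diracT mule1.
Qed.

Lemma bead_image_eq0 A : (forall i, ~ A (f (bead_pos b i))) ->
  bead_image A = 0%E.
Proof.
move=> Af; rewrite bead_imageE eseries0// => i _ _.
by rewrite diracE memNset ?mule0//; exact: Af.
Qed.

HB.instance Definition _ :=
  Measure_isProbability.Build _ _ _ bead_image bead_image_setT.

End bead_measure.

(* The sigma-algebra on strings of beads is that of [pprobability], generated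
   by the masses of the Borel sets: the length, a supremum of the support, is
   a function of the mass measure, and the enumeration of the beads of equal
   masses need not be measurable. *)
Definition bead_law (R : realType) (b : beads R) :
    pprobability (measurableTypeR R) R :=
  bead_image b (id : R -> measurableTypeR R) : probability _ _.

(* The trees are built on nested subsets of [nat * R], where [(j, x)] is the
   point at distance [x] from the left endpoint in the [j]-th copy [s j],
   before rescaling. The left endpoint of the copy [s k.+1], which is attached
   at the point [J k], is identified with [J k], so that [(k.+1, 0)] is
   not used. *)
Section construction.
Context {R : realType}.
Variables (beta : R) (s : nat -> beads R) (J : nat -> nat * R).

(* All subsets are measurable; the measures [tree_mu k] below are atomic. *)
Definition places := g_sigma_algebraType [set: set (nat * R)].

Lemma measurable_places (A : set places) : measurable A.
Proof. exact: sub_sigma_algebra. Qed.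

Definition emb (j : nat) (x : R) : places :=
  if j is k.+1 then if x == 0 then J k else (j, x) else (0%N, x).

Definition mass_at (mu : {measure set places -> \bar R}) (u : places) :
    {nonneg R} :=
  NngNum (fine_ge0 (measure_ge0 mu [set u])).

(* The atom at [J k] is replaced by the image of the mass measure of [s k.+1],
   rescaled by the mass of this atom. *)
Fixpoint tree_mu (k : nat) : {measure set places -> \bar R} :=
  if k is k'.+1 then
    measure_add
      (mrestr (tree_mu k') (measurable_places (~` [set (J k' : places)])))
      (mscale (mass_at (tree_mu k') (J k')) (bead_image (s k) (emb k)))
  else bead_image (s 0%N) (emb 0).

Definition weight (j : nat) : R :=
  if j is k.+1 then (mass_at (tree_mu k) (J k))%:num else 1.

Definition scale (j : nat) : R := weight j `^ beta.

(* If [J k] is not an atom, which has probability 0 when it is picked from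
   [tree_mu k], the copy [s k.+1] is rescaled by 0 and reduced to a point. *)
Definition tree_pts (k : nat) : set (nat * R) :=
  [set u | [/\ (u.1 <= k)%N, 0 <= u.2 <= bead_len (s u.1) &
               (0 < u.1)%N -> 0 < u.2 /\ 0 < weight u.1]].

Fixpoint tree_dist (k : nat) (u v : nat * R) : R :=
  if k is k'.+1 then
    match u.1 == k, v.1 == k with
    | true, true => scale k * `|u.2 - v.2|
    | true, false => scale k * u.2 + tree_dist k' (J k') v
    | false, true => tree_dist k' u (J k') + scale k * v.2
    | false, false => tree_dist k' u v
    end
  else `|u.2 - v.2|.

Lemma tree_distS k u v : tree_dist k.+1 u v =
  match u.1 == k.+1, v.1 == k.+1 with
  | true, true => scale k.+1 * `|u.2 - v.2|
  | true, false => scale k.+1 * u.2 + tree_dist k (J k) v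
  | false, true => tree_dist k u (J k) + scale k.+1 * v.2
  | false, false => tree_dist k u v
  end.
Proof. by []. Qed.

Lemma tree_muS k A : tree_mu k.+1 A =
  (tree_mu k (A `&` ~` [set J k]) +
   (weight k.+1)%:E * bead_image (s k.+1) (emb k.+1) A)%E.
Proof. by rewrite [LHS]measure_addE. Qed.

Lemma tree_mu_setT k : tree_mu k setT = 1%E.
Proof.
elim: k => [|k IH]; first exact: bead_image_setT.
rewrite tree_muS bead_image_setT mule1 setTI.
have fin A : tree_mu k A \is a fin_num.
  rewrite ge0_fin_numE//; apply: (@le_lt_trans _ _ (tree_mu k setT)).
    by apply: le_measure; rewrite ?inE//; exact: measurable_places.
  by rewrite IH ltry.
rewrite /weight /= fineK// -measureU; [|exact: measurable_places..|].
  by rewrite setUC setUv.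
by rewrite setICl.
Qed.

Lemma tree_mu_fin k A : tree_mu k A \is a fin_num.
Proof.
rewrite ge0_fin_numE//; apply: (@le_lt_trans _ _ (tree_mu k setT)).
  by apply: le_measure; rewrite ?inE//; exact: measurable_places.
by rewrite tree_mu_setT ltry.
Qed.

Lemma tree_mu_le k A B : A `<=` B -> (tree_mu k A <= tree_mu k B)%E.
Proof. by move=> AB; apply: le_measure; rewrite ?inE//; exact: measurable_places. Qed.

Lemma weight_ge0 j : 0 <= weight j.
Proof. by case: j => [|j] //=; rewrite fine_ge0. Qed.

Lemma scale_ge0 j : 0 <= scale j.
Proof. exact: powR_ge0. Qed.

Lemma scale_gt0 j : 0 < weight j -> 0 < scale j.
Proof. exact: powR_gt0. Qed.

Lemma tree_pts_sub k : tree_pts k `<=` tree_pts k.+1.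
Proof. by move=> u [uk ux u0]; split => //; exact: leqW. Qed.

Lemma tree_pts_cases k u : tree_pts k.+1 u ->
  (u.1 = k.+1 /\ 0 < u.2 /\ 0 < weight k.+1) \/ ((u.1 == k.+1) = false /\ tree_pts k u).
Proof.
move=> [uk ux u0]; case: (eqVneq u.1 k.+1) => [e|ne]; [left|right].
  by split => //; rewrite -e; apply: u0; rewrite e.
by split => //; split => //; rewrite -ltnS ltn_neqAle ne uk.
Qed.

Lemma tree_mu_out k :
  tree_mu k (~` tree_pts k) = 0%E /\ (0 < weight k.+1 -> tree_pts k (J k)).
Proof.
have out_in n : tree_mu n (~` tree_pts n) = 0%E ->
    0 < weight n.+1 -> tree_pts n (J n).
  move=> out; rewrite /weight /= => w0; apply: contrapT => nJ.
  move: w0; apply/negP; rewrite -leNgt -lee_fin fineK ?tree_mu_fin//.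
  apply: (@le_trans _ _ (tree_mu n (~` tree_pts n))); last by rewrite out.
  by apply: tree_mu_le => _ ->.
have out : tree_mu k (~` tree_pts k) = 0%E; last by split => //; exact: out_in.
elim: k => [|k IH].
  apply: bead_image_eq0 => i; apply; split => //=.
  exact: bead_pos_itv.
rewrite tree_muS; set X := tree_mu k _.
have -> : X = 0%E.
  apply/eqP; rewrite eq_le measure_ge0 andbT -IH; apply: tree_mu_le.
  by move=> u [nu _] uk; apply: nu; exact: tree_pts_sub.
rewrite add0e; have [->|w0] := eqVneq (weight k.+1) 0; first by rewrite mul0e.
have {}w0 : 0 < weight k.+1 by rewrite lt_neqAle eq_sym w0 weight_ge0.
rewrite bead_image_eq0 ?mule0// => i; apply; rewrite /emb.
have /andP[x0 xl] := bead_pos_itv (s k.+1) i.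
case: eqVneq => [_|nx]; first by apply: tree_pts_sub; exact: out_in.
by split => //=; rewrite ?x0//; split=> //; rewrite lt_neqAle eq_sym nx.
Qed.

Lemma tree_dist_metric k :
  [/\ forall u, tree_pts k u -> tree_dist k u u = 0,
      forall u v, tree_pts k u -> tree_pts k v ->
        tree_dist k u v = 0 -> u = v,
      forall u v, tree_pts k u -> tree_pts k v ->
        tree_dist k u v = tree_dist k v u &
      forall v u w, tree_pts k u -> tree_pts k v -> tree_pts k w ->
        tree_dist k u w <= tree_dist k u v + tree_dist k v w].
Proof.
elim: k => [|k [d0 dp ds dt]].
  split=> [u _|[i x] [j y] [/= + _ _] [/= + _ _]|u v _ _|v u w _ _ _] /=.
  - by rewrite subrr normr0.
  - by rewrite !leqn0 => /eqP-> /eqP->/normr0_eq0/eqP; rewrite subr_eq0 => /eqP->.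
  - by rewrite distrC.
  - exact: ler_distD.
have dge0 u v : tree_pts k u -> tree_pts k v -> 0 <= tree_dist k u v.
  move=> hu hv; have := dt v u u hu hv hu.
  by rewrite d0// -(ds u v)// => h; lra.
have [_ hJ] := tree_mu_out k.
split.
- move=> u /tree_pts_cases[[e _]|[e hu]]; rewrite tree_distS e.
    by rewrite eqxx subrr normr0 mulr0.
  exact: d0.
- move=> u v /tree_pts_cases[[eu [u0 w0]]|[e hu]]
    /tree_pts_cases[[ev [v0 w1]]|[f hv]]; rewrite tree_distS ?eu ?ev ?eqxx ?e ?f.
  + move/eqP; rewrite mulf_eq0 gt_eqF ?scale_gt0//= normr_eq0 subr_eq0 => /eqP.
    by case: u v eu ev {u0 v0} => [i x] [j y] /= -> -> ->.
  + have := dge0 _ _ (hJ w0) hv; have : 0 < scale k.+1 * u.2.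
      by rewrite mulr_gt0// scale_gt0.
    by move=> *; exfalso; lra.
  + have := dge0 _ _ hu (hJ w1); have : 0 < scale k.+1 * v.2.
      by rewrite mulr_gt0// scale_gt0.
    by move=> *; exfalso; lra.
  + exact: dp.
- move=> u v /tree_pts_cases[[eu [u0 w0]]|[e hu]]
    /tree_pts_cases[[ev [v0 w1]]|[f hv]]; rewrite !tree_distS ?eu ?ev ?eqxx ?e ?f.
  + by rewrite distrC.
  + by rewrite addrC (ds v)//; exact: hJ.
  + by rewrite addrC (ds u)//; exact: hJ.
  + exact: ds.
- have c0 := scale_ge0 k.+1.
  move=> v u w /tree_pts_cases[[eu [u0 w0]]|[e hu]]
    /tree_pts_cases[[ev [v0 w1]]|[f hv]]
    /tree_pts_cases[[ew [wp w2]]|[g hw]];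
    rewrite !tree_distS ?eu ?ev ?ew ?eqxx ?e ?f ?g.
  + by rewrite -mulrDr ler_wpM2l// ler_distD.
  + rewrite addrA lerD2r// -mulrDr ler_wpM2l//.
    by have := ler_norm (u.2 - v.2) => ?; lra.
  + have h1 := dge0 _ _ (hJ w0) hv; have h2 := dge0 _ _ hv (hJ w0).
    have : scale k.+1 * `|u.2 - w.2| <= scale k.+1 * (u.2 + w.2).
      apply: ler_wpM2l => //; apply: (le_trans (ler_normB _ _)).
      by rewrite !gtr0_norm.
    by rewrite mulrDr => ?; lra.
  + by rewrite -addrA lerD2l; apply: dt => //; exact: hJ.
  + rewrite -addrA lerD2l -mulrDr ler_wpM2l//.
    by have := ler_norm (w.2 - v.2); rewrite distrC => ?; lra.
  + have h := dt (J k) u w hu (hJ w1) hw.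
    have : 0 <= scale k.+1 * v.2 by rewrite mulr_ge0// ltW.
    by move=> ?; lra.
  + by rewrite addrA lerD2r; apply: dt => //; exact: hJ.
  + exact: dt.
Qed.

Definition tree_type (k : nat) : Type := {u : nat * R | tree_pts k u}.

Section tree_space.
Variable k : nat.
Let T := tree_type k.

HB.instance Definition _ := gen_eqMixin (tree_type k).
HB.instance Definition _ := gen_choiceMixin (tree_type k).

Let dist (u v : T) : R := tree_dist k (sval u) (sval v).

Let dist_xx u : dist u u = 0.
Proof. by have [h _ _ _] := tree_dist_metric k; apply: h; case: u. Qed.

Let dist_pos u v : dist u v = 0 -> u = v.
Proof.
have [_ h _ _] := tree_dist_metric k.
case: u v => [u hu] [v hv] /(h _ _ hu hv) /= e.
by case: _ / e hv => hv; rewrite (Prop_irrelevance hu hv).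
Qed.

Let dist_sym u v : dist u v = dist v u.
Proof. by have [_ _ h _] := tree_dist_metric k; apply: h; [case: u|case: v]. Qed.

Let dist_tri v u w : dist u w <= dist u v + dist v w.
Proof.
by have [_ _ _ h] := tree_dist_metric k; apply: h; [case: u|case: v|case: w].
Qed.

HB.instance Definition _ :=
  isMetric.Build R (tree_type k) dist_xx dist_pos dist_sym dist_tri.

Let root_pts : tree_pts k (0%N, 0).
Proof. by split => //=; rewrite lexx ltW// bead_len_gt0. Qed.

HB.instance Definition _ :=
  isPointed.Build (tree_type k) (exist _ (0%N, 0) root_pts).

Definition tree_mass (A : set (borel (tree_type k))) : \bar R :=
  tree_mu k [set sval u | u in (A : set (tree_type k))].

Let tree_mass0 : tree_mass set0 = 0%E.
Proof. by rewrite /tree_mass image_set0 measure0. Qed.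

Let tree_mass_ge0 A : (0 <= tree_mass A)%E.
Proof. exact: measure_ge0. Qed.

Let sval_inj : injective (sval : tree_type k -> nat * R).
Proof.
move=> [u hu] [v hv] /= e; case: _ / e hv => hv.
by rewrite (Prop_irrelevance hu hv).
Qed.

Let tree_mass_sigma : semi_sigma_additive tree_mass.
Proof.
move=> F _ tF _; rewrite /tree_mass image_bigcup.
apply: measure_semi_sigma_additive.
- by move=> i; exact: measurable_places.
- apply/trivIsetP => i j _ _ ij; rewrite -subset0 => _ [[u Fu <-] [v Fv]].
  move/sval_inj => e; move/trivIsetP: tF => /(_ i j I I ij) /seteqP[+ _].
  by move/(_ u); apply; split => //; rewrite -e.
- exact: measurable_places.
Qed.

HB.instance Definition _ := isMeasure.Build _ _ _ tree_mass
  tree_mass0 tree_mass_ge0 tree_mass_sigma.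

Let tree_mass_setT : tree_mass setT = 1%E.
Proof.
have [out _] := tree_mu_out k; rewrite /tree_mass.
have -> : [set sval u | u in [set: tree_type k]] = tree_pts k.
  apply/seteqP; split => [_ [[u hu] _ <-]//|u hu].
  by exists (exist _ u hu).
have : tree_mu k (tree_pts k `|` ~` tree_pts k) =
    (tree_mu k (tree_pts k) + tree_mu k (~` tree_pts k))%E.
  exact: measureU (measurable_places _) (measurable_places _) (setICr _).
by rewrite out adde0 setUv tree_mu_setT => <-.
Qed.

HB.instance Definition _ :=
  Measure_isProbability.Build _ _ _ tree_mass tree_mass_setT.

Definition tree : weighted R := Weighted (tree_mass : probability _ _).

End tree_space.

End construction.

Section random_construction.
Context {R : realType} d (Omega : measurableType d).
Variables (P : probability Omega R).
Variables (xi : nat -> Omega -> beads R) (J : nat -> Omega -> nat * R).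

Definition bead_event (j : nat)
    (A : set (pprobability (measurableTypeR R) R)) : set Omega :=
  [set w | A (bead_law (xi j w))].

(* The sigma-algebra generated by the [xi j], [j < m], and [J i], [i < n]. *)
Definition history (m n : nat) : set (set Omega) :=
  <<s [set E | (exists2 j, (j < m)%N &
                 exists2 A, measurable A & E = bead_event j A) \/
               (exists2 i, (i < n)%N &
                 exists2 B : set (nat * measurableTypeR R),
                   measurable B & E = J i @^-1` B)] >>.

Definition bead_copies :=
  (forall j A, measurable A -> measurable (bead_event j A)) /\
  (forall j A, measurable A -> P (bead_event j A) = P (bead_event 0 A)).

(* The conditional distribution of [J k] given the past is [tree_mu k]: as the
   trees are nested subsets of [nat * R], the past is the sigma-algebra of the
   copies and attachment points used so far. *)
Definition picked_from_mass :=
  forall k, measurable_fun setT (J k : Omega -> nat * measurableTypeR R) /\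
  forall E (B : set (nat * measurableTypeR R)), history k.+1 k E -> measurable B ->
    (P (E `&` J k @^-1` B) =
     \int[P]_(w in E) tree_mu (fun j => xi j w) (fun i => J i w) k B)%E.

(* The copy attached at [J k] is independent of the past and of [J k]. *)
Definition independent_copies :=
  forall k E A, history k.+1 k.+1 E -> measurable A ->
    P (E `&` bead_event k.+1 A) = (P E * P (bead_event k.+1 A))%E.

End random_construction.

(* Main.v *)
(* Let q = beta * p > 1, and let w_k be the mass of the atom J_k. Give an atom of
   mass m in generation g the weight theta^(g+1) m^q. Replacing an atom by a
   rescaled string of beads multiplies its weight by at most theta p_1^(q-1), and
   E p_1^(q-1) < 1, so that for some theta > 1 the weights of the picked atoms
   have a summable expectation. As the lengths L_(k+1) are independent of the
   past and have a finite p-th moment, the sum of theta^g w_k^q L_(k+1)^p is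
   almost surely finite, which makes the height w_k^beta L_(k+1) of the copies
   o(theta^(-g/p)): the copies attached after step k move the points by at most
   c_k, and c_k tends to 0.

   The limit is constructed pathwise, as the inverse limit of the T_k under the
   projections T_(k+1) -> T_k. It is compact, satisfies the four-point condition
   and has approximate geodesics, so that it is an R-tree. Its mass is the image of the Lebesgue measure on [0, 1[, and the
   convergence is clear from the isometric embeddings of the T_k. It has mass 0
   on each T_k, whence on the complement of the leaves, as soon as the largest
   atom of T_k tends to 0; this holds by the Borel-Cantelli lemma, an atom of
   mass greater than e being picked with probability greater than e while
   P(w_k > e) is summable.

   The GHP topology is handled without its triangle inequality: the limit tree is
   determined, up to any given error, by a measurable code with countably many
   values. *)

Require Import Defs.
From HB Require Import structures.
From mathcomp Require Import all_boot all_order all_algebra.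
From mathcomp Require Import all_classical all_reals all_analysis.
From mathcomp Require Import measurable_realfun.
From mathcomp Require Import lra.

Set Implicit Arguments.
Unset Strict Implicit.
Unset Printing Implicit Defensive.

Import Order.TTheory GRing.Theory Num.Theory.
Import numFieldNormedType.Exports.

Local Open Scope classical_set_scope.
Local Open Scope ring_scope.

(** * Metric trees *)

(** Summability of the p-th powers of the heights does not bound the sum of the heights. The factor
    [theta ^ g] repairs this: with [eta = theta ^ (-1/p)] the height of a late copy of generation g
    is at most a small multiple of [eta ^ g], so that the displacement of a point, which adds the
    heights along one line of descent, is bounded by a geometric series. The pathwise part asks only
    [good] of an outcome, and [no_atoms] for the mass. A string may carry a bead at 0. The place
    just picked then remains an atom and keeps its generation, so that the potential of an atom is
    bounded below rather than computed. The largest mass p_1 is replaced by the larger of the masses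
    on the two sides of a fixed cut x. For a suitable x the expectation r of its power q - 1 is less
    than 1, because every string has two beads that some rational separates; [theta = 2 / (1 + r)]
    then satisfies both [theta > 1] and [theta * r < 1]. There are uncountably many places. Events
    about atoms are therefore expressed through countable grids of shrinking cells. *)

Section metric_continuity.
Context {R : realType} {X : metricType R}.
Implicit Types x y z : X.

Lemma mdist_lip x y z : `|mdist x y - mdist x z| <= mdist y z.
Proof.
have := @metric_triangle _ _ x y z; have := @metric_triangle _ _ x z y.
by rewrite (metric_sym z y) ler_norml => *; lra.
Qed.

Lemma mdist_continuous x : continuous (mdist x).
Proof.
move=> y; apply/cvgrPdist_lt => e e0.
near=> z; apply: le_lt_trans (mdist_lip _ _ _) _.
near: z; exact: (@metricType_numDomainType.cvgr_dist_lt _ _ _ _ _ id y).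
Unshelve. all: by end_near. Qed.

(** For x the root this set is the subtree above y, whose mass is thus that of a Borel set. *)
Lemma closed_beyond x y : closed [set z | mdist x y + mdist y z = mdist x z].
Proof.
have -> : [set z | mdist x y + mdist y z = mdist x z] =
    (fun z => mdist x y + mdist y z - mdist x z) @^-1` [set 0].
  apply/seteqP; split => z /=; first by move=> ->; rewrite subrr.
  by move/eqP; rewrite subr_eq0 => /eqP.
apply: closed_comp; last exact: closed_eq.
move=> z _; apply: cvgB; last exact: mdist_continuous.
by apply: cvgD; [exact: cvg_cst|exact: mdist_continuous].
Qed.

End metric_continuity.

Section four_point.
Context {R : realType} (X : metricType R).

(** Gromov's 0-hyperbolicity, the maximum of the two other sums being spelled out as a disjunction
    so that linear arithmetic applies to each case. *)
Definition four_point := forall x y z w : X,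
  mdist x y + mdist z w <= mdist x z + mdist y w \/
  mdist x y + mdist z w <= mdist x w + mdist y z.

Hypothesis fp : four_point.

(** The four-point condition for x, y, u, v bounds d(u, v) by s - t or by t - s, as the length d(x,
    y) cancels; the triangle inequality from x gives the converse. *)
Lemma between_dist (x y u v : X) (s t : R) :
  mdist x u = s -> mdist u y = mdist x y - s ->
  mdist x v = t -> mdist v y = mdist x y - t -> mdist u v = `|s - t|.
Proof.
move=> xu uy xv vy; apply/eqP; rewrite eq_le; apply/andP; split; last first.
  by rewrite -xu -xv mdist_lip.
have := fp x y u v; rewrite !(metric_sym y) xu uy xv vy.
have := ler_norm (s - t); have := ler_norm (t - s); rewrite (distrC t).
by move=> ? ? [] ?; lra.
Qed.

Lemma between_uniq (x y u v : X) :
  mdist x u + mdist u y = mdist x y -> mdist x v = mdist x u ->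
  mdist v y = mdist u y -> u = v.
Proof.
move=> xuy xv vy; apply: mdist_positivity.
rewrite (@between_dist x y u v (mdist x u) (mdist x u)) ?subrr ?normr0 //; lra.
Qed.

Hypothesis bt : forall (x y : X) (s : R), 0 <= s <= mdist x y ->
  exists z, mdist x z = s /\ mdist z y = mdist x y - s.

(** A point is chosen at each height independently of the others: [between_dist] makes any such
    choice an isometry. *)
Lemma geodesic_exists (x y : X) : exists g, geodesic x y g.
Proof.
have /choice[g gP] : forall s : R, exists z : X, 0 <= s <= mdist x y ->
    mdist x z = s /\ mdist z y = mdist x y - s.
  move=> s; have [sd|sd] := pselect (0 <= s <= mdist x y).
    by have [z zP] := bt sd; exists z.
  by exists x => /sd.
exists g; split.
- have [|+ _] := gP 0; first by rewrite lexx mdist_ge0.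
  by move/mdist_positivity.
- have [|_] := gP (mdist x y); first by rewrite lexx mdist_ge0.
  by rewrite subrr => /mdist_positivity.
- move=> s t; rewrite !in_itv/= => /gP[? ?] /gP[? ?].
  exact: (@between_dist x y).
Qed.

Lemma geodesic_mdist (x y : X) g s : geodesic x y g -> 0 <= s <= mdist x y ->
  mdist x (g s) = s /\ mdist (g s) y = mdist x y - s.
Proof.
move=> [g0 gl gi] /andP[s0 sl]; have d0 := mdist_ge0 x y.
have sI : s \in `[0, mdist x y] by rewrite in_itv/= s0.
have h0 : 0 \in `[0, mdist x y] by rewrite in_itv/= lexx.
have hl : mdist x y \in `[0, mdist x y] by rewrite in_itv/= lexx d0.
have := gi _ _ h0 sI; have := gi _ _ sI hl; rewrite g0 gl sub0r normrN => -> ->.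
by rewrite distrC !ger0_norm// subr_ge0.
Qed.

(** Segments, hence subtrees and the search for leaves, become equalities between distances. *)
Lemma segmentE (x y z : X) :
  segment x y z <-> mdist x z + mdist z y = mdist x y.
Proof.
split.
  move=> [g gP [s /=]]; rewrite in_itv/= => sI <-.
  by have [-> ->] := geodesic_mdist gP sI; lra.
move=> xzy; have [g gP] := geodesic_exists x y; exists g => //.
have sI : 0 <= mdist x z <= mdist x y.
  by have := mdist_ge0 x z; have := mdist_ge0 z y => *; apply/andP; split; lra.
exists (mdist x z); first by rewrite /= in_itv.
have [h1 h2] := geodesic_mdist gP sI.
by apply/esym/(@between_uniq x y) => //; lra.
Qed.

Lemma geodesic_within_continuous (x y : X) g : geodesic x y g ->
  {within `[0, mdist x y], continuous g}.
Proof.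
move=> [_ _ gi]; apply/subspace_continuousP => s sI.
apply/metricType_numDomainType.cvgrPdist_lt => e e0; near=> t.
have tI : `[0, mdist x y]%classic t by near: t; exact: withinT.
rewrite gi//; near: t; apply: cvg_within.
by apply: (@cvgr_dist_lt _ _ _ (nbhs s) _ id s) => //; exact: cvg_id.
Unshelve. all: by end_near. Qed.

Lemma geodesic_segment_connected (x y : X) : connected (segment x y).
Proof.
have [g gP] := geodesic_exists x y.
suff -> : segment x y = g @` `[0, mdist x y].
  apply: connected_continuous_connected; last exact: geodesic_within_continuous.
  exact/connected_intervalP/interval_is_interval.
apply/seteqP; split => [z /segmentE xzy|z gz]; last by exists g.
have sI : 0 <= mdist x z <= mdist x y.
  by have := mdist_ge0 x z; have := mdist_ge0 z y => *; apply/andP; split; lra.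
exists (mdist x z); first by rewrite /= in_itv.
have [h1 h2] := geodesic_mdist gP sI.
by apply/esym/(@between_uniq x y) => //; lra.
Qed.

End four_point.

(** An injective path is continuous only within [0, 1]. Clamping the time extends it to the whole
    line, where continuity is no longer relative to a subspace. *)
Lemma continuous_clamp (R : realType) (X : topologicalType) (q : R -> X) :
  {within `[0, 1], continuous q} ->
  continuous (fun t : R => q (Num.max 0 (Num.min t 1))).
Proof.
move=> /subspace_continuousP cq t; set c := fun t : R => Num.max 0 (Num.min t 1).
have cI u : `[0, 1]%classic (c u).
  by rewrite /= in_itv/= /c le_max lexx/= ge_max ler01 ge_min lexx orbT.
have cc : {for t, continuous c}.
  have k (a : R) : {for t, continuous (fun=> a : R)} by exact: cvg_cst.
  apply: (@continuous_max _ _ (fun=> 0)) => //.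
  by apply: (@continuous_min _ _ id) => //; exact: cvg_id.
move=> P hP; have h := cc _ (cq _ (cI t) _ hP).
apply: (@filterS _ (nbhs t) (nbhs_filter t) _ _ _ h) => u /(_ (cI u)).
by [].
Qed.

Lemma clamp_id (R : realType) (t : R) :
  t \in `[0, 1] -> Num.max 0 (Num.min t 1) = t.
Proof. by rewrite in_itv/= => /andP[t0 t1]; rewrite min_l// max_r. Qed.

(** * Injective paths in a space satisfying the four-point condition *)

Section unique_path.
Context {R : realType} (X : metricType R).
Hypothesis fp : four_point X.
Variables (x y : X) (g q : R -> X).
Hypotheses (gP : geodesic x y g) (qP : injective_path x y q).

Let l := mdist x y.
(* The Gromov products: [h z] is the height of the projection of [z] to the
   segment from [x] to [y], and [r z] is the distance from [z] to it. *)
Let h z := (l + mdist x z - mdist y z) / 2.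
Let r z := (mdist x z + mdist y z - l) / 2.

Let hI z : 0 <= h z <= mdist x y.
Proof.
have := metric_triangle y x z; have := metric_triangle x z y.
have := metric_triangle x y z.
rewrite (metric_sym z y) (metric_sym y x) /h /l => *.
by apply/andP; split; lra.
Qed.

Let r_ge0 z : 0 <= r z.
Proof. by have := metric_triangle x z y; rewrite (metric_sym z y) /r /l => *; lra. Qed.

(** The height [h z] is the one at which the two alternatives of the four-point condition give the
    same bound, namely [r z]. *)
Let dist_proj z : mdist z (g (h z)) <= r z.
Proof.
have [h1 h2] := geodesic_mdist gP (hI z).
have := fp z (g (h z)) x y; have := fp x y z (g (h z)).
rewrite !(metric_sym z) !(metric_sym _ x) h1 h2 /r /h /l => *.
by lra.
Qed.

(** A point off the segment hangs on a branch with foot at height [h z]; a point nearer to it than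
    the foot hangs on the same branch. *)
Let h_locally_constant z z' : mdist z z' < r z -> h z = h z'.
Proof.
have := fp z x z' y; have := fp z y z' x; have := r_ge0 z'.
rewrite !(metric_sym _ x) !(metric_sym _ y) (metric_sym y x) /r /h /l => *.
by lra.
Qed.

Let q' t := q (Num.max 0 (Num.min t 1)).

Let cq' : continuous q'. Proof. by case: qP => + _ _ _; exact: continuous_clamp. Qed.

Let cd z : continuous (fun t => mdist z (q' t)).
Proof.
by move=> t; apply: (@cvg_comp _ _ _ q' (mdist z)); [exact: cq'|exact: mdist_continuous].
Qed.

Let cr : continuous (r \o q').
Proof.
move=> t; rewrite /r /=; apply: cvgMr_tmp.
apply: cvgB; last exact: cvg_cst.
by apply: cvgD; exact: cd.
Qed.

Let ch : continuous (h \o q').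
Proof.
move=> t; rewrite /h /=; apply: cvgMr_tmp.
apply: cvgB; first apply: cvgD; first exact: cvg_cst.
  exact: cd.
exact: cd.
Qed.

Let q'0 : q' 0 = x.
Proof. by case: qP => _ _ <- _; rewrite /q' clamp_id// in_itv/= lexx ler01. Qed.

Let q'1 : q' 1 = y.
Proof. by case: qP => _ _ _ <-; rewrite /q' clamp_id// in_itv/= lexx ler01. Qed.

Let q'_inj : {in `[0, 1] &, injective q'}.
Proof. by case: qP => _ qi _ _ s t sI tI; rewrite /q' !clamp_id//; exact: qi. Qed.

Let r0 : r (q' 0) = 0.
Proof. by rewrite q'0 /r mdistxx metric_sym add0r subrr mul0r. Qed.

Let r1 : r (q' 1) = 0.
Proof. by rewrite q'1 /r mdistxx addr0 subrr mul0r. Qed.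

Let zero_compact a b : compact (`[a, b] `&` [set t | r (q' t) = 0]).
Proof.
apply: (subclosed_compact _ (@segment_compact _ a b)); last exact: subIsetl.
apply: closedI; first exact: interval_closed.
have := @closed_comp _ _ (r \o q') [set 0] (fun t _ => cr (x:=t)).
by apply; exact: closed_eq.
Qed.

(** An injective path cannot leave the segment. Let a be the last time before t0 and b the first
    time after t0 at which it is on the segment. In between, the height of the foot is locally
    constant, hence has zero derivative, and the mean value theorem gives a and b the same foot. As
    the path is on the segment at both times, it takes the same value twice. *)
Let r_eq0 t0 : t0 \in `[0, 1] -> r (q' t0) = 0.
Proof.
rewrite in_itv/= => /andP[t00 t01]; apply/eqP/negP => /negP rt0.
have cid A : {within A, continuous (@idfun R)}.
  by apply: continuous_subspaceT => u; exact: cvg_id.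
have i0 : `[0, t0]%classic 0 by rewrite /= in_itv/= lexx.
have i1 : `[t0, 1]%classic 1 by rewrite /= in_itv/= lexx andbT.
have n0 : `[0, t0] `&` [set t | r (q' t) = 0] !=set0 by exists 0.
have n1 : `[t0, 1] `&` [set t | r (q' t) = 0] !=set0 by exists 1.
have [a + amax] := @compact_EVT_max R R idfun _ n0 (@zero_compact 0 t0) (@cid _).
have [b + bmin] := @compact_EVT_min R R idfun _ n1 (@zero_compact t0 1) (@cid _).
rewrite !inE /= !in_itv/= => -[/andP[tb b1] rb] [/andP[a0 ta] ra].
have {}ta : a < t0.
  by rewrite lt_neqAle ta andbT; apply: contraNneq rt0 => <-; rewrite ra.
have {}tb : t0 < b.
  by rewrite lt_neqAle tb andbT; apply: contraNneq rt0 => ->; rewrite rb.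
have ab := lt_trans ta tb.
have rpos t : t \in `]a, b[ -> 0 < r (q' t).
  rewrite in_itv/= => /andP[at_ tb_]; rewrite lt_neqAle r_ge0 andbT eq_sym.
  apply/negP => /eqP rt; have [tt|tt] := leP t t0.
    have := amax t; rewrite inE/= in_itv/= rt tt (ltW (le_lt_trans a0 at_)).
    by move=> /(_ (conj isT erefl)); rewrite leNgt at_.
  have := bmin t; rewrite inE/= in_itv/= rt (ltW tt) (ltW (lt_le_trans tb_ b1)).
  by move=> /(_ (conj isT erefl)); rewrite leNgt tb_.
have [t tI||c _] := @MVT _ (h \o q') (fun=> 0) a b ab.
- apply: (@near_eq_is_derive _ _ _ (fun=> h (q' t))).
    near=> u; apply: h_locally_constant.
    near: u; apply: (@metricType_numDomainType.cvgr_dist_lt _ _ _ (nbhs t) _ q').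
      exact: cq'.
    exact: rpos.
- by apply: continuous_subspaceT => u; exact: ch.
rewrite mul0r => /eqP; rewrite subr_eq0 => /eqP /= hab.
have gq u : r (q' u) = 0 -> q' u = g (h (q' u)).
  move=> ru; apply: mdist_positivity; apply/eqP.
  by rewrite eq_le mdist_ge0 andbT -ru dist_proj.
have qab : q' a = q' b by rewrite gq// (gq b)// hab.
have aI : a \in `[0, 1] by rewrite in_itv/= a0/=; lra.
have bI : b \in `[0, 1] by rewrite in_itv/= b1 andbT; lra.
by move: ab; rewrite (q'_inj aI bI qab) ltxx.
Unshelve. all: by end_near. Qed.

(** The path stays on the segment, so it is [g] composed with its own height. That height is
    continuous and injective, hence monotone, and its end values make it increasing. *)
Lemma injective_path_geodesic : exists2 theta : R -> R,
  reparametrisation (mdist x y) theta & {in `[0, 1], q =1 g \o theta}.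
Proof.
have gq u : u \in `[0, 1] -> q' u = g (h (q' u)).
  move=> uI; apply: mdist_positivity; apply/eqP.
  by rewrite eq_le mdist_ge0 andbT -(r_eq0 uI) dist_proj.
have h0 : h (q' 0) = 0 by rewrite q'0 /h mdistxx metric_sym addr0 subrr mul0r.
have h1 : h (q' 1) = l.
  by rewrite q'1 /h mdistxx subr0 -/l -mulr2n -[l *+ 2]mulr_natr mulfK.
have cw : {within `[0, 1], continuous (h \o q')}.
  by apply: continuous_subspaceT => u; exact: ch.
exists (h \o q'); last first.
  by move=> u uI; rewrite /= -gq// /q' clamp_id.
have hinj : {in `[0, 1] &, injective (h \o q')}.
  by move=> s t sI tI /= e; apply: q'_inj => //; rewrite gq// e -gq.
split => // s t sI tI st; rewrite (leW_mono_in (segment_continuous_inj_le _ cw hinj))//=.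
by rewrite h0 h1 /l mdist_ge0.
Qed.

End unique_path.

Section Rtree_criterion.
Context {R : realType} (X : rootedMetricType R).
Hypothesis fp : four_point X.
Hypothesis cX : compact [set: X].
Hypothesis approx : forall (x y : X) (s e : R), 0 <= s <= mdist x y -> 0 < e ->
  exists z, `|mdist x z - s| <= e /\ `|mdist z y - (mdist x y - s)| <= e.

(** The sum [f] of the two errors attains its minimum on the compact space, and approximate
    intermediate points put this minimum below every positive number. *)
Lemma compact_between (x y : X) (s : R) : 0 <= s <= mdist x y ->
  exists z, mdist x z = s /\ mdist z y = mdist x y - s.
Proof.
move=> sI.
pose f z := `|mdist x z - s| + `|mdist y z - (mdist x y - s)|.
have cf : continuous f.
  move=> z; apply: cvgD; apply: cvg_norm; apply: cvgB; try exact: cvg_cst;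
  exact: mdist_continuous.
have [z _ zmin] := compact_EVT_min (ex_intro _ x I) cX (continuous_subspaceT cf).
have f0 : f z <= 0.
  apply/ler_addgt0Pl => e e0; rewrite addr0.
  have [u [u1 u2]] := approx sI (divr_gt0 e0 (@ltr0Sn R 1)).
  apply: (le_trans (zmin u _)); first by rewrite inE.
  by rewrite /f (metric_sym y u); lra.
have := normr_ge0 (mdist x z - s); have := normr_ge0 (mdist y z - (mdist x y - s)).
rewrite /f in f0 => n1 n2; exists z; rewrite (metric_sym z y).
by split; apply/eqP; rewrite -subr_eq0 -normr_eq0; apply/eqP; lra.
Qed.

Lemma compact_Rtree : Rtree X.
Proof.
split.
  have [B cB [_ Bb]] := compact_second_countable cX.
  have /choice[c cP] : forall U : set X, exists x, U !=set0 -> U x.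
    move=> U; have [[x Ux]|U0] := pselect (U !=set0); first by exists x.
    by exists point.
  exists (c @` B); first exact: card_le_trans (card_image_le _ _) cB.
  move=> O [x Ox] oO; have [V [BV Vx] VO] := Bb x _ (open_nbhs_nbhs (conj oO Ox)).
  by exists (c V); split; [apply: VO; apply: cP; exists x|exists V].
move=> x y; have [g gP] := geodesic_exists fp compact_between x y.
by exists g => // q; exact: injective_path_geodesic.
Qed.

(** The complement of x is the union of the segments from the root to its points. They are connected
    and share the root, and the maximality of x keeps x off all of them. *)
Lemma leafP (x : X) : x != point ->
  (forall y, mdist point x + mdist x y = mdist point y -> y = x) -> leaf x.
Proof.
move=> x0 hx; split => //.
suff -> : ~` [set x] = \bigcup_(y in ~` [set x]) segment point y.
  apply: bigcup_connected.
    exists point => y _; apply/(segmentE fp compact_between).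
    by rewrite mdistxx add0r.
  by move=> y _; exact: (geodesic_segment_connected fp compact_between).
apply/seteqP; split => y yx.
  by exists y => //; apply/(segmentE fp compact_between); rewrite mdistxx addr0.
case: yx => z zx /(segmentE fp compact_between) pyz.
by move=> /= e; apply: zx; apply: hx; rewrite -e.
Qed.

End Rtree_criterion.

(** * Upper bounds for the Gromov-Hausdorff-Prokhorov distance *)

Section GHP_bounds.
Context {R : realType}.

Lemma nonexpansive_continuous (X Y : metricType R) (f : X -> Y) :
  (forall x y, mdist (f x) (f y) <= mdist x y) -> continuous f.
Proof.
move=> fi x; apply/metricType_numDomainType.cvgrPdist_lt => e e0.
near=> z; apply: le_lt_trans (fi _ _) _; near: z.
by apply: (@metricType_numDomainType.cvgr_dist_lt _ _ _ (nbhs x) _ id) => //; exact: cvg_id.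
Unshelve. all: by end_near. Qed.

Lemma isometric_continuous (X Y : metricType R) (f : X -> Y) :
  isometric f -> continuous f.
Proof. by move=> fi; apply: nonexpansive_continuous => x y; rewrite fi. Qed.

Lemma open_thick (M : metricType R) (e : R) (A : set M) : open (thick e A).
Proof.
rewrite openE => y [x Ax xy]; apply: filterS (nbhsx_ballx y (e - mdist x y) _).
  move=> z; rewrite ballEmdist /= => yz; exists x => //.
  by apply: le_lt_trans (metric_triangle x y z) _; lra.
by rewrite subr_gt0.
Qed.

Lemma open_borel (X : rootedMetricType R) (U : set X) :
  open U -> measurable (U : set (borel X)).
Proof. by move=> oU; exact: sub_sigma_algebra. Qed.

Lemma closed_borel (X : rootedMetricType R) (C : set X) :
  closed C -> measurable (C : set (borel X)).
Proof.
move=> cC; rewrite -[C]setCK; apply: measurableC; apply: open_borel.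
exact: closed_openC.
Qed.

Lemma dGHP_le (X Y : weighted R) (M : metricType R) (f : X -> M) (g : Y -> M)
    (e : R) :
  isometric f -> isometric g -> 0 < e -> mdist (f point) (g point) <= e ->
  (forall x, exists y, mdist (f x) (g y) < e) ->
  (forall y, exists x, mdist (f x) (g y) < e) ->
  (forall C : set M, closed C ->
    (wmass X (f @^-1` C) <= wmass Y (g @^-1` thick e C) + e%:E /\
     wmass Y (g @^-1` C) <= wmass X (f @^-1` thick e C) + e%:E)%E) ->
  (dGHP X Y <= e%:E)%E.
Proof.
move=> fi gi e0 rfg fg gf mfg.
apply: le_trans (ereal_inf_lbound (ex_intro _ M (ex_intro _ f
  (ex_intro _ g (And3 fi gi erefl))))) _.
rewrite !ge_max lee_fin rfg /=; apply/andP; split; apply: ereal_inf_lbound.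
  exists e => //; split => // [_ [x _ <-]|_ [y _ <-]].
    by have [y xy] := fg x; exists (g y); [exists y|rewrite metric_sym].
  by have [x xy] := gf y; exists (f x) => //; exists x.
by exists e.
Qed.

Lemma dGHP_ge0 (X Y : weighted R) : (0 <= dGHP X Y)%E.
Proof.
apply: le_ereal_inf_tmp => _ [M [f [g [_ _ ->]]]].
by rewrite le_max lee_fin mdist_ge0.
Qed.

End GHP_bounds.

Definition glue (X Y : Type) : Type := X + Y.

HB.instance Definition _ X Y := gen_eqMixin (glue X Y).
HB.instance Definition _ X Y := gen_choiceMixin (glue X Y).

Section glue.
Context {R : realType} (X Y : metricType R) (I : Type).
Variables (a : I -> X) (b : I -> Y) (i0 : I) (dlt : R).
Hypothesis dlt0 : 0 < dlt.
Hypothesis dab : forall i j, `|mdist (a i) (a j) - mdist (b i) (b j)| <= dlt.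

(** Each [a i] is joined to [b i] by a bridge of length [dlt], and this is the shortest way over one
    bridge. The positive length keeps X and Y apart, which makes the glued distance a metric; [i0]
    makes the infimum run over a nonempty set. *)
Let cross x y := inf [set mdist x (a i) + dlt + mdist (b i) y | i in setT].

Let cross_le x y i : cross x y <= mdist x (a i) + dlt + mdist (b i) y.
Proof.
apply: ge_inf; last by exists i.
by exists 0 => _ [j _ <-]; rewrite !addr_ge0 ?mdist_ge0// ltW.
Qed.

Let cross_ge x y c :
  (forall i, c <= mdist x (a i) + dlt + mdist (b i) y) -> c <= cross x y.
Proof.
move=> h; apply: lb_le_inf; last by move=> _ [i _ <-].
by exists (mdist x (a i0) + dlt + mdist (b i0) y); exists i0.
Qed.

Definition glue_dist (u v : glue X Y) : R :=
  match u, v with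
  | inl x, inl x' => mdist x x'
  | inr y, inr y' => mdist y y'
  | inl x, inr y | inr y, inl x =>
      inf [set mdist x (a i) + dlt + mdist (b i) y | i in setT]
  end.

Let cross_gt0 x y : 0 < cross x y.
Proof.
apply: lt_le_trans dlt0 _; apply: cross_ge => i.
by have := mdist_ge0 x (a i); have := mdist_ge0 (b i) y => *; lra.
Qed.

Let dist_xx u : glue_dist u u = 0.
Proof. by case: u => ? /=; rewrite mdistxx. Qed.

Let dist_pos u v : glue_dist u v = 0 -> u = v.
Proof.
case: u v => [x|y] [x'|y'] /= e; first [by congr (_ _); exact: mdist_positivity
  | by have := @cross_gt0 x y'; rewrite /cross e ltxx
  | by have := @cross_gt0 x' y; rewrite /cross e ltxx].
Qed.

Let dist_sym u v : glue_dist u v = glue_dist v u.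
Proof. by case: u v => [x|y] [x'|y'] //=; rewrite metric_sym. Qed.

Let crossX x x' y : cross x y <= mdist x x' + cross x' y.
Proof.
rewrite -lerBlDl; apply: cross_ge => i; rewrite lerBlDl.
have := cross_le x y i; have := metric_triangle x x' (a i) => *; lra.
Qed.

Let crossY x y y' : cross x y <= mdist y y' + cross x y'.
Proof.
rewrite -lerBlDl; apply: cross_ge => i; rewrite lerBlDl.
have := cross_le x y i; have := metric_triangle (b i) y' y.
by rewrite (metric_sym y' y) => *; lra.
Qed.

(** A detour through Y crosses two bridges, whose total length [2 * dlt] outweighs the distortion
    allowed by [dab]. *)
Let dXX x x' y : mdist x x' <= cross x y + cross x' y.
Proof.
rewrite -lerBlDr; apply: cross_ge => i; rewrite lerBlDr -lerBlDl.
apply: cross_ge => j.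
have := metric_triangle x (a i) x'; have := metric_triangle (a i) (a j) x'.
have := metric_triangle (b i) y (b j); have := dab i j; rewrite ler_norml.
by rewrite (metric_sym (a j) x') (metric_sym y (b j)) => /andP[*]; lra.
Qed.

Let dYY x y y' : mdist y y' <= cross x y + cross x y'.
Proof.
rewrite -lerBlDr; apply: cross_ge => i; rewrite lerBlDr -lerBlDl.
apply: cross_ge => j.
have := metric_triangle y (b i) y'; have := metric_triangle (b i) (b j) y'.
have := metric_triangle (a i) x (a j); have := dab i j; rewrite ler_norml.
by rewrite (metric_sym (a i) x) (metric_sym y (b i)) => /andP[*]; lra.
Qed.

Let dist_tri v u w : glue_dist u w <= glue_dist u v + glue_dist v w.
Proof.
case: u v w => [x|y] [x'|y'] [x''|y''] /=; rewrite -?/(cross _ _);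
  try exact: metric_triangle.
- exact: crossX.
- exact: dXX.
- by rewrite addrC metric_sym; exact: crossY.
- by rewrite addrC metric_sym; exact: crossX.
- exact: dYY.
- exact: crossY.
Qed.

Definition glue_metric : metricType R := HB.pack (glue X Y)
  (isMetric.Build R (glue X Y) dist_xx dist_pos dist_sym dist_tri).

Lemma glue_metricE (u v : glue_metric) : mdist u v = glue_dist u v.
Proof. by []. Qed.

Lemma glue_dist_le x y i : glue_dist (inl x) (inr y) <=
  mdist x (a i) + dlt + mdist (b i) y.
Proof. exact: cross_le. Qed.

End glue.

(** Both trees are partitioned into cells with labels in [I] and one centre per label. The mass of a
    set of labels is a set function [mX] that only sandwiches Borel sets, as the union of the cells
    in an arbitrary S is not known to be Borel. Points of equal label are within [3 * dlt]: a
    centre, a bridge, a centre; the constant 4 gives the strict inequalities. *)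
Lemma dGHP_cells (R : realType) (X Y : weighted R) (I : Type)
    (a : I -> X) (b : I -> Y) (cX : X -> I) (cY : Y -> I)
    (mX mY : set I -> \bar R) (i0 : I) (dlt : R) :
  0 < dlt ->
  (forall i j, `|mdist (a i) (a j) - mdist (b i) (b j)| <= dlt) ->
  a i0 = point -> b i0 = point ->
  (forall x, mdist x (a (cX x)) <= dlt) ->
  (forall y, mdist y (b (cY y)) <= dlt) ->
  (forall (B : set (borel X)) S, measurable B ->
    ((B `<=` cX @^-1` S -> wmass X B <= mX S) /\
     (cX @^-1` S `<=` B -> mX S <= wmass X B))%E) ->
  (forall (B : set (borel Y)) S, measurable B ->
    ((B `<=` cY @^-1` S -> wmass Y B <= mY S) /\
     (cY @^-1` S `<=` B -> mY S <= wmass Y B))%E) ->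
  (forall S, mX S <= mY S + dlt%:E /\ mY S <= mX S + dlt%:E)%E ->
  (dGHP X Y <= (4 * dlt)%:E)%E.
Proof.
move=> d0 dab ai0 bi0 da db mXP mYP mXY.
pose M := glue_metric i0 d0 dab.
have near x y : cX x = cY y -> mdist (inl x : M) (inr y : M) < 4 * dlt.
  move=> xy; rewrite glue_metricE.
  apply: le_lt_trans (@glue_dist_le R X Y I a b dlt d0 _ _ (cX x)) _.
  have := db y; have := da x; rewrite -xy (metric_sym y) => *; lra.
apply: (@dGHP_le _ _ _ M inl inr) => //.
- by rewrite mulr_gt0.
- rewrite glue_metricE; apply: le_trans (@glue_dist_le R X Y I a b dlt d0 _ _ i0) _.
  by rewrite ai0 bi0 !mdistxx; lra.
- move=> x; exists (b (cX x)); rewrite glue_metricE.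
  apply: le_lt_trans (@glue_dist_le R X Y I a b dlt d0 _ _ (cX x)) _.
  by rewrite mdistxx; have := da x => *; lra.
- move=> y; exists (a (cY y)); rewrite glue_metricE.
  apply: le_lt_trans (@glue_dist_le R X Y I a b dlt d0 _ _ (cY y)) _.
  by rewrite mdistxx metric_sym; have := db y => *; lra.
have il : isometric (inl : X -> M) by [].
have ir : isometric (inr : Y -> M) by [].
have cl := isometric_continuous il; have cr := isometric_continuous ir.
have eC : (dlt%:E <= (4 * dlt)%:E)%E by rewrite lee_fin; lra.
move=> C cC.
have mlC : measurable ((inl @^-1` C : set X) : set (borel X)).
  by apply: closed_borel; apply: (@closed_comp X M inl) => // x _; exact: cl.
have mrC : measurable ((inr @^-1` C : set Y) : set (borel Y)).
  by apply: closed_borel; apply: (@closed_comp Y M inr) => // x _; exact: cr.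
have mlT : measurable ((inl @^-1` thick (4 * dlt) C : set X) : set (borel X)).
  by apply: open_borel; apply: (@open_comp X M inl) => [x _|]; [exact: cl|exact: open_thick].
have mrT : measurable ((inr @^-1` thick (4 * dlt) C : set Y) : set (borel Y)).
  by apply: open_borel; apply: (@open_comp Y M inr) => [x _|]; [exact: cr|exact: open_thick].
split.
(* The closed set is enlarged to the union of the cells that it meets, which the thickening still
   contains on the other side. *)
- have [+ _] := mXP _ (cX @` (inl @^-1` C)) mlC.
  move=> /(_ _)/le_trans; apply; first by move=> x Cx; exists x.
  apply: le_trans (mXY _).1 _; apply: leeD => //; apply: (mYP _ _ mrT).2.
  by move=> y [x Cx xy]; exists (inl x) => //; exact: near.
- have [+ _] := mYP _ (cY @` (inr @^-1` C)) mrC.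
  move=> /(_ _)/le_trans; apply; first by move=> y Cy; exists y.
  apply: le_trans (mXY _).2 _; apply: leeD => //; apply: (mXP _ _ mlT).2.
  by move=> x [y Cy xy]; exists (inr y) => //; rewrite metric_sym; exact: near.
Qed.

(** * The trees of the construction *)

Lemma line_four_point (R : realType) (x y z t : R) :
  `|x - y| + `|z - t| <= `|x - z| + `|y - t| \/
  `|x - y| + `|z - t| <= `|x - t| + `|y - z|.
Proof.
have := ler_norm (x - z); have := ler_norm (x - t).
have := ler_norm (y - z); have := ler_norm (y - t).
have := ler_norm (z - x); have := ler_norm (t - x).
have := ler_norm (z - y); have := ler_norm (t - y).
rewrite (distrC t x) (distrC z x) (distrC t y) (distrC z y).
by case: (lerP x y) => ?; case: (lerP z t) => ? *;
  first [by left; lra | by right; lra].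
Qed.

Section finite_trees.
Context {R : realType}.
Variables (beta : R) (s : nat -> beads R) (J : nat -> nat * R).

Local Notation pts := (tree_pts s J).
Local Notation dist := (tree_dist beta s J).
Local Notation w := (weight s J).
Local Notation sc := (scale beta s J).

Lemma tree_pts_leq m k u : (m <= k)%N -> pts m u -> pts k u.
Proof.
move=> /subnKC <-; elim: (k - m)%N => [|n IH]; first by rewrite addn0.
by move=> /IH /tree_pts_sub; rewrite addnS.
Qed.

Lemma tree_distxx k u : pts k u -> dist k u u = 0.
Proof. by have [h _ _ _] := tree_dist_metric beta s J k; exact: h. Qed.

Lemma tree_dist_pos k u v : pts k u -> pts k v -> dist k u v = 0 -> u = v.
Proof. by have [_ h _ _] := tree_dist_metric beta s J k; exact: h. Qed.

Lemma tree_dist_sym k u v : pts k u -> pts k v -> dist k u v = dist k v u.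
Proof. by have [_ _ h _] := tree_dist_metric beta s J k; exact: h. Qed.

Lemma tree_dist_triangle k v u z : pts k u -> pts k v -> pts k z ->
  dist k u z <= dist k u v + dist k v z.
Proof. by have [_ _ _ h] := tree_dist_metric beta s J k; exact: h. Qed.

Lemma tree_dist_ge0 k u v : pts k u -> pts k v -> 0 <= dist k u v.
Proof.
move=> hu hv; have := tree_dist_triangle hu hv hu.
by rewrite tree_distxx// (tree_dist_sym hv hu) => ?; lra.
Qed.

Lemma tree_pts_J k : 0 < w k.+1 -> pts k (J k).
Proof. by have [_] := tree_mu_out s J k. Qed.

Lemma tree_pts_new k t : 0 < t <= bead_len (s k.+1) -> 0 < w k.+1 ->
  pts k.+1 (k.+1, t).
Proof. by move=> /andP[t0 tl] w0; split => //=; rewrite (ltW t0). Qed.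

Lemma tree_pts_root k : pts k (0%N, 0).
Proof. by split => //=; rewrite lexx ltW// bead_len_gt0. Qed.

Lemma tree_pts_neqS k u : pts k u -> (u.1 == k.+1) = false.
Proof. by move=> [uk _ _]; apply/negbTE; rewrite neq_ltn ltnS uk. Qed.

Lemma tree_dist_stable k u v : pts k u -> pts k v -> dist k.+1 u v = dist k u v.
Proof. by move=> /tree_pts_neqS eu /tree_pts_neqS ev; rewrite tree_distS eu ev. Qed.

(* [p] is the point of the tree at level [k] from which [u] is reached, and [q]
   is the distance between them. *)
Lemma tree_pts_base k u : pts k.+1 u -> exists b p q,
  [/\ b = (u.1 == k.+1), pts k p, 0 <= q,
     (if b then p = J k /\ q = sc k.+1 * u.2 else p = u /\ q = 0) &
     b -> 0 < w k.+1].
Proof.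
case/tree_pts_cases => [[-> [u0 w0]]|[e hu]].
  exists true, (J k), (sc k.+1 * u.2); rewrite eqxx; split => //.
    exact: tree_pts_J.
  by rewrite mulr_ge0 ?scale_ge0// ltW.
by exists false, u, 0; rewrite e.
Qed.

(** The sixteen cases say which of the four points lie on the newest copy. With three or four of
    them there, the condition is that of a line, a point of the old tree counting as coordinate 0.
    Otherwise the heights above [J k] cancel, or the induction hypothesis applies to the feet. *)
Lemma tree_dist_four_point k x y z t : pts k x -> pts k y -> pts k z -> pts k t ->
  dist k x y + dist k z t <= dist k x z + dist k y t \/
  dist k x y + dist k z t <= dist k x t + dist k y z.
Proof.
elim: k x y z t => [|k IH] x y z t.
  by move=> _ _ _ _; exact: line_four_point.
have c0 := scale_ge0 beta s J k.+1.
have cM a b : sc k.+1 * `|a - b| = `|sc k.+1 * a - sc k.+1 * b|.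
  by rewrite -mulrBr normrM (ger0_norm c0).
move=> /tree_pts_base[bx [px [qx [ex hx qx0 xE wx]]]].
move=> /tree_pts_base[by_ [py [qy [ey hy qy0 yE wy]]]].
move=> /tree_pts_base[bz [pz [qz [ez hz qz0 zE wz]]]].
move=> /tree_pts_base[bt [pt [qt [et ht qt0 tE wt]]]].
have := IH px py pz pt hx hy hz ht.
rewrite !tree_distS -ex -ey -ez -et !cM.
case: bx ex xE wx => ex [? ?] wx; case: by_ ey yE wy => ey [? ?] wy;
case: bz ez zE wz => ez [? ?] wz; case: bt et tE wt => et [? ?] wt; subst;
rewrite ?(tree_dist_sym _ (tree_pts_J (wx isT)))
        ?(tree_dist_sym _ (tree_pts_J (wy isT)))
        ?(tree_dist_sym _ (tree_pts_J (wz isT))) ?tree_distxx//.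
all: move: (sc k.+1 * x.2) (sc k.+1 * y.2) (sc k.+1 * z.2) (sc k.+1 * t.2)
  qx0 qy0 qz0 qt0 => X Y Z T X0 Y0 Z0 T0.
all: have hD (a b : R) : 0 <= a -> 0 <= b -> `|a - b| <= a + b
  by move=> *; rewrite ler_norml; apply/andP; split; lra.
- by move=> _; exact: line_four_point.
- by move=> _; case: (line_four_point X Y Z 0); rewrite !subr0  ?(ger0_norm X0) ?(ger0_norm Y0) ?(ger0_norm Z0) ?(ger0_norm T0) => ?;
    [left|right]; lra.
- by move=> _; case: (line_four_point X Y 0 T); rewrite !(subr0, sub0r, normrN)  ?(ger0_norm X0) ?(ger0_norm Y0) ?(ger0_norm Z0) ?(ger0_norm T0) => ?;
    [left|right]; lra.
- by have h : `|X - Y| <= X + Y by [exact: hD]; case=> ?; left; lra.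
- by move=> _; case: (line_four_point X 0 Z T); rewrite !(subr0, sub0r, normrN)  ?(ger0_norm X0) ?(ger0_norm Y0) ?(ger0_norm Z0) ?(ger0_norm T0) => ?;
    [left|right]; lra.
- by move=> _; right; lra.
- by move=> _; left; lra.
- by case=> ?; [left|right]; lra.
- by move=> _; case: (line_four_point 0 Y Z T); rewrite !(subr0, sub0r, normrN)  ?(ger0_norm X0) ?(ger0_norm Y0) ?(ger0_norm Z0) ?(ger0_norm T0) => ?;
    [left|right]; lra.
- by move=> _; left; lra.
- by move=> _; right; lra.
- by case=> ?; [left|right]; lra.
- by have h : `|Z - T| <= Z + T by [exact: hD]; case=> ?; left; lra.
- by case=> ?; [left|right]; lra.
- by case=> ?; [left|right]; lra.
Qed.

End finite_trees.

Section finite_trees_projection.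
Context {R : realType}.
Variables (beta : R) (s : nat -> beads R) (J : nat -> nat * R).

Local Notation pts := (tree_pts s J).
Local Notation dist := (tree_dist beta s J).
Local Notation mu := (tree_mu s J).
Local Notation w := (weight s J).
Local Notation sc := (scale beta s J).

Lemma tree_dist_between k x y t : pts k x -> pts k y -> 0 <= t <= dist k x y ->
  exists z, [/\ pts k z, dist k x z = t & dist k z y = dist k x y - t].
Proof.
elim: k x y t => [|k IH] x y t.
  case: x y => [i x] [j y] [/= + xI _] [/= + yI _].
  rewrite !leqn0 => /eqP i0 /eqP j0; subst; rewrite /= in xI yI *.
  move: xI yI => /andP[x0 xl] /andP[y0 yl].
  case: (lerP x y) => xy /andP[t0 txy].
    exists (0%N, x + t); split => /=.
    - by split => //=; apply/andP; split; lra.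
    - by rewrite opprD addrA subrr sub0r normrN ger0_norm.
    - by rewrite distrC ger0_norm; lra.
  exists (0%N, x - t); split => /=.
  - by split => //=; apply/andP; split; lra.
  - by rewrite ger0_norm; lra.
  - by rewrite ger0_norm; lra.
(* From u on the newest copy to v in the old tree: the point is still on the copy while r is less
   than the height of u, and beyond [J k] afterwards. *)
have new_old u v r : u.1 = k.+1 -> 0 < u.2 -> pts k.+1 u -> 0 < w k.+1 -> pts k v ->
    0 <= r <= sc k.+1 * u.2 + dist k (J k) v ->
    exists z, [/\ pts k.+1 z, dist k.+1 u z = r &
      dist k.+1 z v = sc k.+1 * u.2 + dist k (J k) v - r].
  move=> eu u0 hu w0 hv /andP[r0 rl]; have hJ := tree_pts_J w0.
  have c0 : 0 < sc k.+1 by rewrite scale_gt0.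
  have [ru|ru] := ltP r (sc k.+1 * u.2).
    have rc : 0 <= r / sc k.+1 < u.2.
      by rewrite divr_ge0 ?(ltW c0)//= ltr_pdivrMr// mulrC.
    case: hu => _ /andP[_]; rewrite eu => ul _.
    exists (k.+1, u.2 - r / sc k.+1); split.
    - by apply: tree_pts_new => //; move: rc => /andP[? ?]; apply/andP; split; lra.
    - rewrite tree_distS eu eqxx /= opprB addrCA subrr addr0.
      by rewrite ger0_norm ?(andP rc).1// mulrC divfK// gt_eqF.
    - rewrite tree_distS /= eqxx (tree_pts_neqS hv) mulrBr.
      by rewrite [sc _ * (r / _)]mulrC divfK ?gt_eqF//; lra.
  have [|z [hz z1 z2]] := IH (J k) v (r - sc k.+1 * u.2) hJ hv.
    by apply/andP; split; lra.
  exists z; split; first exact: tree_pts_sub.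
  - by rewrite tree_distS eu eqxx (tree_pts_neqS hz) z1; lra.
  - by rewrite tree_dist_stable// z2; lra.
move=> hx hy.
case: (tree_pts_cases hx) => [[ex [x0 w0]]|[ex hx']];
case: (tree_pts_cases hy) => [[ey [y0 w1]]|[ey hy']].
- have c0 : 0 < sc k.+1 by rewrite scale_gt0.
  rewrite tree_distS ex ey eqxx => /andP[t0 tl].
  move: (hx) (hy) => [_ /andP[_ +] _] [_ /andP[_ +] _]; rewrite ex ey => xl yl.
  have tc0 : 0 <= t / sc k.+1 by rewrite divr_ge0// ltW.
  have tcl : t / sc k.+1 <= `|x.2 - y.2| by rewrite ler_pdivrMr// mulrC.
  have tcE : sc k.+1 * (t / sc k.+1) = t by rewrite mulrC divfK// gt_eqF.
  move: (t / sc k.+1) tc0 tcl tcE tl => r r0 + <- _.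
  case: (lerP x.2 y.2) => xy rl.
    exists (k.+1, x.2 + r); rewrite !tree_distS ex ey /= eqxx; split.
    - by apply: tree_pts_new => //; apply/andP; split; lra.
    - by rewrite opprD addrA subrr sub0r normrN ger0_norm.
    - by rewrite -mulrBr distrC ger0_norm; [congr (_ * _)|]; lra.
  exists (k.+1, x.2 - r); rewrite !tree_distS ex ey /= eqxx; split.
  - by apply: tree_pts_new => //; apply/andP; split; lra.
  - by rewrite opprB addrCA subrr addr0 ger0_norm.
  - by rewrite -mulrBr ger0_norm; [congr (_ * _)|]; lra.
- rewrite tree_distS ex eqxx ey => tI; exact: new_old.
- move=> /andP[t0 tl].
  have E : dist k.+1 x y = sc k.+1 * y.2 + dist k (J k) x.
    rewrite tree_distS ex ey eqxx addrC (tree_dist_sym beta hx')//; exact: tree_pts_J.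
  (* Here the new point is the target y, so the distance is measured from the other end. *)
  have [|z [hz z1 z2]] := @new_old y x (dist k.+1 x y - t) ey y0 hy w1 hx'.
    by rewrite E in tl *; apply/andP; split; lra.
  exists z; split => //.
  - by rewrite tree_dist_sym// z2 E; lra.
  - by rewrite tree_dist_sym// z1.
- rewrite tree_dist_stable// => /(IH _ _ _ hx' hy')[z [hz z1 z2]].
  exists z; split; first exact: tree_pts_sub.
  - by rewrite tree_dist_stable.
  - by rewrite tree_dist_stable.
Qed.

(** The bonding map of the inverse system: the newest copy is collapsed to its attachment point. *)
Definition tree_proj k (u : nat * R) := if u.1 == k.+1 then J k else u.

Local Notation proj := (tree_proj).

Lemma proj_old k u : pts k u -> proj k u = u.
Proof. by rewrite /tree_proj => /tree_pts_neqS ->. Qed.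

Lemma tree_pts_proj k u : pts k.+1 u -> pts k (proj k u).
Proof.
rewrite /tree_proj; case/tree_pts_cases => [[-> [_ w0]]|[-> //]].
by rewrite eqxx; exact: tree_pts_J.
Qed.

Lemma tree_dist_proj k u v : pts k.+1 u -> pts k.+1 v -> proj k u != proj k v ->
  dist k.+1 u v = dist k.+1 u (proj k u) + dist k (proj k u) (proj k v) +
    dist k.+1 v (proj k v).
Proof.
rewrite /tree_proj => hu hv.
case: (tree_pts_cases hu) => [[eu [u0 w0]]|[eu hu']];
case: (tree_pts_cases hv) => [[ev [v0 w1]]|[ev hv']];
rewrite ?eu ?ev ?eqxx// => _.
- have hJ := tree_pts_J w0.
  rewrite !tree_distS eu eqxx ev !(tree_pts_neqS hJ).
  by rewrite !tree_distxx// ?addr0//; exact: tree_pts_J.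
- have hJ := tree_pts_J w1.
  rewrite !tree_distS ev eqxx eu !(tree_pts_neqS hJ).
  by rewrite !tree_distxx// ?addr0 ?add0r//; exact: tree_pts_J.
- by rewrite !tree_dist_stable// !tree_distxx// add0r addr0.
Qed.

Lemma tree_dist_proj_le k u v : pts k.+1 u -> pts k.+1 v ->
  dist k (proj k u) (proj k v) <= dist k.+1 u v.
Proof.
move=> hu hv; have [->|ne] := eqVneq (proj k u) (proj k v).
  by rewrite tree_distxx ?tree_dist_ge0//; exact: tree_pts_proj.
rewrite (tree_dist_proj hu hv ne).
have := tree_dist_ge0 beta hu (tree_pts_sub (tree_pts_proj hu)).
have := tree_dist_ge0 beta hv (tree_pts_sub (tree_pts_proj hv)).
by move=> *; lra.
Qed.

Lemma tree_mu_le1 k A : (mu k A <= 1)%E.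
Proof. by rewrite -(tree_mu_setT s J k); exact: tree_mu_le. Qed.

Lemma tree_mu_pts k A : mu k A = mu k (A `&` pts k).
Proof.
apply/eqP; rewrite eq_le; apply/andP; split; last by apply: tree_mu_le => ? [].
have [out _] := tree_mu_out s J k.
apply: (@le_trans _ _ (mu k ((A `&` pts k) `|` ~` pts k))).
  by apply: tree_mu_le => u Au; have [?|?] := pselect (pts k u); [left|right].
apply: le_trans (measureU2 _ (measurable_places _) (measurable_places _)) _.
by rewrite [X in (_ + X)%E](_ : _ = 0%E) ?adde0//; exact: out.
Qed.

Lemma weightE k : (w k.+1)%:E = mu k [set J k].
Proof. by rewrite /weight /= fineK// tree_mu_fin. Qed.

Lemma weight_le1 j : w j <= 1.
Proof. by case: j => [|k] //; rewrite -lee_fin weightE tree_mu_le1. Qed.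

Lemma proj_emb k x : 0 < w k.+1 -> proj k (emb J k.+1 x) = J k.
Proof.
move=> w0; rewrite /emb; case: eqVneq => _; last by rewrite /tree_proj eqxx.
exact/proj_old/tree_pts_J.
Qed.

(** The masses form a projective system: the new copy has total mass that of the atom it replaces,
    and collapses back to it. *)
Lemma tree_mu_proj k (A : set (nat * R)) : mu k.+1 (proj k @^-1` A) = mu k A.
Proof.
rewrite tree_muS.
have -> : mu k (proj k @^-1` A `&` ~` [set J k]) = mu k (A `&` ~` [set J k]).
  rewrite tree_mu_pts [in RHS]tree_mu_pts; congr (mu k _).
  apply/seteqP; split => u [[/= Au Ju] hu]; split => //; split => //.
    by rewrite (proj_old hu) in Au.
  by rewrite /= (proj_old hu).
have [w0|w0] := ltP 0 (w k.+1); last first.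
  have {}w0 : w k.+1 = 0 by apply/eqP; rewrite eq_le w0 weight_ge0.
  rewrite w0 mul0e adde0; apply/eqP; rewrite eq_le tree_mu_le//=.
  apply: (@le_trans _ _ (mu k ((A `&` ~` [set J k]) `|` [set J k]))).
    by apply: tree_mu_le => u Au; have [?|?] := pselect (u = J k); [right|left].
  apply: le_trans (measureU2 _ (measurable_places _) (measurable_places _)) _.
  by rewrite [X in (_ + X)%E](_ : _ = 0%E) ?adde0// -[LHS]weightE w0.
have [AJ|AJ] := pselect (A (J k)).
  have -> : bead_image (s k.+1) (emb J k.+1) (proj k @^-1` A) = 1%E.
    rewrite bead_imageE -(bead_mass_sum (s k.+1)); apply: eq_eseriesr => i _.
    by rewrite diracE mem_set ?mule1//= proj_emb.
  rewrite mule1 weightE -measureU; [|exact: measurable_places..|].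
    congr (mu k _); apply/seteqP; split => [u [[]//|->//]|u Au].
    by have [?|?] := pselect (u = J k); [right|left].
  by rewrite -subset0 => u [[_ /=]].
rewrite bead_image_eq0 ?mule0 ?adde0.
  congr (mu k _); apply/seteqP; split => [u []//|u Au].
  by split => // /= e; apply: AJ; rewrite -e.
by move=> i /=; rewrite proj_emb.
Qed.

End finite_trees_projection.

(** * The limit tree *)

Section limit_tree.
Context {R : realType}.
Variables (eta beta : R) (s : nat -> beads R) (J : nat -> nat * R).

Local Notation pts := (tree_pts s J).
Local Notation dist := (tree_dist beta s J).
Local Notation sc := (scale beta s J).
Local Notation proj := (tree_proj J).

(* The generation of the [j]-th copy; [minn] only matters when [J k] is not in
   the tree, and makes the recursion well founded. *)
Fixpoint generation_rec n j : nat :=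
  if n is n'.+1 then
    if j is k.+1 then (generation_rec n' (minn k (J k).1)).+1 else 0%N
  else 0%N.

Definition generation j := generation_rec j j.

Lemma generation_fuel n j : (j <= n)%N -> generation_rec n j = generation j.
Proof.
rewrite /generation; suff H m : (forall i n, i <= m -> i <= n ->
  generation_rec n i = generation_rec i i)%N by move=> ?; exact: (H j).
elim: m => [|m IH] [|i] [|{}n] //= im ni; rewrite IH ?(IH _ i) ?geq_minl//.
- by rewrite (leq_trans (geq_minl _ _)).
- by rewrite (leq_trans (geq_minl _ _)).
- by rewrite (leq_trans (geq_minl _ _)).
Qed.

Lemma generationS k : generation k.+1 = (generation (minn k (J k).1)).+1.
Proof. by rewrite [LHS]/generation /= generation_fuel// geq_minl. Qed.

Definition height j := sc j * bead_len (s j).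

(* The generations increase along a line of descent, so that the heights of the
   copies attached after step [k] add up to at most [c] on each of them. *)
Definition controlled k c :=
  forall j, (k < j)%N -> height j <= c * (1 - eta) * eta ^+ generation j.

(** The limit tree and the convergence to it are deterministic consequences of this property. *)
Definition good := forall e, 0 < e -> exists k, controlled k e.

Hypothesis eta01 : 0 < eta < 1.

Fixpoint down m n (u : nat * R) :=
  if m is m'.+1 then proj n (down m' n.+1 u) else u.

Lemma tree_pts_down m n u : pts (n + m) u -> pts n (down m n u).
Proof.
elim: m n => [|m IH] n; first by rewrite addn0.
by rewrite addnS -addSn => /IH; exact: tree_pts_proj.
Qed.

Lemma down_old m k u : pts k u -> down m k u = u.
Proof.
elim: m k => //= m IH k hu.
by rewrite IH ?(proj_old hu)//; exact: tree_pts_sub.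
Qed.

Lemma downS m n u : down m.+1 n u = down m n (proj (n + m) u).
Proof.
elim: m n => [|m IH] n; first by rewrite addn0.
by rewrite -[LHS]/(proj n (down m.+1 n.+1 u)) IH addSnnS.
Qed.

Lemma eta_exp n : 0 <= eta ^+ n <= 1.
Proof.
have /andP[e0 e1] := eta01.
by rewrite exprn_ge0 ?exprn_ile1 // ltW.
Qed.

(** The bound is a partial geometric sum: a copy attached in generation g + 1 adds at most
    [c * (1 - eta) * eta ^ (g + 1)] to the bound [c * (1 - eta ^ (g + 1))] of its attachment point,
    and the total is the bound for generation g + 1. *)
Lemma dist_down_le k c m u : 0 <= c -> controlled k c -> pts (k + m) u ->
  dist (k + m) u (down m k u) <= c * (1 - eta ^+ (generation u.1).+1).
Proof.
move=> c0 kc; elim: m u => [|m IH] u.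
  rewrite addn0 => hu; rewrite tree_distxx// mulr_ge0// subr_ge0.
  by have /andP[] := eta_exp (generation u.1).+1.
rewrite addnS => hu; rewrite downS.
have hd v : pts (k + m) v -> pts (k + m) (down m k v).
  by move=> hv; apply: (@tree_pts_leq _ _ _ k); [exact: leq_addr|exact: tree_pts_down].
case: (tree_pts_cases hu) => [[eu [u0 w0]]|[eu hu']]; last first.
  rewrite (proj_old hu') tree_dist_stable//; last exact: hd.
  exact: IH.
have hJ := tree_pts_J w0; have hdJ := hd _ hJ.
rewrite {1}/tree_proj eu eqxx tree_distS eu eqxx (tree_pts_neqS hdJ) generationS.
have -> : minn (k + m) (J (k + m)).1 = (J (k + m)).1.
  by apply/minn_idPr; case: hJ.
have h1 := IH _ hJ.
have h2 : sc (k + m).+1 * u.2 <= c * (1 - eta) * eta ^+ (generation (J (k + m)).1).+1.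
  have := kc (k + m).+1; rewrite ltnS leq_addr => /(_ isT).
  rewrite generationS (_ : minn _ _ = (J (k + m)).1); last first.
    by apply/minn_idPr; case: hJ.
  apply: le_trans; rewrite ler_wpM2l ?scale_ge0//.
  by case: hu => _ /andP[_]; rewrite eu.
rewrite exprS; move: h1 h2; move: (eta ^+ _) => E; lra.
Qed.

(* The limit tree is an inverse limit: [x k] is the projection of its point [x]
   onto the [k]-th tree. *)
Definition coherent (x : nat -> nat * R) :=
  forall k, pts k (x k) /\ proj k (x k.+1) = x k.

(** Truncated subtraction makes the sequence constant from level k on, which turns a point of the
    k-th tree into a coherent sequence. *)
Definition ancestors k u n := down (k - n) n u.

Lemma ancestors_coherent k u : pts k u -> coherent (ancestors k u).
Proof.
move=> hu n; rewrite /ancestors; split.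
  have [kn|/ltnW nk] := leqP k n.
    by rewrite (eqP kn); exact: tree_pts_leq hu.
  by apply: tree_pts_down; rewrite subnKC.
have [kn|nk] := leqP k n; last by rewrite -[in RHS](subnSK nk).
rewrite (eqP kn) (eqP (leqW kn)) /=; apply: proj_old; exact: tree_pts_leq hu.
Qed.

Lemma ancestors_geq k u n : (k <= n)%N -> ancestors k u n = u.
Proof. by rewrite /ancestors => /eqP ->. Qed.

Lemma coherent_down x m k : coherent x -> down m k (x (k + m)%N) = x k.
Proof.
move=> cx; elim: m k => [|m IH] k; first by rewrite addn0.
by rewrite addnS -addSn /= IH; have [_] := cx k.
Qed.


Lemma coherent_ancestors x k n : coherent x -> (n <= k)%N -> ancestors k (x k) n = x n.
Proof. by move=> cx nk; have := coherent_down (k - n) n cx; rewrite subnKC. Qed.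

Lemma coherent_dist_stable k n u v : (k <= n)%N -> pts k u -> pts k v ->
  dist n u v = dist k u v.
Proof.
move=> /subnKC <-; elim: (n - k)%N => [|m IH] hu hv; first by rewrite addn0.
rewrite addnS tree_dist_stable ?IH//; apply: tree_pts_leq; try eassumption;
exact: leq_addr.
Qed.

Section coherent_pair.
Variables (x y : nat -> nat * R).
Hypotheses (cx : coherent x) (cy : coherent y).

Lemma coherent_dist_homo m n : (m <= n)%N ->
  dist m (x m) (y m) <= dist n (x n) (y n).
Proof.
move=> /subnKC <-; elim: (n - m)%N => [|k IH]; first by rewrite addn0.
apply: le_trans IH _; rewrite addnS.
have [hx <-] := cx (m + k); have [hy <-] := cy (m + k).
by apply: tree_dist_proj_le; [have [] := cx (m + k).+1|have [] := cy (m + k).+1].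
Qed.

Lemma coherent_dist_trunc k c n : 0 <= c -> controlled k c -> (k <= n)%N ->
  dist n (x n) (x k) <= c.
Proof.
move=> c0 kc kn; have [hx _] := cx n.
rewrite -(coherent_down (n - k) k cx) subnKC//.
have := @dist_down_le k c (n - k) (x n) c0 kc; rewrite subnKC// => /(_ hx).
move=> /le_trans; apply; rewrite ler_piMr// lerBlDr lerDl.
  by have /andP[] := eta_exp (generation (x n).1).+1.
Qed.

End coherent_pair.

End limit_tree.

Section limit_space.
Context {R : realType}.
Variables (eta beta : R) (s : nat -> beads R) (J : nat -> nat * R).

Local Notation pts := (tree_pts s J).
Local Notation dist := (tree_dist beta s J).
Local Notation good := (good eta beta s J).
Local Notation controlled := (controlled eta beta s J).
Local Notation coherent := (coherent s J).

(** The two proofs are recorded in the type, where the metric instance finds them to show that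
    distances are finite. *)
Definition limit_tree (_ : 0 < eta < 1) (_ : good) : Type :=
  {x : nat -> nat * R | coherent x}.

Variables (eta01 : 0 < eta < 1) (g : good).
Local Notation T := (limit_tree eta01 g).

HB.instance Definition _ := gen_eqMixin T.
HB.instance Definition _ := gen_choiceMixin T.

Lemma limit_eqP (x y : T) : (forall n, sval x n = sval y n) -> x = y.
Proof.
case: x y => [x hx] [y hy] /= /funext e; case: _ / e hy => hy.
by rewrite (Prop_irrelevance hx hy).
Qed.

(** The distances between the projections increase with the level by [coherent_dist_homo], so this
    supremum is their limit. *)
Definition limit_dist (x y : T) : R :=
  sup [set dist n (sval x n) (sval y n) | n in setT].

Lemma limit_dist_trunc (x y : T) k c n : 0 <= c -> controlled k c ->
  dist n (sval x n) (sval y n) <= dist k (sval x k) (sval y k) + 2 * c.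
Proof.
move=> c0 kc; have cx := svalP x; have cy := svalP y.
have [nk|/ltnW kn] := leqP n k.
  have := coherent_dist_homo beta cx cy nk; lra.
have hx : pts n (sval x n) by have [] := cx n.
have hy : pts n (sval y n) by have [] := cy n.
have hxk : pts n (sval x k) by apply: tree_pts_leq kn _; have [] := cx k.
have hyk : pts n (sval y k) by apply: tree_pts_leq kn _; have [] := cy k.
have := coherent_dist_trunc eta01 cx c0 kc kn.
have := coherent_dist_trunc eta01 cy c0 kc kn.
have := tree_dist_triangle beta hx hxk hy.
have := tree_dist_triangle beta hxk hyk hy.
have [hx0 _] := cx k; have [hy0 _] := cy k.
by rewrite (tree_dist_sym beta hyk hy) (coherent_dist_stable beta kn hx0 hy0); lra.
Qed.

Lemma limit_dist_has_sup (x y : T) :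
  has_sup [set dist n (sval x n) (sval y n) | n in setT].
Proof.
have [k kc] := g ltr01.
split; first by exists (dist 0 (sval x 0%N) (sval y 0%N)); exists 0%N.
by exists (dist k (sval x k) (sval y k) + 2 * 1) => _ [n _ <-]; exact: limit_dist_trunc.
Qed.

Lemma limit_dist_ge (x y : T) n : dist n (sval x n) (sval y n) <= limit_dist x y.
Proof. by apply: sup_upper_bound; [exact: limit_dist_has_sup|exists n]. Qed.

Lemma limit_dist_le (x y : T) c :
  (forall n, dist n (sval x n) (sval y n) <= c) -> limit_dist x y <= c.
Proof.
move=> h; apply: ge_sup; last by move=> _ [n _ <-].
by have [] := limit_dist_has_sup x y.
Qed.

Let dist_xx x : limit_dist x x = 0.
Proof.
apply/eqP; rewrite eq_le; apply/andP; split.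
  by apply: limit_dist_le => n; rewrite tree_distxx//; have [] := svalP x n.
apply: le_trans (limit_dist_ge x x 0).
by rewrite tree_distxx//; have [] := svalP x 0%N.
Qed.

Let dist_pos x y : limit_dist x y = 0 -> x = y.
Proof.
move=> xy0; apply: limit_eqP => n.
have hx : pts n (sval x n) by have [] := svalP x n.
have hy : pts n (sval y n) by have [] := svalP y n.
apply: (tree_dist_pos hx hy (beta := beta)); apply/eqP.
by rewrite eq_le tree_dist_ge0// -xy0 limit_dist_ge.
Qed.

Let dist_sym x y : limit_dist x y = limit_dist y x.
Proof.
have E n : dist n (sval x n) (sval y n) = dist n (sval y n) (sval x n).
  by apply: tree_dist_sym; [have [] := svalP x n|have [] := svalP y n].
by rewrite /limit_dist; congr sup; apply/seteqP; split => _ [n _ <-]; exists n.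
Qed.

Let dist_tri y x z : limit_dist x z <= limit_dist x y + limit_dist y z.
Proof.
apply: limit_dist_le => n; apply: le_trans (lerD (limit_dist_ge x y n) (limit_dist_ge y z n)).
apply: tree_dist_triangle.
- by have [] := svalP x n.
- by have [] := svalP y n.
- by have [] := svalP z n.
Qed.

HB.instance Definition _ := isMetric.Build R T dist_xx dist_pos dist_sym dist_tri.

Lemma limit_distE (x y : T) : mdist x y = limit_dist x y. Proof. by []. Qed.

Definition node k u (hu : pts k u) : T := exist _ (ancestors J k u) (ancestors_coherent hu).

HB.instance Definition _ := isPointed.Build T (node (tree_pts_root s J 0)).

Lemma limit_pointE n : sval (point : T) n = (0%N, 0).
Proof. by rewrite /= ancestors_geq. Qed.

Lemma limit_coherent (x : T) n : pts n (sval x n).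
Proof. by have [] := svalP x n. Qed.

Definition retract k (x : T) : T := node (limit_coherent x k).

Lemma retract_le k (x : T) n : (n <= k)%N -> sval (retract k x) n = sval x n.
Proof. by move=> nk; rewrite /= (coherent_ancestors (svalP x)). Qed.

Lemma retract_ge k (x : T) n : (k <= n)%N -> sval (retract k x) n = sval x k.
Proof. exact: ancestors_geq. Qed.

Lemma node_dist k u v (hu : pts k u) (hv : pts k v) :
  mdist (node hu) (node hv) = dist k u v.
Proof.
apply/eqP; rewrite limit_distE eq_le; apply/andP; split; last first.
  by have := limit_dist_ge (node hu) (node hv) k; rewrite /= !ancestors_geq.
apply: limit_dist_le => n; have [nk|/ltnW kn] := leqP n k.
  have := coherent_dist_homo beta (ancestors_coherent hu) (ancestors_coherent hv) nk.
  by rewrite !(ancestors_geq J _ (leqnn k)).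
by rewrite /= !ancestors_geq// (coherent_dist_stable beta kn).
Qed.

Lemma retract_dist k (x y : T) :
  mdist (retract k x) (retract k y) = dist k (sval x k) (sval y k).
Proof. exact: node_dist. Qed.

Lemma retract_lip k (x y : T) : mdist (retract k x) (retract k y) <= mdist x y.
Proof. by rewrite retract_dist; exact: limit_dist_ge. Qed.

Lemma mdist_retract k c (x : T) : 0 <= c -> controlled k c ->
  mdist x (retract k x) <= c.
Proof.
move=> c0 kc; rewrite limit_distE; apply: limit_dist_le => n.
have [nk|/ltnW kn] := leqP n k.
  by rewrite retract_le// tree_distxx//; exact: limit_coherent.
rewrite retract_ge//; exact: (coherent_dist_trunc eta01 (svalP x) c0 kc kn).
Qed.

Lemma limit_four_point : four_point T.
Proof.
move=> x y z t; apply: contrapT => /not_orP[/negP + /negP].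
rewrite -!ltNge => h1 h2.
have app (u v : T) (e : R) : 0 < e ->
    exists k, forall n, (k <= n)%N -> mdist u v - e < dist n (sval u n) (sval v n).
  move=> e0; have [_ [k _ <-] uv] := sup_adherent e0 (limit_dist_has_sup u v).
  exists k => n kn; apply: lt_le_trans uv _.
  exact: (coherent_dist_homo beta (svalP u) (svalP v) kn).
set p := mdist x y + mdist z t in h1 h2.
(* Only the two distances on the left need approximating, each up to e, as the distances at a finite
   level never exceed the limit ones; twice e fits in either gap. *)
pose e := Num.min (p - (mdist x z + mdist y t)) (p - (mdist x t + mdist y z)) / 2.
have e0 : 0 < e by rewrite divr_gt0// lt_min !subr_gt0 h1.
have [k1 k1P] := app x y e e0; have [k2 k2P] := app z t e e0.
have {}k1P := k1P _ (leq_maxl k1 k2); have {}k2P := k2P _ (leq_maxr k1 k2).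
have ge (u v : T) := limit_dist_ge u v (maxn k1 k2).
have := tree_dist_four_point beta (limit_coherent x (maxn k1 k2))
  (limit_coherent y (maxn k1 k2)) (limit_coherent z (maxn k1 k2))
  (limit_coherent t (maxn k1 k2)).
have := ge x z; have := ge x t; have := ge y z; have := ge y t.
have e1 : 2 * e <= p - (mdist x z + mdist y t).
  by rewrite /e mulrC divfK// ge_min lexx.
have e2 : 2 * e <= p - (mdist x t + mdist y z).
  by rewrite /e mulrC divfK// ge_min lexx orbT.
rewrite -!limit_distE; rewrite /p in e1 e2 h1 h2 *; move=> ? ? ? ? [] ?; lra.
Qed.

Lemma limit_approx_between (x y : T) (r e : R) : 0 <= r <= mdist x y -> 0 < e ->
  exists z, `|mdist x z - r| <= e /\ `|mdist z y - (mdist x y - r)| <= e.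
Proof.
move=> /andP[r0 rd] e0; have e2 : 0 < e / 4 by rewrite divr_gt0.
have [k kc] := g e2; have {}e2 := ltW e2.
have hx := mdist_retract x e2 kc; have hy := mdist_retract y e2 kc.
have hx' := hx; rewrite metric_sym in hx'; have hy' := hy; rewrite metric_sym in hy'.
(* The distance at level k can be slightly less than r, which lies between 0 and the limit distance
   only; the target is capped accordingly. *)
pose r' := Num.min r (dist k (sval x k) (sval y k)).
have [|z [hz z1 z2]] := @tree_dist_between _ beta s J k (sval x k) (sval y k) r'
  (limit_coherent x k) (limit_coherent y k).
  rewrite /r' le_min r0 tree_dist_ge0//=; [|exact: limit_coherent..].
  by rewrite ge_min lexx orbT.
have d1 : mdist (retract k x) (node hz) = r' by rewrite node_dist.
have d2 : mdist (node hz) (retract k y) = dist k (sval x k) (sval y k) - r'.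
  by rewrite node_dist.
rewrite -retract_dist in d2.
have t1 := metric_triangle x (retract k x) (node hz).
have t2 := metric_triangle (retract k x) x (node hz).
have t3 := metric_triangle (node hz) (retract k y) y.
have t4 := metric_triangle (node hz) y (retract k y).
have t5 := metric_triangle x (retract k x) y.
have t6 := metric_triangle (retract k x) (retract k y) y.
have t7 := retract_lip k x y.
exists (node hz); rewrite !ler_norml; move: d1 d2; rewrite /r' -!retract_dist.
by case: (leP r (mdist (retract k x) (retract k y))) => ? d1 d2;
  split; apply/andP; split; lra.
Qed.

End limit_space.

Lemma fmap_ultra (S U : Type) (f : S -> U) (F : set_system S) :
  UltraFilter F -> UltraFilter (f @ F).
Proof.
move=> FU; split; first exact: fmap_proper_filter.
move=> G GF FG; apply/seteqP; split => [A GA|]; last exact: FG.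
have [//|FA] := in_ultra_setVsetC (f @^-1` A) FU.
have GC : G (~` A) by apply: FG.
have [u []] := filter_ex (filterI GA GC).
by [].
Qed.

Section limit_compact.
Context {R : realType}.
Variables (eta beta : R) (s : nat -> beads R) (J : nat -> nat * R).
Variables (eta01 : 0 < eta < 1) (g : good eta beta s J).

Local Notation pts := (tree_pts s J).
Local Notation dist := (tree_dist beta s J).
Local Notation w := (weight s J).
Local Notation sc := (scale beta s J).
Local Notation controlled := (controlled eta beta s J).
Local Notation T := (limit_tree eta01 g).

Lemma emb_pts k t : 0 < w k -> 0 <= t <= bead_len (s k) -> pts k (emb J k t).
Proof.
case: k => [|k] w0 tI; first by split.
rewrite /emb; case: eqVneq => [_|t0]; first exact/tree_pts_sub/tree_pts_J.
apply: tree_pts_new => //.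
by rewrite lt_neqAle eq_sym t0.
Qed.

Lemma emb_dist k t t' : 0 < w k -> 0 <= t <= bead_len (s k) ->
  0 <= t' <= bead_len (s k) ->
  dist k (emb J k t) (emb J k t') = sc k * `|t - t'|.
Proof.
case: k => [|k] w0 /andP[t0 _] /andP[t0' _].
  by rewrite /scale /= powR1 mul1r.
have hJ := tree_pts_J w0; have nJ := tree_pts_neqS hJ.
rewrite tree_distS /emb; case: (eqVneq t 0) => [->|?]; case: (eqVneq t' 0) => [->|?];
  rewrite /= ?nJ ?eqxx//.
- by rewrite tree_distxx// subrr normr0 mulr0.
- by rewrite tree_distxx// add0r sub0r normrN ger0_norm.
- by rewrite tree_distxx// addr0 subr0 ger0_norm.
Qed.

Definition node_of k u : T :=
  if pselect (pts k u) is left h then node eta01 g h else point.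

Lemma node_ofE k u (h : pts k u) : node_of k u = node eta01 g h.
Proof.
rewrite /node_of; case: pselect => // h'.
by apply: limit_eqP.
Qed.

Lemma node_of_dist k u v : pts k u -> pts k v ->
  mdist (node_of k u) (node_of k v) = dist k u v.
Proof. by move=> hu hv; rewrite !node_ofE node_dist. Qed.

Definition level k : set T := [set x | retract k x = x].

Lemma retract_continuous k : continuous (retract k : T -> T).
Proof. by apply: nonexpansive_continuous => x y; exact: retract_lip. Qed.

Lemma level_closed k : closed (level k).
Proof.
move=> x clx; apply/eqP/negP => /negP ne.
have e0 : 0 < mdist (retract k x) x / 2 by rewrite divr_gt0// mdist_gt0.
have [y [ly]] := clx _ (nbhsx_ballx x _ e0).
rewrite ballEmdist /= => xy.
have h := retract_lip k x y; rewrite ly in h.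
by have := metric_triangle (retract k x) y x; rewrite (metric_sym y x) => *; lra.
Qed.

Lemma strand_compact k : 0 < w k ->
  compact ((fun t => node_of k (emb J k t)) @` `[0, bead_len (s k)]).
Proof.
move=> w0; apply: continuous_compact; last exact: segment_compact.
apply/subspace_continuousP => t tI.
apply/metricType_numDomainType.cvgrPdist_lt => e e0; near=> u.
have uI : `[0, bead_len (s k)]%classic u by near: u; exact: withinT.
rewrite node_of_dist ?emb_dist//; try exact: emb_pts.
rewrite mulrC -ltr_pdivlMr ?scale_gt0//; near: u; apply: cvg_within.
by apply: (@cvgr_dist_lt _ _ _ (nbhs t) _ id t); [exact: cvg_id|rewrite divr_gt0// scale_gt0].
Unshelve. all: by end_near. Qed.

(** A level is closed and contained in the previous one together with one copy, a continuous image
    of an interval; a copy of weight 0 adds no point. *)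
Lemma level_compact k : compact (level k).
Proof.
have lev0 : level 0 `<=` (fun t => node_of 0 (emb J 0 t)) @` `[0, bead_len (s 0%N)].
  move=> x lx; have [+ xI _] := limit_coherent x 0.
  rewrite leqn0 => /eqP x0; rewrite x0 in xI; exists (sval x 0%N).2; first by rewrite /= in_itv.
  have E : (0%N, (sval x 0%N).2) = sval x 0%N by move: x0; case: (sval x 0%N) => a b /= ->.
  by rewrite /emb E (node_ofE (limit_coherent x 0)) -[RHS]lx.
elim: k => [|k IH].
  exact: (subclosed_compact (@level_closed 0) (@strand_compact 0 ltr01) lev0).
have [w0|w0] := ltP 0 (w k.+1).
  apply: (subclosed_compact (@level_closed _) (compactU IH (strand_compact w0))).
  move=> x lx; have hx := limit_coherent x k.+1.
  case: (tree_pts_cases hx) => [[e [x0 _]]|[e hx']].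
    right; exists (sval x k.+1).2.
      by case: hx => _ h _; rewrite e in h; rewrite /= in_itv.
    rewrite /emb (gt_eqF x0).
    have E : (k.+1, (sval x k.+1).2) = sval x k.+1 by move: e; case: (sval x k.+1) => a b /= ->.
    by rewrite E (node_ofE hx) -[RHS]lx; exact: limit_eqP.
  left; apply: limit_eqP => n; rewrite -[in RHS]lx.
  have xk : sval x k = sval x k.+1.
    by have [_ <-] := svalP x k; rewrite (proj_old hx').
  have [nk|kn] := leqP n k; first by rewrite !retract_le// ltnW.
  by rewrite !retract_ge// ltnW.
apply: (subclosed_compact (@level_closed _) IH) => x lx.
have hx := limit_coherent x k.+1.
case: (tree_pts_cases hx) => [[_ [_ w1]]|[e hx']]; first by rewrite leNgt w1 in w0.
apply: limit_eqP => n; rewrite -[in RHS]lx.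
have xk : sval x k = sval x k.+1.
  by have [_ <-] := svalP x k; rewrite (proj_old hx').
have [nk|kn] := leqP n k; first by rewrite !retract_le// ltnW.
by rewrite !retract_ge// ltnW.
Qed.

Lemma retract_level k (x : T) : level k (retract k x).
Proof.
apply: limit_eqP => n; have [nk|/ltnW kn] := leqP n k.
  by rewrite !retract_le.
by rewrite !retract_ge.
Qed.

Lemma retract_retract k (x : T) : retract k (retract k.+1 x) = retract k x.
Proof.
apply: limit_eqP => n; have [nk|/ltnW kn] := leqP n k.
  by rewrite !retract_le// ltnW.
by rewrite !(retract_ge _ kn)// retract_le.
Qed.

(** The image of an ultrafilter under each retraction converges in a compact level. Continuity of
    the retractions and uniqueness of limits make these limits coherent, hence a point x of T. As
    the retractions are uniformly close to the identity, the ultrafilter itself converges to x. *)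
Lemma limit_compact : compact [set: T].
Proof.
rewrite compact_ultra => F FU _.
have lim k : exists p, level k p /\ retract k @ F --> p.
  have Flev : (retract k @ F) (level k).
    rewrite /fmap /=; suff -> : retract k @^-1` level k = setT by exact: filterT.
    by apply/seteqP; split => // x _; exact: retract_level.
  have := @level_compact k; rewrite compact_ultra => h.
  by have [p [lp pF]] := h (retract k @ F) (fmap_ultra _ FU) Flev; exists p.
have /choice[p pP] := lim.
have pp k : retract k (p k.+1) = p k.
  have h1 : retract k @ (retract k.+1 @ F) --> retract k (p k.+1).
    apply: (@cvg_comp _ _ _ (retract k.+1) (retract k)); last exact: retract_continuous.
    by have [] := pP k.+1.
  have h2 : retract k @ (retract k.+1 @ F) --> p k.
    have [_ h] := pP k.
    have E : (retract k : T -> T) = retract k \o retract k.+1.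
      by apply/funext => x /=; rewrite retract_retract.
    by rewrite E in h.
  exact: (@cvg_unique _ (@metric_hausdorff _ T) _ _ _ _ h1 h2).
have cp : coherent s J (fun n => sval (p n) n).
  move=> n; split; first exact: limit_coherent.
  have [_ ->] := svalP (p n.+1) n.
  by rewrite -(retract_le (p n.+1) (leqnn n)) pp.
pose x : T := exist _ _ cp.
have rx k : retract k x = p k.
  have [lk _] := pP k; rewrite -[RHS]lk.
  by apply: limit_eqP.
exists x; split => //; apply/metricType_numDomainType.fcvgrPdist_lt => e e0.
have e4 : 0 < e / 4 by rewrite divr_gt0.
have [k kc] := g e4; have [_ pF] := pP k; have {}e4' := ltW e4.
have pFk := @metricType_numDomainType.cvgr_dist_lt _ _ _ F _ (retract k) _ pF _ e4.
near=> y.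
have xy : mdist (retract k x) (retract k y) < e / 4 by rewrite rx; near: y; exact: pFk.
have := mdist_retract x e4' kc; have := mdist_retract y e4' kc.
have := metric_triangle x (retract k x) y.
have := metric_triangle (retract k x) (retract k y) y.
by rewrite (metric_sym (retract k y) y) => *; lra.
Unshelve. all: by end_near. Qed.

Lemma limit_Rtree : Rtree T.
Proof.
exact: (compact_Rtree (@limit_four_point _ _ _ _ _ eta01 g) limit_compact
  (@limit_approx_between _ _ _ _ _ eta01 g)).
Qed.

End limit_compact.

(** * Leaves of the limit tree *)

Section limit_leaves.
Context {R : realType}.
Variables (eta beta : R) (s : nat -> beads R) (J : nat -> nat * R).
Variables (eta01 : 0 < eta < 1) (g : good eta beta s J).

Local Notation pts := (tree_pts s J).
Local Notation dist := (tree_dist beta s J).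
Local Notation mu := (tree_mu s J).
Local Notation w := (weight s J).
Local Notation sc := (scale beta s J).
Local Notation controlled := (controlled eta beta s J).
Local Notation T := (limit_tree eta01 g).

Lemma coherent_distS x k n : coherent s J x -> (k <= n)%N ->
  dist n.+1 (x n.+1) (x k) = dist n.+1 (x n.+1) (x n) + dist n (x n) (x k).
Proof.
move=> cx kn; have [hxk _] := cx k; have [hxn px] := cx n; have [hx _] := cx n.+1.
have hxkn : pts n (x k) by exact: tree_pts_leq hxk.
have [->|ne] := eqVneq (x n) (x k); first by rewrite tree_distxx// addr0.
have := @tree_dist_proj _ beta _ _ _ _ _ hx (tree_pts_sub hxkn).
by rewrite px (proj_old hxkn) (tree_distxx beta (tree_pts_sub hxkn)) addr0; exact.
Qed.

Lemma coherent_branch x y k n : coherent s J x -> coherent s J y -> (k <= n)%N ->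
  x k != y k -> dist n (x n) (y n) =
    dist n (x n) (x k) + dist k (x k) (y k) + dist n (y n) (y k).
Proof.
move=> cx cy /subnKC <- ne; have [hxk _] := cx k; have [hyk _] := cy k.
elim: (n - k)%N => [|m IH].
  by rewrite addn0 !tree_distxx// add0r addr0.
rewrite addnS; have [hx px] := cx (k + m)%N; have [hy py] := cy (k + m)%N.
have [hx' _] := cx (k + m).+1; have [hy' _] := cy (k + m).+1.
have nem : x (k + m)%N != y (k + m)%N.
  apply: contraNneq ne => e.
  by rewrite -(coherent_down m k cx) -(coherent_down m k cy) e.
rewrite (tree_dist_proj beta hx' hy') px py// IH.
by rewrite (coherent_distS cx (leq_addr m k)) (coherent_distS cy (leq_addr m k)); lra.
Qed.

(** Points separated at level k remain in different branches, so the geodesic between them passes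
    through both retractions. The outer two distances are suprema over levels; any two levels are
    dominated by a common one. *)
Lemma limit_branch k (x y : T) : sval x k != sval y k ->
  mdist x y = mdist x (retract k x) + mdist (retract k x) (retract k y) +
    mdist (retract k y) y.
Proof.
move=> ne; apply/eqP; rewrite eq_le; apply/andP; split.
  have := metric_triangle x (retract k x) y.
  by have := metric_triangle (retract k x) (retract k y) y => *; lra.
rewrite retract_dist (metric_sym (retract k y)) -lerBrDr -lerBrDr.
apply: limit_dist_le => n; rewrite lerBrDr lerBrDr addrC -lerBrDr.
apply: limit_dist_le => m; rewrite lerBrDr.
pose N := maxn k (maxn n m).
have kN : (k <= N)%N by rewrite leq_maxl.
have nN : (n <= N)%N by rewrite (leq_trans (leq_maxl n m))// leq_maxr.
have mN : (m <= N)%N by rewrite (leq_trans (leq_maxr n m))// leq_maxr.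
apply: le_trans (limit_dist_ge x y N).
rewrite (coherent_branch (svalP x) (svalP y) kN ne).
have := coherent_dist_homo beta (svalP x) (svalP (retract k x)) nN.
have := coherent_dist_homo beta (svalP y) (svalP (retract k y)) mN.
rewrite -!/(sval _) !(retract_ge _ kN); lra.
Qed.

Lemma retract_point k : retract k (point : T) = point.
Proof.
apply: limit_eqP => n; rewrite limit_pointE; have [nk|/ltnW kn] := leqP n k.
  by rewrite retract_le// limit_pointE.
by rewrite retract_ge// limit_pointE.
Qed.

Lemma limit_root_branch k (y : T) :
  mdist point y = mdist point (retract k y) + mdist (retract k y) y.
Proof.
have [e|ne] := eqVneq (sval (point : T) k) (sval y k).
  suff -> : retract k y = point by rewrite mdistxx add0r.
  rewrite -[RHS](retract_point k); apply: limit_eqP => n.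
  by rewrite -[LHS]/(ancestors J k (sval y k) n) -e.
by rewrite (limit_branch ne) retract_point mdistxx add0r.
Qed.

Let leafT (x : T) : x != point ->
  (forall y, mdist point x + mdist x y = mdist point y -> y = x) -> leaf x.
Proof.
exact: (leafP (@limit_four_point _ _ _ _ _ eta01 g)
  (@limit_compact _ _ _ _ _ eta01 g) (@limit_approx_between _ _ _ _ _ eta01 g)).
Qed.

(** Let y be beyond x, and take a level at which the retraction moves points by at most a third of
    d(x, y). The two retractions then differ, and the geodesic from the root to y leaves the level
    only once, after the retraction of x. Being on this geodesic, x is its own retraction. *)
Lemma limit_leaf (x : T) : (forall k, ~ level k x) -> leaf x.
Proof.
move=> nx; apply: leafT => [|y xy].
  by apply/eqP => x0; apply: (nx 0%N); rewrite /level /= x0 retract_point.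
apply/esym/eqP/negP => /negP; rewrite -mdist_gt0 => d0.
have e0 : 0 < mdist x y / 3 by rewrite divr_gt0.
have [k kc] := g e0; have e0' := ltW e0.
have hx := mdist_retract x e0' kc; have hy := mdist_retract y e0' kc.
have [e|ne] := eqVneq (sval x k) (sval y k).
  have E : retract k x = retract k y by apply: limit_eqP => n; rewrite /= e.
  rewrite E in hx; have := metric_triangle x (retract k y) y.
  by rewrite (metric_sym (retract k y) y) => *; lra.
apply: (nx k); apply: mdist_positivity; apply/eqP.
rewrite eq_le mdist_ge0 andbT.
have := limit_branch ne; have := limit_root_branch k x; have := limit_root_branch k y.
have := metric_triangle point (retract k x) (retract k y).
by rewrite (metric_sym x (retract k x)) => *; lra.
Qed.

Lemma bead_image_point_ge (b : beads R) (f : R -> nat * R) i :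
  ((bead_mass b i)%:E <=
    bead_image b (f : R -> places) [set f (bead_pos b i)])%E.
Proof.
rewrite bead_imageE; apply: le_trans (nneseries_lim_ge i.+1 _); last first.
  by move=> n _; rewrite mule_ge0// lee_fin bead_mass_ge0.
rewrite big_nat_recr//= diracE mem_set// mule1 leeDr//.
by apply: sume_ge0 => n _; rewrite mule_ge0// lee_fin bead_mass_ge0.
Qed.

(** This serves the positivity of the mass above a point that is not a leaf: a set A of places at a
    finite level has positive mass, and all points projecting into A are beyond x. The level used is
    that of the copy j on which x lies. The alternatives are an atom at x, a bead further along the
    copy, or a massless right end. *)
Lemma level_leaf k (x : T) : level k x -> x != point ->
  leaf x \/ exists j (A : set (nat * R)), (0 < mu j A)%E /\
    forall y : T, A (sval y j) -> mdist point x + mdist x y = mdist point y.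
Proof.
move=> lx x0; pose u := sval x k; pose j := u.1.
have hu : pts k u := limit_coherent x k.
have huj n : (j <= n)%N -> pts n u.
  by move=> jn; case: hu => _ uI u0; split.
have xn n : (j <= n)%N -> sval x n = u.
  move=> jn; have [kn|/ltnW nk] := leqP k n.
    by rewrite -lx retract_ge.
  by rewrite -(coherent_ancestors (svalP x) nk) /ancestors (down_old _ (huj n jn)).
have rx : retract j x = x.
  apply: limit_eqP => n; have [nj|/ltnW jn] := leqP n j; first by rewrite retract_le.
  by rewrite retract_ge// !xn.
have wj : 0 < w j by case: hu; rewrite -/j; case: (j) => // ? _ _ /(_ isT)[].
have [mu0|mu0] := ltP 0%E (mu j [set u]).
  right; exists j, [set u]; split => // y /= yu.
  suff -> : x = retract j y by rewrite -limit_root_branch.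
  rewrite -rx; apply: limit_eqP => n.
  by rewrite /= yu xn.
have uI : 0 <= u.2 <= bead_len (s j) by case: hu.
have same_strand t : u.2 < t <= bead_len (s j) -> forall y : T, sval y j = (j, t) ->
    mdist point x + mdist x y = mdist point y.
  move=> /andP[ut tl] y yj.
  have ne : sval x j != sval y j.
    by rewrite xn// yj; apply/eqP => e; move: ut; rewrite e ltxx.
  rewrite (limit_branch ne) rx (limit_root_branch j y) mdistxx add0r.
  rewrite -{1 2}rx -(retract_point j) !retract_dist xn// yj limit_pointE.
  rewrite addrA; congr (_ + _).
  have u1 : u.1 = j by [].
  have hroot n : pts n (0%N, 0) := tree_pts_root s J n.
  case: (j) u1 (huj j (leqnn j)) wj => [|i] ui hui wi.
    move: uI => /andP[? _]; rewrite /= !sub0r !normrN (distrC u.2 t).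
    by rewrite !ger0_norm; lra.
  rewrite !tree_distS ui eqxx/= (distrC u.2 t) ger0_norm; last by lra.
  by rewrite mulrBr; lra.
(* The length is the supremum of the beads of positive mass by [bead_lenE], so that one of them lies
   strictly beyond u unless u is the right end. *)
have [ul|ul] := ltP u.2 (bead_len (s j)).
  have S0 : [set bead_pos (s j) i | i in [set i | 0 < bead_mass (s j) i]] !=set0.
    apply/set0P/eqP => S0; have := bead_len_gt0 (s j).
    by rewrite bead_lenE S0 sup0 ltxx.
  right; move: ul; rewrite {1}bead_lenE => /(sup_gt S0)[_ [i i0 <-] ui].
  exists j, [set emb J j (bead_pos (s j) i)].
  have [_ il] := andP (bead_pos_itv (s j) i).
  have ei : emb J j (bead_pos (s j) i) = (j, bead_pos (s j) i).
    have : 0 < bead_pos (s j) i by apply: le_lt_trans ui; case/andP: uI.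
    by rewrite /emb; case: (j) => // n p0; rewrite gt_eqF.
  split; last by move=> y; rewrite ei; apply: same_strand; rewrite ui.
  have := bead_image_point_ge (s j) (emb J j) i.
  case: (j) wj i0 => [|n] wj i0; first by apply: lt_le_trans; rewrite lte_fin.
  move=> hb; rewrite tree_muS; apply: (@lt_le_trans _ _ ((w n.+1)%:E * (bead_mass (s n.+1) i)%:E)%E).
    by rewrite mule_gt0// lte_fin.
  by apply: le_trans (lee_wpmul2l _ hb) _; rewrite ?lee_fin ?weight_ge0// leeDr.
(* The place u is now a right end without mass. Its mass remains 0 at all later levels, so that no
   copy of positive weight is ever attached there. *)
left; apply: leafT => // y.
have yu : sval y j = u -> y = x.
  move=> yu; apply: limit_eqP => n.
  have [nj|/ltnW jn] := leqP n j.
    by rewrite -(retract_le y nj) -(retract_le x nj) /= yu xn.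
  rewrite xn//; move: jn => /subnKC <-.
  have muj m : mu (j + m)%N [set u] = 0%E.
    apply/eqP; rewrite eq_le measure_ge0 andbT.
    elim: m => [|m IH]; first by rewrite addn0.
    apply: le_trans IH; rewrite addnS -(tree_mu_proj s J (j + m)%N).
    apply: tree_mu_le => _ -> /=; apply/proj_old/huj; exact: leq_addr.
  elim: (n - j)%N => [|m IH]; first by rewrite addn0.
  rewrite addnS; have [_ py] := svalP y (j + m)%N; rewrite IH in py.
  case: (tree_pts_cases (limit_coherent y (j + m).+1)) => [[e [_ w0]]|[_ hy]].
    move: py; rewrite /tree_proj e eqxx => Ju; move: w0.
    by rewrite -lte_fin weightE Ju muj ltxx.
  by rewrite -py (proj_old hy).
move=> xy; apply: yu; apply: contrapT => /eqP ne.
have ne' : sval x j != sval y j by rewrite xn// eq_sym.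
have := limit_branch ne'; have := limit_root_branch j y.
rewrite rx mdistxx add0r => h1 h2.
have {}xy : mdist point x + mdist x (retract j y) = mdist point (retract j y).
  by move: xy h1 h2 => *; lra.
move: xy; rewrite -{1 2}rx -(retract_point j) !retract_dist xn// limit_pointE.
have hv := limit_coherent y j; move: (sval y j) hv ne => v hv ne.
have u1 : u.1 = j by [].
have hroot n : pts n (0%N, 0) := tree_pts_root s J n.
case: (j) u1 (huj j (leqnn j)) wj uI ul hv => [|i] ui hui wi uI ul hv.
  case: hv => + vI _; rewrite leqn0 => /eqP v1; move: vI; rewrite v1.
  case/andP: uI => u0 _ /andP[v0 vl].
  rewrite /= !sub0r !normrN (distrC u.2) (ger0_norm u0) (ger0_norm v0) => h.
  case/negP: ne; apply/eqP; have := ler_norm (v.2 - u.2).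
  have uv : u.2 = v.2 by move: (u.2) (v.2) h u0 v0 vl ul => a b; case: (lerP a b); lra.
  by rewrite (surjective_pairing v) (surjective_pairing u) uv v1 ui.
rewrite !tree_distS ui eqxx; case: (tree_pts_cases hv) => [[ev [v0 _]]|[ev hv']].
  rewrite ev eqxx /= => h; case/negP: ne; apply/eqP.
  case: hv => _ /andP[_]; rewrite ev => vl _.
  have c0 := scale_gt0 beta wi.
  suff uv : u.2 = v.2 by rewrite (surjective_pairing v) (surjective_pairing u) uv ev ui.
  have : `|u.2 - v.2| = v.2 - u.2.
    by apply: (mulfI (lt0r_neq0 c0)); lra.
  by have := normr_ge0 (u.2 - v.2) => *; lra.
rewrite ev /= => h; case/andP: uI => u0 _.
have lp := bead_len_gt0 (s i.+1).
have c0 : 0 < sc i.+1 * u.2 by rewrite mulr_gt0 ?scale_gt0//; lra.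
have hJ := tree_pts_J wi.
have := tree_dist_triangle beta (hroot i) hJ hv'; lra.
Qed.

End limit_leaves.

(** * The limit mass *)

Section bead_split.
Context {R : realType}.
Local Notation leb := (@lebesgue_measure R).

Definition bead_cumul (b : beads R) n := \sum_(i < n) bead_mass b i.

Lemma bead_cumulS b n : bead_cumul b n.+1 = bead_cumul b n + bead_mass b n.
Proof. by rewrite /bead_cumul big_ord_recr. Qed.

Lemma bead_cumul_homo b : {homo bead_cumul b : m n / (m <= n)%N >-> m <= n}.
Proof.
move=> m n /subnKC <-; elim: (n - m)%N => [|k IH]; first by rewrite addn0.
by rewrite addnS bead_cumulS (le_trans IH)// lerDl bead_mass_ge0.
Qed.

Lemma bead_cumul_ge0 b n : 0 <= bead_cumul b n.
Proof. by rewrite sumr_ge0// => i _; exact: bead_mass_ge0. Qed.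

Lemma bead_cumulE b n : ((bead_cumul b n)%:E = \sum_(0 <= i < n) (bead_mass b i)%:E)%E.
Proof. by rewrite big_mkord sumEFin. Qed.

Lemma bead_cumul_le1 b n : bead_cumul b n <= 1.
Proof.
rewrite -lee_fin bead_cumulE -(bead_mass_sum b).
by apply: nneseries_lim_ge => i _ _; rewrite lee_fin bead_mass_ge0.
Qed.

Lemma bead_cumul_lim b t : t < 1 -> exists n, t < bead_cumul b n.
Proof.
move=> t1; apply: contrapT => h.
have : (\sum_(i <oo) (bead_mass b i)%:E <= t%:E)%E.
  apply: lime_le; first by apply: is_cvg_nneseries => n _ _; rewrite lee_fin bead_mass_ge0.
  apply: nearW => n; rewrite -bead_cumulE lee_fin leNgt; apply/negP => tn.
  by apply: h; exists n.
by rewrite bead_mass_sum lee_fin leNgt t1.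
Qed.

Lemma bead_index b t : 0 <= t < 1 ->
  exists i, bead_cumul b i <= t < bead_cumul b i.+1.
Proof.
move=> /andP[t0 /(bead_cumul_lim b) h].
case: (ex_minnP h) => -[|n] tn nmin.
  by move: tn; rewrite /bead_cumul big_ord0 ltNge t0.
exists n; rewrite tn andbT leNgt; apply/negP => /nmin; by rewrite ltnn.
Qed.

(** The interval is cut at l plus m times the partial sums of the masses, which fill it because the
    masses add up to 1; a bead of mass 0 receives an empty piece. By the last clause the fibres are
    again half-open intervals, so that the cutting can be iterated. *)
Lemma bead_split (b : beads R) (f : R -> nat * R) (l m : R) : 0 < m ->
  injective (f \o bead_pos b) ->
  exists Y : R -> nat * R, [/\
    forall A, measurable (`[l, l + m[ `&` Y @^-1` A),
    forall A : set (nat * R), leb (`[l, l + m[ `&` Y @^-1` A) =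
      (m%:E * bead_image b (f : R -> places) A)%E,
    forall t, l <= t < l + m -> exists i, Y t = f (bead_pos b i) &
    forall i, exists l', [/\ l <= l', l' + m * bead_mass b i <= l + m &
      forall t, l <= t < l + m ->
        (Y t = f (bead_pos b i) <-> l' <= t < l' + m * bead_mass b i)]].
Proof.
move=> m0 finj; pose K i : set R := `[l + m * bead_cumul b i, l + m * bead_cumul b i.+1[%classic.
have /choice[idx idxP] : forall t, exists i, l <= t < l + m -> K i t.
  move=> t; have [tl|tl] := pselect (l <= t < l + m); last by exists 0%N.
  have [|i iP] := @bead_index b ((t - l) / m).
    case/andP: tl => lt tm; rewrite divr_ge0 ?(ltW m0) ?subr_ge0//=.
    by rewrite ltr_pdivrMr// mul1r; lra.
  exists i => _; rewrite /K /= in_itv /=; move: iP.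
  rewrite ler_pdivlMr// ltr_pdivrMr// => /andP[h1 h2].
  by apply/andP; split; lra.
have KK i j t : K i t -> K j t -> i = j.
  have half i' j' : (i' < j')%N -> K i' t -> K j' t -> False.
    move=> /(bead_cumul_homo b) ij; rewrite /K /= !in_itv /=.
    move=> /andP[_ h1] /andP[h2 _].
    have : m * bead_cumul b i'.+1 <= m * bead_cumul b j' by rewrite ler_wpM2l// ltW.
    by lra.
  move=> Ki Kj; case: (ltngtP i j) => // ij; first by case: (half _ _ ij Ki Kj).
  by case: (half _ _ ij Kj Ki).
have Kl i t : K i t -> l <= t < l + m.
  rewrite /K /= in_itv /= => /andP[h1 h2].
  have : 0 <= m * bead_cumul b i by rewrite mulr_ge0 ?bead_cumul_ge0// ltW.
  have : m * bead_cumul b i.+1 <= m * 1 by rewrite ler_wpM2l ?bead_cumul_le1// ltW.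
  by move=> *; apply/andP; split; lra.
have idxE i t : K i t -> idx t = i.
  by move=> Kt; apply: (KK _ _ t) => //; apply/idxP/(Kl i).
pose Y t := f (bead_pos b (idx t)).
have lebK i : leb (K i) = (m * bead_mass b i)%:E.
  rewrite /K lebesgue_measure_itv /= lte_fin bead_cumulS.
  have := bead_mass_ge0 b i; rewrite le_eqVlt => /predU1P[<-|p0].
    by rewrite addr0 ltxx mulr0.
  rewrite ifT; last by rewrite ltrD2l ltr_pM2l// ltrDl.
  by rewrite -EFinB; congr (_%:E); lra.
pose F (A : set (nat * R)) i := if `[< A (f (bead_pos b i)) >] then K i else set0.
have YA A : `[l, l + m[ `&` Y @^-1` A = \bigcup_i F A i.
  apply/seteqP; split => t.
    move=> [+ At]; rewrite /= in_itv /= => tl.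
    by exists (idx t) => //; rewrite /F asboolT//; exact: idxP.
  move=> [i _]; rewrite /F; case: asboolP => // Ai Kt; split.
    by rewrite /= in_itv /=; exact: Kl Kt.
  by rewrite /Y /= (idxE _ _ Kt).
have mF A i : measurable (F A i) by rewrite /F; case: asboolP => _; [exact: measurable_itv|exact: measurable0].
exists Y; split.
- by move=> A; rewrite YA; apply: bigcup_measurable => i _; exact: mF.
- move=> A; rewrite YA measure_semi_bigcup; last 3 first.
  + exact: mF.
  + apply/trivIsetP => i j _ _ ij; apply/seteqP; split => // t [].
    rewrite /F; case: asboolP => // _ Ki; case: asboolP => // _ Kj.
    by move/eqP: ij; apply; exact: KK Ki Kj.
  + by apply: bigcup_measurable => i _; exact: mF.
  rewrite bead_imageE -nneseriesZl; last first.
    by move=> i _; rewrite mule_ge0// lee_fin bead_mass_ge0.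
  apply: eq_eseriesr => i _; rewrite diracE /F; case: asboolP => Ai.
    by rewrite mem_set// mule1 -EFinM; exact: lebK.
  by rewrite memNset// !mule0; exact: measure0.
- by move=> t _; exists (idx t).
- move=> i; exists (l + m * bead_cumul b i); split.
  + by rewrite lerDl mulr_ge0 ?bead_cumul_ge0// ltW.
  + rewrite -addrA lerD2l -mulrDr -bead_cumulS -[leRHS]mulr1.
    by rewrite ler_wpM2l ?bead_cumul_le1// ltW.
  + move=> t tl; rewrite -addrA -mulrDr -bead_cumulS.
    have KE : K i t <-> l + m * bead_cumul b i <= t < l + m * bead_cumul b i.+1.
      by rewrite /K /= in_itv.
    rewrite -KE; split => [/finj e|/idxE e]; last by rewrite /Y e.
    by rewrite -e; exact: idxP.
Qed.

End bead_split.

Section level_maps.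
Context {R : realType}.
Variables (s : nat -> beads R) (J : nat -> nat * R).
Local Notation leb := (@lebesgue_measure R).
Local Notation pts := (tree_pts s J).
Local Notation mu := (tree_mu s J).
Local Notation w := (weight s J).
Local Notation proj := (tree_proj J).

Lemma emb_inj k : 0 < w k -> injective (emb J k : R -> nat * R).
Proof.
case: k => [_ x y [] //|k] w0 x y; have hJ := tree_pts_neqS (tree_pts_J w0).
rewrite /emb; case: eqVneq => [->|_]; case: eqVneq => [->|_] //.
- by move=> e; rewrite e /= eqxx in hJ.
- by move=> e; rewrite -e /= eqxx in hJ.
- by case.
Qed.

Lemma bead_image_point (b : beads R) (f : R -> nat * R) i :
  injective (f \o bead_pos b) ->
  bead_image b (f : R -> places) [set f (bead_pos b i)] = (bead_mass b i)%:E.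
Proof.
move=> finj; rewrite bead_imageE (nneseriesD1 (n := i))//; last first.
  by move=> n _; rewrite mule_ge0// lee_fin bead_mass_ge0.
rewrite diracE mem_set// mule1 eseries0 ?adde0// => n _ ni.
rewrite diracE memNset ?mule0// => /= /finj e.
by rewrite e eqxx in ni.
Qed.

Lemma bead_split_point (b : beads R) (f : R -> nat * R) (l m : R) : 0 < m ->
  injective (f \o bead_pos b) ->
  exists Y : R -> nat * R, [/\
    forall A, measurable (`[l, l + m[ `&` Y @^-1` A),
    forall A : set (nat * R), leb (`[l, l + m[ `&` Y @^-1` A) =
      (m%:E * bead_image b (f : R -> places) A)%E &
    forall u, exists l', [/\ l <= l',
      l' + m * fine (bead_image b (f : R -> places) [set u]) <= l + m &
      forall t, l <= t < l + m -> (Y t = u <->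
        l' <= t < l' + m * fine (bead_image b (f : R -> places) [set u]))]].
Proof.
move=> m0 finj; have [Y [mY lY Yf Yi]] := bead_split l m0 finj.
exists Y; split => // u.
have [[i iu]|nu] := pselect (exists i, f (bead_pos b i) = u).
  by rewrite -iu bead_image_point//; exact: Yi.
rewrite bead_image_eq0/= ?mulr0 => [|i iu]; last by apply: nu; exists i.
exists l; rewrite !addr0; split => //; first by rewrite lerDl ltW.
move=> t tl; split; last by move=> /andP[h1 h2]; have := le_lt_trans h1 h2; rewrite ltxx.
by have [i ->] := Yf t tl => e; case: nu; exists i.
Qed.

(** The third clause is the invariant of the recursion: the fibre of each place is a half-open
    interval as long as its mass. Places without mass have empty fibres, so every value is an
    atom. *)
Definition level_map k (X : R -> nat * R) :=
  [/\ forall A, measurable (`[0, 1[ `&` X @^-1` A),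
      forall A : set (nat * R), leb (`[0, 1[ `&` X @^-1` A) = mu k A &
      forall u, exists l, [/\ 0 <= l, l + fine (mu k [set u]) <= 1 &
        forall t, 0 <= t < 1 -> (X t = u <-> l <= t < l + fine (mu k [set u]))]].

Lemma level_map_pts k X t : level_map k X -> 0 <= t < 1 -> pts k (X t).
Proof.
move=> [_ _ /(_ (X t))[l [_ _ lP]]] /lP[/(_ erefl) /andP[h1 h2] _].
have m0 : 0 < fine (mu k [set X t]) by have := le_lt_trans h1 h2; rewrite ltrDl.
apply: contrapT => nX; move: m0; rewrite -lte_fin fineK ?tree_mu_fin//.
have [out _] := tree_mu_out s J k.
apply/negP; rewrite -leNgt -[leRHS]out.
by apply: tree_mu_le => _ ->.
Qed.

Lemma level_map0 : exists X, level_map 0 X.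
Proof.
have inj0 : injective (emb J 0 \o bead_pos (s 0%N)).
  by move=> i j /= [] /bead_pos_inj.
have [X [mX lX Xu]] := bead_split_point 0 ltr01 inj0.
rewrite add0r in mX lX Xu; exists X; split => //.
- by move=> A; rewrite lX mul1e.
- by move=> u; have [l [l0 l1 lP]] := Xu u; exists l; rewrite mul1r in l1 lP.
Qed.

Lemma level_mapS k X : level_map k X ->
  exists X', level_map k.+1 X' /\ forall t, 0 <= t < 1 -> proj k (X' t) = X t.
Proof.
move=> Xk; have [mX lX Xu] := Xk.
have [w0|w0] := ltP 0 (w k.+1); last first.
  have {}w0 : w k.+1 = 0 by apply/eqP; rewrite eq_le w0 weight_ge0.
  have muE A : mu k.+1 A = mu k A.
    rewrite tree_muS w0 mul0e adde0.
    apply/eqP; rewrite eq_le; apply/andP; split; first by apply: tree_mu_le => ? [].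
    apply: (@le_trans _ _ (mu k ((A `&` ~` [set J k]) `|` [set J k]))).
      by apply: tree_mu_le => u Au; have [?|?] := pselect (u = J k); [right|left].
    apply: le_trans (measureU2 _ (measurable_places _) (measurable_places _)) _.
    by rewrite [X in (_ + X)%E](_ : _ = 0%E) ?adde0// -[LHS]weightE w0.
  exists X; split; last by move=> t tI; apply: proj_old; exact: level_map_pts.
  by split => // [A|u]; rewrite muE.
have hJ := tree_pts_J w0.
have injk : injective (emb J k.+1 \o bead_pos (s k.+1)).
  by move=> i j /= /(emb_inj w0) /bead_pos_inj.
have [l [l0 l1 lP]] := Xu (J k).
have mE : fine (mu k [set J k]) = w k.+1 by [].
rewrite mE in l1 lP.
have [Y [mY lY Yu]] := bead_split_point l w0 injk.
(* Only the interval that represents the picked atom is cut again. *)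
pose X' t := if X t == J k then Y t else X t.
have lI t : l <= t < l + w k.+1 -> 0 <= t < 1 by case/andP=> *; apply/andP; split; lra.
have X'E A : `[0, 1[ `&` X' @^-1` A =
    (`[0, 1[ `&` X @^-1` (A `&` ~` [set J k])) `|` (`[l, l + w k.+1[ `&` Y @^-1` A).
  apply/seteqP; split => t; rewrite /= !in_itv /= /X'.
    move=> [tI]; case: eqP => [/(lP t tI) tl At|XJ At]; [by right|by left].
  move=> [[tI [At XJ]]|[tl At]]; first by split => //; rewrite (introF eqP XJ).
  split; first exact: lI.
  by rewrite (iffRL (lP t (lI t tl)) tl) eqxx.
exists X'; split; last first.
  move=> t tI; rewrite /X'; case: eqP => [XJ|XJ]; last first.
    by apply: proj_old; exact: level_map_pts tI.
  rewrite XJ; have /(lP t tI) tl := XJ.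
  have [l' [_ _ l'P]] := Yu (Y t).
  have /l'P[/(_ erefl) + _] := tl.
  move=> /andP[h1 h2]; have := le_lt_trans h1 h2; rewrite ltrDl.
  rewrite pmulr_rgt0// => m0.
  have [[i <-]|ni] := pselect (exists i, emb J k.+1 (bead_pos (s k.+1) i) = Y t).
    exact: (proj_emb _ w0).
  by move: m0; rewrite bead_image_eq0/= ?ltxx// => i /= e; apply: ni; exists i.
split.
- by move=> A; rewrite X'E; exact: measurableU.
- move=> A; rewrite X'E measureU; [|exact: mX|exact: mY|]; last first.
    apply/seteqP; split => // t [[]]; rewrite /= !in_itv /= => tI [_ XJ] [tl _].
    by apply: XJ; apply/lP.
  by rewrite tree_muS; congr (_ + _)%E; [exact: lX|exact: lY].
move=> u; have muU : mu k.+1 [set u] = (mu k ([set u] `&` ~` [set J k]) +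
    (w k.+1)%:E * bead_image (s k.+1) (emb J k.+1) [set u])%E by exact: tree_muS.
have bfin : bead_image (s k.+1) (emb J k.+1) [set u] \is a fin_num.
  exact: fin_num_measure (measurable_places _).
have [[i iu]|nu] := pselect (exists i, emb J k.+1 (bead_pos (s k.+1) i) = u).
  have mu0 : mu k ([set u] `&` ~` [set J k]) = 0%E.
    have [out _] := tree_mu_out s J k; apply/eqP; rewrite eq_le measure_ge0 andbT.
    rewrite -[leRHS]out; apply: tree_mu_le => _ [-> /= uJ] hu.
    by move: (proj_old hu); rewrite -iu (proj_emb _ w0) iu => /esym.
  have {}muU : fine (mu k.+1 [set u]) =
      w k.+1 * fine (bead_image (s k.+1) (emb J k.+1) [set u]).
    by rewrite muU mu0 add0e fineM.
  rewrite muU; have [l' [ll' l'1 l'P]] := Yu u.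
  exists l'; split; [lra|lra|] => t tI; rewrite /X'; case: eqP => [XJ|XJ].
    by apply: l'P; apply/lP.
  split => [XU|tl'].
    have hu := level_map_pts Xk tI; rewrite XU in hu.
    by case: XJ; rewrite XU -(proj_old hu) -iu (proj_emb _ w0).
  by case: XJ; apply/lP => //; case/andP: tl' => *; apply/andP; split; lra.
have b0 : bead_image (s k.+1) (emb J k.+1) [set u] = 0%E.
  by apply: bead_image_eq0 => i e; apply: nu; exists i.
have Ynu t : 0 <= t < 1 -> X t = J k -> Y t <> u.
  move=> tI /(lP t tI) tl Yt; have [l' [_ _ l'P]] := Yu u.
  have /l'P[/(_ Yt) + _] := tl; rewrite b0 /= mulr0 addr0 => /andP[h1 h2].
  by have := le_lt_trans h1 h2; rewrite ltxx.
rewrite muU b0 mule0 adde0; have [e|uJ] := eqVneq u (J k).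
  rewrite e setICr measure0 /=; exists 0; rewrite addr0; split => // t tI.
  split; last by move=> /andP[h1 h2]; have := le_lt_trans h1 h2; rewrite ltxx.
  by rewrite /X'; case: eqP => // XJ; rewrite -e => /(Ynu t tI XJ).
have -> : [set u] `&` ~` [set J k] = [set u].
  by apply/seteqP; split => [v []//|v ->]; split => //; exact/eqP.
have [l' [l'0 l'1 l'P]] := Xu u; exists l'; split => // t tI.
rewrite -l'P// /X'; case: eqP => // XJ; rewrite XJ; split => [Yt|e].
  by case: (Ynu t tI XJ).
by rewrite e eqxx in uJ.
Qed.

(* The interval of [0, 1[ representing an atom is cut into intervals representing
   the atoms that replace it; the limit mass is then the image of the Lebesgue
   measure under the limit of the [X k]. *)
Lemma level_maps : exists X : nat -> R -> nat * R, forall k,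
  level_map k (X k) /\ forall t, 0 <= t < 1 -> proj k (X k.+1 t) = X k t.
Proof.
pose F := fix F k : {X | level_map k X} :=
  match k with
  | 0%N => cid level_map0
  | k'.+1 => let c := cid (level_mapS (svalP (F k'))) in
             exist _ (sval c) (svalP c).1
  end.
exists (fun k => sval (F k)) => k; split; first exact: svalP.
by rewrite /=; case: cid => X' [].
Qed.

End level_maps.

Section unit_image.
Context {R : realType} (Y : rootedMetricType R) (f : R -> Y).
Local Notation leb := (@lebesgue_measure R).
Hypothesis mf : forall B : set (borel Y), measurable B ->
  measurable (`[0, 1[ `&` f @^-1` B).

(** The proof of measurability is an argument so that the measure and probability instances can be
    attached to the term. *)
Definition unit_image (_ : forall B : set (borel Y), measurable B ->
  measurable (`[0, 1[ `&` f @^-1` B)) (B : set (borel Y)) : \bar R :=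
  leb (`[0, 1[ `&` f @^-1` B).

Let unit_image0 : unit_image mf set0 = 0%E.
Proof. by rewrite /unit_image preimage_set0 setI0 measure0. Qed.

Let unit_image_ge0 B : (0 <= unit_image mf B)%E.
Proof. exact: measure_ge0. Qed.

Let unit_image_sigma_additive : semi_sigma_additive (unit_image mf).
Proof.
move=> F mF tF mUF; rewrite /unit_image preimage_bigcup setI_bigcupr.
apply: measure_semi_sigma_additive.
- by move=> n; exact: mf.
- apply/trivIsetP => /= i j _ _ ij; apply/seteqP; split => // t [[_ Fi] [_ Fj]].
  by move/trivIsetP : tF => /(_ _ _ I I ij) /seteqP[+ _]; apply; split; eassumption.
- by rewrite -setI_bigcupr -preimage_bigcup; exact: mf.
Qed.

HB.instance Definition _ := isMeasure.Build _ _ _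
  (unit_image mf) unit_image0 unit_image_ge0 unit_image_sigma_additive.

Let unit_imageT : unit_image mf setT = 1%E.
Proof.
rewrite /unit_image preimage_setT setIT lebesgue_measure_itv /= lte_fin ltr01.
by rewrite oppr0 adde0.
Qed.

HB.instance Definition _ :=
  Measure_isProbability.Build _ _ _ (unit_image mf) unit_imageT.

End unit_image.

Section limit_mass.
Context {R : realType}.
Variables (eta beta : R) (s : nat -> beads R) (J : nat -> nat * R).
Variables (eta01 : 0 < eta < 1) (g : good eta beta s J).

Local Notation leb := (@lebesgue_measure R).
Local Notation pts := (tree_pts s J).
Local Notation mu := (tree_mu s J).
Local Notation T := (limit_tree eta01 g).

Lemma limit_mass_exists : exists (P : probability (borel T) R) (X : R -> T), [/\
  forall B : set (borel T), measurable B -> measurable (`[0, 1[ `&` X @^-1` B),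
  forall B : set (borel T), measurable B -> P B = leb (`[0, 1[ `&` X @^-1` B),
  forall k (A : set (nat * R)), measurable (`[0, 1[ `&` [set t | A (sval (X t) k)]) &
  forall k (A : set (nat * R)),
    leb (`[0, 1[ `&` [set t | A (sval (X t) k)]) = mu k A].
Proof.
have [X XP] := level_maps s J.
have cX t : 0 <= t < 1 -> coherent s J (X ^~ t).
  move=> tI k; have [Xk Xs] := XP k.
  by split; [exact: level_map_pts Xk tI|exact: Xs].
pose Xoo t : T := if pselect (coherent s J (X ^~ t)) is left h
  then exist _ _ h else point.
have XooE t k : 0 <= t < 1 -> sval (Xoo t) k = X k t.
  by move=> tI; rewrite /Xoo; case: pselect => // h; case: h; exact: cX.
have XA k (A : set (nat * R)) :
    `[0, 1[ `&` [set t | A (sval (Xoo t) k)] = `[0, 1[ `&` X k @^-1` A.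
  by apply/seteqP; split => t []; rewrite /= in_itv /= => tI; rewrite XooE// => At;
    split => //; rewrite in_itv.
have mA k (A : set (nat * R)) : measurable (`[0, 1[ `&` [set t | A (sval (Xoo t) k)]).
  by rewrite XA; have [[]] := XP k.
have mX (B : set (borel T)) : measurable B -> measurable (`[0, 1[ `&` Xoo @^-1` B).
  suff mXoo : measurable_fun (`[0, 1[ : set (measurableTypeR R)) (Xoo : _ -> borel T).
    by apply: mXoo; exact: measurable_itv.
  apply: (@measurability _ _ _ (borel T) _ _ (@open T)) => // _ [U oU <-].
  (* An open set is a countable union of sets that depend on one level only. A point is within
     [1/(m+1)] of its retraction: the ball of radius [2/(m+1)] around the retraction contains the
     point, and lies in the ball of radius [3/(m+1)] around it. *)
  pose A n m : set (nat * R) := [set u | controlled eta beta s J n m.+1%:R^-1 /\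
    exists h : pts n u, ball (node eta01 g h : T) (2 / m.+1%:R) `<=` U].
  have -> : `[0, 1[ `&` Xoo @^-1` U =
      \bigcup_n \bigcup_m (`[0, 1[ `&` [set t | A n m (sval (Xoo t) n)]).
    apply/seteqP; split => t.
      move=> [tI Ut].
      have /nbhs_ballP[e /= e0 eU] : nbhs (Xoo t) U by exact: open_nbhs_nbhs.
      have [m me] : exists m : nat, m.+1%:R^-1 < e / 3 :> R.
        have [m _ mP] := near_infty_natSinv_lt (PosNum (divr_gt0 e0 (ltr0Sn R 2))).
        by exists m; apply: mP => /=.
      have m0 : 0 < m.+1%:R^-1 :> R by rewrite invr_gt0.
      have [n nc] := g m0; exists n => //; exists m => //; split => //; split => //.
      exists (limit_coherent (Xoo t) n) => z; rewrite ballEmdist /= => zz.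
      apply: eU; rewrite ballEmdist /=.
      have {}zz : mdist (retract n (Xoo t)) z < 2 / m.+1%:R := zz.
      have := metric_triangle (Xoo t) (retract n (Xoo t)) z.
      have := mdist_retract (Xoo t) (ltW m0) nc.
      by move: me zz {nc m0}; move: (m.+1%:R^-1) => r; lra.
    move=> [n _ [m _ [tI [nc [h hU]]]]]; split => //; apply: hU.
    rewrite ballEmdist /= metric_sym.
    have m0 : 0 < m.+1%:R^-1 :> R by rewrite invr_gt0.
    have := mdist_retract (Xoo t) (ltW m0) nc.
    have -> : node eta01 g h = retract n (Xoo t) by exact: limit_eqP.
    by move: m0; move: (m.+1%:R^-1) => r; lra.
  by apply: bigcup_measurable => n _; apply: bigcup_measurable => m _; exact: mA.
exists (unit_image mX : probability _ _), Xoo; split => // k A.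
by rewrite XA; have [[]] := XP k.
Qed.

Definition limit_mass : probability (borel T) R := sval (cid limit_mass_exists).

Definition limit_param : R -> T := sval (cid (svalP (cid limit_mass_exists))).

Let limit_paramP := svalP (cid (svalP (cid limit_mass_exists))).

Definition limit_weighted : weighted R := Weighted limit_mass.

Lemma limit_massE (B : set (borel T)) : measurable B ->
  measurable (`[0, 1[ `&` limit_param @^-1` B) /\
  limit_mass B = leb (`[0, 1[ `&` limit_param @^-1` B).
Proof. by move=> mB; have [h1 h2 _ _] := limit_paramP; split; [exact: h1|exact: h2]. Qed.

Lemma limit_param_level k (A : set (nat * R)) :
  measurable (`[0, 1[ `&` [set t | A (sval (limit_param t) k)]) /\
  leb (`[0, 1[ `&` [set t | A (sval (limit_param t) k)]) = mu k A.
Proof. by have [_ _ h3 h4] := limit_paramP. Qed.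

(** One-sided comparisons with the sets of points whose projection lies in A; measurability in T is
    asked of B only. *)
Lemma limit_mass_le k (A : set (nat * R)) (B : set (borel T)) : measurable B ->
  (forall x : T, B x -> A (sval x k)) -> (limit_mass B <= mu k A)%E.
Proof.
move=> mB BA; have [m1 ->] := limit_massE mB.
have [m2 <-] := limit_param_level k A.
by apply: le_measure; rewrite ?inE// => t [tI Bt]; split => //; exact: BA.
Qed.

Lemma limit_mass_ge k (A : set (nat * R)) (B : set (borel T)) : measurable B ->
  (forall x : T, A (sval x k) -> B x) -> (mu k A <= limit_mass B)%E.
Proof.
move=> mB BA; have [m1 ->] := limit_massE mB.
have [m2 <-] := limit_param_level k A.
by apply: le_measure; rewrite ?inE// => t [tI At]; split => //; exact: BA.
Qed.

Definition limit_ctree : compact_tree R :=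
  @CompactTree R limit_weighted (@limit_compact _ _ _ _ _ eta01 g)
    (@limit_Rtree _ _ _ _ _ eta01 g).

Lemma limit_dGHP k c : 0 < c -> controlled eta beta s J k c ->
  (dGHP (tree beta s J k) limit_ctree <= (2 * c)%:E)%E.
Proof.
move=> c0 kc.
pose f (u : tree beta s J k) : T := node eta01 g (svalP u).
have hd (x : T) := mdist_retract x (ltW c0) kc.
(* The limit tree itself is the common space; twice c is there for the strict inequalities. *)
apply: (@dGHP_le R (tree beta s J k) limit_weighted T f id) => //.
- by move=> u v; rewrite /f node_dist.
- by rewrite mulr_gt0.
- have -> : f point = point.
    apply: limit_eqP => n; rewrite limit_pointE -[LHS]/(ancestors J k (0%N, 0) n).
    exact: (down_old _ (tree_pts_root s J n)).
  by rewrite mdistxx; lra.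
- by move=> x; exists (f x); rewrite mdistxx mulr_gt0.
- move=> y; exists (exist _ _ (limit_coherent y k)).
  have -> : f (exist _ _ (limit_coherent y k)) = retract k y by exact: limit_eqP.
  by rewrite metric_sym; have := hd y; lra.
have fE (x : T) (u : tree beta s J k) : sval u = sval x k -> f u = retract k x.
  by move=> e; apply: limit_eqP => n; rewrite /= e.
move=> C cC; split; rewrite -[wmass (tree _ _ _ _) _]/(mu k _).
- apply: (@le_trans _ _ (limit_mass (thick (2 * c) C))); last by rewrite leeDl// lee_fin; lra.
  apply: limit_mass_ge; first by apply: open_borel; exact: (@open_thick R T).
  move=> x [u Cu ux]; exists (f u) => //.
  by rewrite (fE x u ux) metric_sym; have := hd x; lra.
- apply: (@le_trans _ _ (mu k [set sval u | u in f @^-1` thick (2 * c) C])).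
    apply: limit_mass_le; first exact: closed_borel.
    move=> x Cx; exists (exist _ _ (limit_coherent x k)) => //.
    exists x => //; rewrite (fE x)//.
    by have := hd x; lra.
  by rewrite leeDl// lee_fin; lra.
Qed.

End limit_mass.

(** * The limit is a continuum tree *)

Section limit_continuum.
Context {R : realType}.
Variables (eta beta : R) (s : nat -> beads R) (J : nat -> nat * R).
Variables (eta01 : 0 < eta < 1) (g : good eta beta s J).

Local Notation mu := (tree_mu s J).
Local Notation T := (limit_tree eta01 g).
Local Notation mass := (limit_mass eta01 g).

(** A countable set that carries the masses of all levels. *)
Definition bead_points : set (nat * R) :=
  \bigcup_j \bigcup_i [set emb J j (bead_pos (s j) i)].

Lemma tree_mu_bead_points k : mu k (~` bead_points) = 0%E.
Proof.
have bi j : bead_image (s j) (emb J j : R -> places) (~` bead_points) = 0%E.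
  by apply: bead_image_eq0 => i; apply; exists j => //; exists i.
elim: k => [|k IH]; first exact: bi.
rewrite tree_muS bi mule0 adde0; apply/eqP; rewrite eq_le measure_ge0 andbT -IH.
by apply: tree_mu_le => u [].
Qed.

Definition no_atoms := forall e, 0 < e -> exists k, forall u, (mu k [set u] <= e%:E)%E.

Hypothesis na : no_atoms.

Lemma limit_mass_point (x : T) : mass [set x] = 0%E.
Proof.
apply/eqP; rewrite eq_le measure_ge0 andbT; apply/lee_addgt0Pr => e e0.
rewrite add0e; have [k ka] := na e0.
apply: le_trans (ka (sval x k)); apply: limit_mass_le; last by move=> _ ->.
by apply: closed_borel; apply: accessible_closed_set1; apply: hausdorff_accessible;
  exact: metric_hausdorff.
Qed.

(** The nodes at bead positions are countably many points, each of mass 0. The rest of the level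
    projects onto places off [bead_points], which have no mass at level k. *)
Lemma limit_mass_level k : mass (@level _ _ _ _ _ eta01 g k) = 0%E.
Proof.
have mp (x : T) : measurable ([set x] : set (borel T)).
  by apply: closed_borel; apply: accessible_closed_set1; apply: hausdorff_accessible;
    exact: metric_hausdorff.
have ml : measurable (level k : set (borel T)) by apply: closed_borel; exact: level_closed.
pose N : set (borel T) := \bigcup_j \bigcup_i [set node_of eta01 g k (emb J j (bead_pos (s j) i))].
have mN : measurable N by apply: bigcup_measurable => j _; apply: bigcup_measurable => i _; exact: mp.
have N0 : mass N = 0%E.
  apply/negligibleP => //; apply: negligible_bigcup => j; apply: negligible_bigcup => i.
  by apply/negligibleP => //; exact: limit_mass_point.
apply/eqP; rewrite eq_le measure_ge0 andbT.
apply: (@le_trans _ _ (mass (N `|` (level k `\` N)))).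
  apply: le_measure; rewrite ?inE//; first by apply: measurableU => //; exact: measurableD.
  by move=> x lx; have [?|?] := pselect (N x); [left|right].
apply: le_trans (measureU2 _ mN (measurableD ml mN)) _.
rewrite [X in (X + _)%E](_ : _ = 0%E) ?add0e; last exact: N0.
rewrite -(tree_mu_bead_points k); apply: limit_mass_le.
  exact: measurableD.
move=> x [lx nx] [j _ [i _ xk]]; apply: nx; exists j => //; exists i => //.
by rewrite /= -xk (node_ofE _ _ (limit_coherent x k)) -[LHS]lx; exact: limit_eqP.
Qed.

Lemma limit_continuum : continuum_tree (limit_ctree eta01 g).
Proof.
split; [exact: limit_Rtree| |exact: limit_mass_point|].
  have h : mass.-negligible (\bigcup_k (@level _ _ _ _ _ eta01 g k)).
    apply: negligible_bigcup => k; apply/negligibleP; last exact: limit_mass_level.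
    by apply: closed_borel; exact: level_closed.
  apply: negligibleS h => x nx; apply: contrapT => nlx; apply: nx.
  by apply: limit_leaf => k lx; apply: nlx; exists k.
move=> x nlx.
have segE := segmentE (@limit_four_point _ _ _ _ _ eta01 g)
  (compact_between (@limit_compact _ _ _ _ _ eta01 g)
     (@limit_approx_between _ _ _ _ _ eta01 g)).
have subE : (subtree x : set T) = [set y | mdist point x + mdist x y = mdist point y].
  by apply/seteqP; split => y /segE.
have msub : measurable (subtree x : set (borel T)).
  by rewrite subE; apply: closed_borel; exact: closed_beyond.
have [x0|x0] := eqVneq x point.
  apply: (@lt_le_trans _ _ 1%E); first exact: lte01.
  rewrite -(tree_mu_setT s J 0); apply: limit_mass_ge => // y _.
  by rewrite subE /= x0 mdistxx add0r.
have [k lx] : exists k, level k x.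
  by apply: contrapT => nlev; apply: nlx; apply: limit_leaf => k lx; apply: nlev; exists k.
have [//|[j [A [A0 AP]]]] := level_leaf lx x0.
apply: lt_le_trans A0 _; apply: limit_mass_ge => // y /AP.
by rewrite subE.
Qed.

End limit_continuum.

(** * Measurability of the construction *)

Section cells.
Context {R : realType}.

(** The mesh [1/(n+1)] yields countably many measurable cells, which stand in for the uncountably
    many places. *)
Definition cell_index n (u : nat * R) : nat * int := (u.1, Num.floor (u.2 * n.+1%:R)).

Definition cell n (c : nat * int) : set (nat * R) := cell_index n @^-1` [set c].

Lemma floor_eq_dist (x y : R) : Num.floor x = Num.floor y -> `|x - y| < 1.
Proof.
move=> e; have /andP[x0 x1] := floor_itv x; have /andP[y0 y1] := floor_itv y.
rewrite e intrD in x0 x1; rewrite intrD in y1.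
by rewrite ltr_norml; apply/andP; split; lra.
Qed.

Lemma cell_index_dist n (u v : nat * R) : cell_index n u = cell_index n v ->
  u.1 = v.1 /\ `|u.2 - v.2| < n.+1%:R^-1.
Proof.
move=> [e1 /floor_eq_dist h]; split => //; move: h.
rewrite -mulrBl normrM (ger0_norm (ler0n _ _)).
by rewrite -ltr_pdivlMr// div1r.
Qed.

Lemma measurable_cell n c : measurable (cell n c : set (nat * measurableTypeR R)).
Proof.
have -> : cell n c = [set c.1] `*` [set x : R | c.2%:~R <= x * n.+1%:R < (c.2 + 1)%:~R].
  apply/seteqP; split => -[i x] /=; case: c => c1 c2 /=.
    by move=> [-> <-]; split => //; exact: floor_itv.
  by move=> [-> h]; congr (_, _); exact: floor_def.
apply: measurableX => //.
rewrite (_ : mkset _ = (fun x => x * n.+1%:R) @^-1` `[c.2%:~R, (c.2 + 1)%:~R[); last first.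
  by apply/seteqP; split => x /=; rewrite in_itv.
by rewrite -[X in measurable X]setTI; apply: measurable_funM.
Qed.

(** The cells around u need not be nested as n varies. They are squeezed between the point and the
    decreasing sets [B n], to which continuity from above applies. *)
Lemma cell_mass_cvg (mu : {measure set places -> \bar R}) (u : nat * R) :
  (mu setT < +oo)%E ->
  (fun n => mu (cell n (cell_index n u))) @ \oo --> mu [set u].
Proof.
move=> mufin.
pose B n : set places := [set v : nat * R | v.1 = u.1 /\ `|v.2 - u.2| < n.+1%:R^-1].
have muS (A C : set places) : A `<=` C -> (mu A <= mu C)%E.
  by move=> AC; apply: le_measure; rewrite ?inE//; exact: measurable_places.
have IB : \bigcap_n B n = [set u].
  apply/seteqP; split => [v vB|_ -> n _]; last first.
    by split => //; rewrite subrr normr0 invr_gt0.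
  have [v1 _] := vB 0%N I.
  suff v2 : v.2 = u.2 by rewrite /= (surjective_pairing v) v1 v2 -surjective_pairing.
  apply/eqP; rewrite -subr_eq0 -normr_eq0 eq_le normr_ge0 andbT.
  apply/ler_addgt0Pl => e e0; rewrite addr0.
  have [n _ nP] := near_infty_natSinv_lt (PosNum e0).
  have [_ h] := vB n I; apply: ltW; apply: lt_trans h _; exact: nP (leqnn n).
have cB : mu \o B @ \oo --> mu [set u].
  rewrite -IB; apply: nonincreasing_cvg_mu.
  - by apply: le_lt_trans mufin; exact: muS.
  - by move=> n; exact: measurable_places.
  - exact: measurable_places.
  - move=> m n mn; apply/subsetPset => v [v1 v2]; split => //.
    by apply: lt_le_trans v2 _; rewrite lef_pV2 ?posrE// ler_nat.
apply: squeeze_cvge cB; last exact: cvg_cst.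
apply: nearW => n; apply/andP; split; first by apply: muS => _ ->.
by apply: muS => v; move=> /cell_index_dist.
Qed.

End cells.

Section bead_law.
Context {R : realType}.

Lemma bead_lawE (b : beads R) (A : set (measurableTypeR R)) :
  bead_law b A = bead_image b (id : R -> measurableTypeR R) A.
Proof. by []. Qed.

Lemma bead_image_law d (Y : measurableType d) (b : beads R) (f : R -> Y) (A : set Y) :
  bead_image b f A = bead_law b (f @^-1` A).
Proof. by rewrite bead_lawE !bead_imageE. Qed.

(** This makes the length a function of the mass measure, hence measurable. *)
Lemma bead_law_gt_len (b : beads R) x :
  (bead_len b <= x) = (bead_law b `]x, +oo[%classic == 0%E).
Proof.
apply/idP/eqP => [lx|].
  rewrite bead_lawE bead_image_eq0// => i /=; rewrite in_itv /= andbT.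
  by have /andP[_ h] := bead_pos_itv b i; rewrite ltNge (le_trans h).
rewrite bead_lawE bead_imageE => h; rewrite leNgt; apply/negP => xl.
have S0 : [set bead_pos b i | i in [set i | 0 < bead_mass b i]] !=set0.
  apply/set0P/eqP => S0; have := bead_len_gt0 b.
  by rewrite bead_lenE S0 sup0 ltxx.
move: xl; rewrite bead_lenE => /(sup_gt S0)[_ [i i0 <-] xi].
have : ((bead_mass b i)%:E <= 0)%E; last by rewrite lee_fin leNgt i0.
rewrite -h; apply: le_trans (nneseries_lim_ge i.+1 _); last first.
  by move=> n _; rewrite mule_ge0// lee_fin bead_mass_ge0.
rewrite big_nat_recr//= diracE mem_set ?mule1 ?leeDr//.
  by apply: sume_ge0 => n _; rewrite mule_ge0// lee_fin bead_mass_ge0.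
by rewrite /= in_itv /= xi.
Qed.

End bead_law.

Section measurability.
Context {R : realType} d (S : measurableType d).
Variables (xi : nat -> S -> beads R) (J : nat -> S -> nat * R).
Variables (m n : nat).
Local Notation place := (nat * measurableTypeR R)%type.
Local Notation mu w k := (tree_mu (fun j => xi j w) (fun i => J i w) k).
Local Notation W w j := (weight (fun j => xi j w) (fun i => J i w) j).

Hypothesis mxi : forall j, (j < m)%N ->
  measurable_fun setT (fun w => bead_law (xi j w)).
Hypothesis mJ : forall i, (i < n)%N -> measurable_fun setT (J i : S -> place).

Lemma measurable_bead_law j (A : set (measurableTypeR R)) : (j < m)%N ->
  measurable A -> measurable_fun setT (fun w => bead_law (xi j w) A).
Proof.
move=> jm mA.
exact: (measurable_kernel (kprobability (mxi jm)) A mA).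
Qed.

Lemma measurable_bead_len j : (j < m)%N ->
  measurable_fun setT (fun w => bead_len (xi j w)).
Proof.
move=> jm; apply: (measurability _ (RGenOInfty.measurableE R)) => // _ [_ [x ->] <-].
rewrite setTI.
rewrite (_ : _ @^-1` _ =
  ~` ((fun w => bead_law (xi j w) `]x, +oo[%classic) @^-1` [set 0%E])).
  apply: measurableC; rewrite -[X in measurable X]setTI.
  by apply: measurable_bead_law.
apply/seteqP; split => w /=; rewrite in_itv/= andbT ltNge bead_law_gt_len.
  by move=> /negP h e; apply: h; apply/eqP.
by move=> h; apply/negP => /eqP.
Qed.

(** The mass is evaluated at a random singleton. It is the limit of the masses of the cells
    containing [J k], and for each mesh only countably many cells occur. *)
Lemma measurable_mass_at k : (k < n)%N ->
  (forall B : set place, measurable B -> measurable_fun setT (fun w => mu w k B)) ->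
  measurable_fun setT (fun w => mu w k [set J k w]).
Proof.
move=> kn mmu.
apply: (@emeasurable_fun_cvg _ _ _ _
  (fun i w => mu w k (cell i (cell_index i (J k w))))) => [i|w _]; last first.
  by apply: cell_mass_cvg; rewrite tree_mu_setT ltry.
move=> _ B mB; rewrite setTI.
rewrite (_ : _ @^-1` _ = \bigcup_c (J k @^-1` cell i c `&`
    (fun w => mu w k (cell i c)) @^-1` B)).
  apply: countable_bigcupT_measurable => [|c]; first exact: countableP.
  apply: measurableI.
    by rewrite -[X in measurable X]setTI; apply: mJ => //; exact: measurable_cell.
  by rewrite -[X in measurable X]setTI; apply: mmu => //; exact: measurable_cell.
apply/seteqP; split => w /=; first by move=> h; exists (cell_index i (J k w)).
by move=> [c _ [<-]].
Qed.

Lemma measurable_section j (B : set place) : measurable B ->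
  measurable ([set x | B (j, x)] : set (measurableTypeR R)).
Proof.
move=> mB; have := @measurable_xsection _ _ _ (measurableTypeR R) B j mB.
rewrite /xsection; congr (measurable _).
by apply/seteqP; split => x /=; rewrite inE.
Qed.

Lemma measurable_punctured_section j (B : set place) : measurable B ->
  measurable ([set x : R | x != 0] `&` [set x | B (j, x)] : set (measurableTypeR R)).
Proof.
move=> mB; apply: measurableI; last exact: measurable_section.
rewrite (_ : mkset _ = ~` [set 0]).
  by apply: measurableC; exact: measurable_set1.
by apply/seteqP; split => x /= /eqP.
Qed.

(** A bead at 0 lands on the random attachment point, the others in the fixed copy; separating them
    leaves only masses of deterministic sets under the law of the string. *)
Lemma emb_image_split j (b : beads R) (K : nat -> nat * R) (B : set place) :
  measurable B ->
  bead_image b (emb K j.+1) B =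
    (bead_law b [set 0%R] * (\1_B (K j))%:E +
     bead_law b ([set x | x != 0%R] `&` [set x | B (j.+1, x)]))%E.
Proof.
move=> mB; have m0 : measurable ([set 0] : set (measurableTypeR R)) by exact: measurable_set1.
have mB' := measurable_punctured_section j.+1 mB.
rewrite bead_image_law; have [BK|BK] := pselect (B (K j)).
  rewrite indicE mem_set// mule1 -measureU//.
    congr (bead_law b _); apply/seteqP; split => x; rewrite /= /emb.
      by case: eqVneq => [->|x0] ?; [left|right].
    by case: eqVneq => [_ _ //|x0 [e|[]//]]; rewrite e eqxx in x0.
  by apply/seteqP; split => // x [/= ->]; rewrite eqxx => -[].
rewrite indicE memNset// mule0 add0e.
congr (bead_law b _); apply/seteqP; split => x; rewrite /= /emb.
  by case: eqVneq => [_ /BK|x0].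
by case: eqVneq => // _ [].
Qed.

Lemma measurable_tree_mu k (B : set place) : (k < m)%N -> (k <= n)%N ->
  measurable B -> measurable_fun setT (fun w => mu w k B).
Proof.
elim: k B => [|k IH] B km kn mB.
  rewrite (_ : (fun _ => _) = (fun w => bead_law (xi 0%N w) [set x | B (0%N, x)])).
    by apply: measurable_bead_law => //; exact: measurable_section.
  by apply/funext => w; rewrite /= bead_image_law.
have mmu (C : set place) : measurable C -> measurable_fun setT (fun w => mu w k C).
  by move=> mC; exact: (IH _ (ltnW km) (ltnW kn) mC).
have mW : measurable_fun setT (fun w => mu w k [set J k w]).
  exact: measurable_mass_at.
have mBJ : measurable_fun setT (fun w => (\1_B (J k w) : R)%:E).
  apply/(measurable_EFinP _ (fun w => \1_B (J k w) : R)).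
  apply: (measurableT_comp (f := (\1_B : place -> R))); last exact: mJ.
  exact: measurable_indic.
(* The set B deprived of [J k] is random; its mass is that of B, less that of the atom if B contains
   it. *)
rewrite (_ : (fun _ => _) = (fun w => (mu w k B - (\1_B (J k w))%:E * mu w k [set J k w]) +
   mu w k [set J k w] * (bead_law (xi k.+1 w) [set 0%R] * (\1_B (J k w))%:E +
     bead_law (xi k.+1 w) ([set x | x != 0%R] `&` [set x | B (k.+1, x)])))%E).
  apply: emeasurable_funD.
    by apply: emeasurable_funB => //; [exact: mmu|exact: emeasurable_funM].
  apply: emeasurable_funM => //; apply: emeasurable_funD.
    by apply: emeasurable_funM => //; apply: measurable_bead_law.
  by apply: measurable_bead_law => //; exact: measurable_punctured_section.
apply/funext => w; rewrite tree_muS weightE emb_image_split//; congr (_ + _)%E.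
have fin A := tree_mu_fin (xi^~ w) (J^~ w) k A.
have [BK|BK] := pselect (B (J k w)).
  rewrite indicE mem_set// mul1e.
  have -> : mu w k B = (mu w k (B `&` ~` [set J k w]) + mu w k [set J k w])%E.
    rewrite -measureU; [|exact: measurable_places..|].
      congr (tree_mu _ _ _ _); apply/seteqP; split => [u Bu|u [[]//|-> //]].
      by have [?|?] := pselect (u = J k w); [right|left].
    by apply/seteqP; split => // u [[_ /=]].
  by rewrite addeK.
rewrite indicE memNset// mul0e sube0; congr (tree_mu _ _ _ _).
by apply/seteqP; split => [u []//|u Bu]; split => // /= e; apply: BK; rewrite -e.
Qed.

Lemma measurable_weight j : (j <= m)%N -> (j <= n)%N -> measurable_fun setT (fun w => W w j).
Proof.
case: j => [_ _|k km kn]; first exact: measurable_cst.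
apply/measurable_EFinP.
rewrite (_ : _ \o _ = (fun w => mu w k [set J k w])); last first.
  by apply/funext => w /=; rewrite weightE.
apply: measurable_mass_at => // B mB.
by apply: measurable_tree_mu => //; exact: ltnW.
Qed.

End measurability.

(** * Almost sure summability of the heights *)

Section independence.
Context {R : realType} d (Omega : measurableType d) (P : probability Omega R).
Context d1 d2 (T1 : measurableType d1) (T2 : measurableType d2).
Variables (X1 : Omega -> T1) (X2 : Omega -> T2).
Hypotheses (mX1 : measurable_fun setT X1) (mX2 : measurable_fun setT X2).
Hypothesis indep : forall A B, measurable A -> measurable B ->
  P (X1 @^-1` A `&` X2 @^-1` B) = (P (X1 @^-1` A) * P (X2 @^-1` B))%E.

Local Open Scope ereal_scope.

(** Independence identifies the law of the pair with the product law, and Tonelli's theorem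
    applies. *)
Lemma integral_indep_prod (f : T1 -> \bar R) (g : T2 -> \bar R) :
  measurable_fun setT f -> measurable_fun setT g ->
  (forall x, 0 <= f x) -> (forall y, 0 <= g y) ->
  \int[P]_w (f (X1 w) * g (X2 w)) = (\int[P]_w f (X1 w)) * (\int[P]_w g (X2 w)).
Proof.
move=> mf mg f0 g0.
pose Y1 : {mfun Omega >-> T1} := HB.pack X1 (isMeasurableFun.Build _ _ _ _ X1 mX1).
pose Y2 : {mfun Omega >-> T2} := HB.pack X2 (isMeasurableFun.Build _ _ _ _ X2 mX2).
have mX : measurable_fun setT (fun w => (X1 w, X2 w)) by exact: measurable_fun_pair.
pose Y : {mfun Omega >-> (T1 * T2)%type} :=
  HB.pack (fun w => (X1 w, X2 w)) (isMeasurableFun.Build _ _ _ _ _ mX).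
pose m1 := distribution P Y1; pose m2 := distribution P Y2.
pose m' := distribution P Y.
have prodE : forall A, measurable A -> (m1 \x m2) A = m' A.
  by apply: product_measure_unique => A B mA mB; exact: indep.
have mfg : measurable_fun setT (fun z : (T1 * T2)%type => f z.1 * g z.2).
  by apply: emeasurable_funM; apply: measurableT_comp.
have fg0 (z : (T1 * T2)%type) : 0 <= f z.1 * g z.2 by rewrite mule_ge0.
transitivity (\int[m']_z (f z.1 * g z.2)).
  by rewrite ge0_integral_distribution.
transitivity (\int[m1 \x m2]_z (f z.1 * g z.2)).
  by apply: eq_measure_integral => A mA _; first [exact/esym/prodE|exact: prodE].
rewrite fubini_tonelli1//=.
transitivity (\int[m1]_x (f x * \int[m2]_y g y)).
  apply: eq_integral => x _; rewrite /fubini_F /=.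
  by rewrite ge0_integralZl.
rewrite ge0_integralZr//; last exact: integral_ge0.
by rewrite !ge0_integral_distribution.
Qed.

End independence.

(** * A pathwise bound on the weights of the picked atoms *)

Section potential.
Context {R : realType}.
Variables (q : R) (theta : R) (s : nat -> beads R) (J : nat -> nat * R).
Hypothesis q1 : 1 < q.
Hypothesis theta1 : 1 <= theta.

Local Notation mu := (tree_mu s J).
Local Notation w := (weight s J).
Local Notation gen := (generation J).

Lemma q_gt0 : 0 < q. Proof. exact: lt_trans ltr01 q1. Qed.

Definition offspring k := theta ^+ gen k.+1 * w k.+1 `^ q.

Lemma offspring_ge0 k : 0 <= offspring k.
Proof. by rewrite mulr_ge0 ?powR_ge0// exprn_ge0// (le_trans ler01). Qed.

Definition bead_powers (b : beads R) (f : R -> @places R) : {measure set (@places R) -> \bar R} :=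
  mseries (fun i => mscale (NngNum (powR_ge0 (bead_mass b i) q))
                           (dirac (f (bead_pos b i)))) 0.

Lemma bead_powersE b f A : bead_powers b f A =
  (\sum_(i <oo) ((bead_mass b i `^ q)%:E * \d_(f (bead_pos b i)) A))%E.
Proof. by []. Qed.

(** Write p_i^q = p_i^(q-1) p_i, bound the first factor by its value at the largest mass, and use
    that the masses add up to 1. *)
Lemma bead_powersT b f rho : bead_mass b 0 `^ (q - 1) <= rho ->
  (bead_powers b f setT <= rho%:E)%E.
Proof.
move=> brho; rewrite bead_powersE.
apply: (@le_trans _ _ (\sum_(i <oo) (rho%:E * (bead_mass b i)%:E))%E).
  apply: lee_nneseries => i _; first by rewrite mule_ge0// lee_fin powR_ge0.
  rewrite diracT mule1 -EFinM lee_fin.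
  have p0 := bead_mass_ge0 b i.
  have [->|pn] := eqVneq (bead_mass b i) 0.
    by rewrite powR0 ?mulr0// gt_eqF// q_gt0.
  have -> : bead_mass b i `^ q = bead_mass b i `^ (q - 1) * bead_mass b i.
    by rewrite -{3}(powRr1 p0) -powRD ?pn ?implybT// subrK.
  rewrite ler_wpM2r//; apply: le_trans brho.
  rewrite ge0_ler_powR ?nnegrE ?bead_mass_ge0//; last exact: bead_mass_ni.
  by rewrite subr_ge0 ltW.
rewrite nneseriesZl; last by move=> i _; rewrite lee_fin bead_mass_ge0.
by rewrite bead_mass_sum mule1.
Qed.

Lemma bead_powers_point b f i :
  ((bead_mass b i `^ q)%:E <= bead_powers b f [set f (bead_pos b i)])%E.
Proof.
rewrite bead_powersE; apply: le_trans (nneseries_lim_ge i.+1 _); last first.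
  by move=> n _; rewrite mule_ge0// lee_fin powR_ge0.
rewrite big_nat_recr//= diracE mem_set// mule1 leeDr//.
by apply: sume_ge0 => n _; rewrite mule_ge0// lee_fin powR_ge0.
Qed.

(* An atom of mass [m] in generation [g] counts for [theta ^+ g.+1 * m `^ q]. The
   atom [J k] counts for at least [offspring k], and the atoms that replace it
   for at most [theta * rho * offspring k], where [E rho < 1]. *)
Fixpoint potential k : {measure set (@places R) -> \bar R} :=
  if k is k'.+1 then
    measure_add
      (mrestr (potential k') (measurable_places (~` [set (J k' : places)])))
      (mscale (NngNum (mulr_ge0 (le_trans ler01 theta1) (offspring_ge0 k')))
              (bead_powers (s k) (emb J k)))
  else mscale (NngNum (le_trans ler01 theta1)) (bead_powers (s 0%N) (emb J 0)).

Lemma potentialS k A : potential k.+1 A = (potential k (A `&` ~` [set J k]) +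
  (theta * offspring k)%:E * bead_powers (s k.+1) (emb J k.+1) A)%E.
Proof. by rewrite [LHS]measure_addE. Qed.

Lemma potential0 A : potential 0 A = (theta%:E * bead_powers (s 0%N) (emb J 0) A)%E.
Proof. by []. Qed.

Lemma potential_point k u :
  ((theta ^+ (gen u.1).+1 * fine (mu k [set u]) `^ q)%:E <= potential k [set u])%E.
Proof.
have t0 : 0 <= theta := le_trans ler01 theta1.
have q0 : q != 0 by rewrite gt_eqF// q_gt0.
elim: k u => [|k IH] u.
  have [[i iu]|nu] := pselect (exists i, emb J 0 (bead_pos (s 0%N) i) = u).
    rewrite -iu potential0 [mu 0%N _]bead_image_point; last by move=> i' j [] /bead_pos_inj.
    rewrite expr1 EFinM lee_wpmul2l ?lee_fin//.
    exact: (bead_powers_point (s 0%N) (emb J 0)).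
  rewrite [mu 0%N _]bead_image_eq0 ?powR0 ?mulr0//.
  by move=> i e; apply: nu; exists i.
rewrite potentialS tree_muS.
have fin A := tree_mu_fin s J k A.
have [w0|w0] := ltP 0 (w k.+1); last first.
  have {}w0 : w k.+1 = 0 by apply/eqP; rewrite eq_le w0 weight_ge0.
  rewrite w0 mul0e adde0; apply: (@le_trans _ _ (potential k ([set u] `&` ~` [set J k]))); last first.
    by rewrite leeDl// mule_ge0// lee_fin mulr_ge0// offspring_ge0.
  have [->|uJ] := eqVneq u (J k); first by rewrite setICr !measure0 powR0// mulr0.
  have -> : [set u] `&` ~` [set J k] = [set u].
    by apply/seteqP; split => [v []//|v ->]; split => //; exact/eqP.
  exact: IH.
have hJ := tree_pts_J w0.
have genJ : gen k.+1 = (gen (J k).1).+1.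
  by rewrite generationS (_ : minn _ _ = (J k).1)//; apply/minn_idPr; case: hJ.
have [[i iu]|nu] := pselect (exists i, emb J k.+1 (bead_pos (s k.+1) i) = u).
  have -> : mu k ([set u] `&` ~` [set J k]) = 0%E.
    have [out _] := tree_mu_out s J k; apply/eqP; rewrite eq_le measure_ge0 andbT.
    rewrite -[leRHS]out; apply: tree_mu_le => _ [-> /= uJ] hu.
    by move: (proj_old hu); rewrite -iu (proj_emb _ w0) iu => /esym.
  rewrite add0e -iu bead_image_point; last first.
    by move=> a b /= /(emb_inj w0) /bead_pos_inj.
  apply: (@le_trans _ _ ((theta * offspring k)%:E * (bead_mass (s k.+1) i `^ q)%:E)%E); last first.
    rewrite -[leLHS]add0e; apply: leeD => //.
    apply: lee_wpmul2l; first by rewrite lee_fin mulr_ge0// offspring_ge0.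
    exact: (bead_powers_point (s k.+1) (emb J k.+1)).
  rewrite -!EFinM lee_fin /= powRM ?bead_mass_ge0 ?weight_ge0// /offspring.
  rewrite -[leRHS]mulrA -[X in _ <= theta * X]mulrA [leRHS]mulrA.
  rewrite ler_wpM2r ?mulr_ge0 ?powR_ge0// -exprS.
  (* A bead at 0 stays at [J k], one generation below that of the copy; as [theta >= 1], its
     potential is only larger than required. *)
  rewrite /emb; case: eqVneq => _ //=.
  by rewrite genJ ler_weXn2l// leqnSn.
have b0 : bead_image (s k.+1) (emb J k.+1) [set u] = 0%E.
  by apply: bead_image_eq0 => i e; apply: nu; exists i.
rewrite b0 mule0 adde0; apply: (@le_trans _ _ (potential k ([set u] `&` ~` [set J k]))); last first.
  by rewrite leeDl// mule_ge0// lee_fin mulr_ge0// offspring_ge0.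
have [->|uJ] := eqVneq u (J k); first by rewrite setICr !measure0 powR0// mulr0.
have -> : [set u] `&` ~` [set J k] = [set u].
  by apply/seteqP; split => [v []//|v ->]; split => //; exact/eqP.
exact: IH.
Qed.

Lemma offspring_le_potential k : ((offspring k)%:E <= potential k [set J k])%E.
Proof.
have q0 : q != 0 by rewrite gt_eqF// q_gt0.
have [w0|w0] := ltP 0 (w k.+1); last first.
  have {}w0 : w k.+1 = 0 by apply/eqP; rewrite eq_le w0 weight_ge0.
  by rewrite /offspring w0 powR0// mulr0.
apply: le_trans (potential_point k (J k)); rewrite /offspring generationS.
by rewrite (_ : minn _ _ = (J k).1)//; apply/minn_idPr; case: (tree_pts_J w0).
Qed.

Variable rho : nat -> R.
Hypothesis rhoP : forall j, bead_mass (s j) 0 `^ (q - 1) <= rho j.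

(** A balance: step k removes the atom [J k], whose potential is at least [offspring k], and adds at
    most [theta * offspring k * rho (k+1)]. *)
Lemma sum_offspring_le n :
  ((\sum_(k < n) offspring k)%:E + potential n setT <=
   (theta * rho 0%N + \sum_(k < n) theta * offspring k * rho k.+1)%:E)%E.
Proof.
have t0 : 0 <= theta := le_trans ler01 theta1.
elim: n => [|n IH].
  rewrite !big_ord0 add0e addr0 potential0 EFinM lee_wpmul2l ?lee_fin//.
  exact: bead_powersT.
rewrite !big_ord_recr /= addrA [leRHS]EFinD.
apply: le_trans (leeD IH (lexx _)).
rewrite potentialS setTI.
have -> : potential n setT = (potential n (~` [set J n]) + potential n [set J n])%E.
  rewrite -measureU; [|exact: measurable_places..|].
    by rewrite setUC setUv.
  by rewrite setICl.
rewrite EFinD -!addeA; apply: leeD => //.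
rewrite addeCA; apply: leeD => //; first exact: offspring_le_potential.
apply: leeD => //.
rewrite [leRHS]EFinM; apply: lee_wpmul2l.
  by rewrite lee_fin mulr_ge0// offspring_ge0.
exact: bead_powersT.
Qed.

End potential.

Section measurable_generation.
Context {R : realType} d (S : measurableType d).
Variables (J : nat -> S -> nat * R) (n : nat).
Hypothesis mJ : forall i, (i < n)%N ->
  measurable_fun setT (J i : S -> nat * measurableTypeR R).

Lemma measurable_exp_generation (c : R) j : (j <= n)%N ->
  measurable_fun setT (fun w => c ^+ generation (J^~ w) j).
Proof.
elim/ltn_ind: j => -[|k] IH kn; first exact: measurable_cst.
move=> _ B mB; rewrite setTI.
rewrite (_ : _ @^-1` _ = \bigcup_(i in `I_k.+1)
  ((fun w => minn k (J k w).1) @^-1` [set i] `&`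
   (fun w => c * c ^+ generation (J^~ w) i) @^-1` B)).
  apply: bigcup_measurable => i /= ik; apply: measurableI.
    rewrite -[X in measurable X]setTI.
    have mk : measurable_fun setT (fun w => (J k w).1).
      by apply: measurableT_comp => //; exact: mJ.
    exact: (measurableT_comp (f := minn k) _ mk).
  rewrite -[X in measurable X]setTI; apply: measurable_funM => //.
  by apply: IH => //; exact: leq_trans (ltnW ik) kn.
apply/seteqP; split => w /=; rewrite generationS exprS.
  by move=> h; exists (minn k (J k w).1) => //=; rewrite ltnS geq_minl.
by move=> [i _ [<-]].
Qed.

End measurable_generation.

Section sides.
Context {R : realType}.
Implicit Types (b : beads R) (x : R).

(* The largest mass of the two half-lines cut at [x]; unlike the largest mass of
   an atom, which it bounds, it is clearly a measurable function of the law. *)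
Definition larger_side x (mu : set (measurableTypeR R) -> \bar R) : R :=
  Num.max (fine (mu `]-oo, x]%classic)) (fine (mu `]x, +oo[%classic)).

Lemma bead_law_fin b (A : set (measurableTypeR R)) : measurable A ->
  bead_law b A \is a fin_num.
Proof. by move=> mA; exact: fin_num_measure. Qed.

Lemma bead_law_point_le b i (A : set (measurableTypeR R)) : measurable A ->
  A (bead_pos b i) -> bead_mass b i <= fine (bead_law b A).
Proof.
move=> mA Ai; rewrite -lee_fin fineK ?bead_law_fin// bead_lawE bead_imageE.
apply: le_trans (nneseries_lim_ge i.+1 _); last first.
  by move=> n _; rewrite mule_ge0// lee_fin bead_mass_ge0.
rewrite big_nat_recr//= diracE mem_set// mule1 leeDr//.
by apply: sume_ge0 => n _; rewrite mule_ge0// lee_fin bead_mass_ge0.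
Qed.

Lemma larger_side_ge x b : bead_mass b 0 <= larger_side x (bead_law b).
Proof.
rewrite /larger_side le_max; have [xb|xb] := leP (bead_pos b 0) x.
  by rewrite bead_law_point_le//= in_itv.
by apply/orP; right; apply: bead_law_point_le => //; rewrite /= in_itv /= xb.
Qed.

Lemma larger_side_le1 x b : larger_side x (bead_law b) <= 1.
Proof.
by rewrite ge_max -!lee_fin !fineK ?bead_law_fin// !probability_le1.
Qed.

Lemma larger_side_ge0 x b : 0 <= larger_side x (bead_law b).
Proof. by rewrite le_max fine_ge0. Qed.

(** As the largest mass is positive and less than 1, a second bead has positive mass. A rational
    between the two leaves mass on both sides. *)
Lemma larger_side_lt1 b : exists x : rat, larger_side (ratr x) (bead_law b) < 1.
Proof.
have p0 : 0 < bead_mass b 0.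
  rewrite lt_neqAle bead_mass_ge0 andbT; apply/eqP => p0.
  have := bead_mass_sum b; rewrite eseries0 => [/eqP|i _ _]; first by rewrite eqe eq_sym oner_eq0.
  congr (_%:E); apply/eqP; rewrite eq_le bead_mass_ge0 andbT p0.
  exact: (bead_mass_ni b (leq0n i)).
have p1 : 0 < bead_mass b 1.
  rewrite lt_neqAle bead_mass_ge0 andbT; apply/eqP => p1.
  have := bead_mass_sum b; rewrite (nneseriesD1 (n := 0%N))//; last first.
    by move=> i _; rewrite lee_fin bead_mass_ge0.
  rewrite eseries0 ?adde0 => [[e]|i _ i0]; first by have := bead_mass_lt1 b; rewrite e ltxx.
  congr (_%:E); apply/eqP; rewrite eq_le bead_mass_ge0 andbT p1.
  by apply: (bead_mass_ni b); rewrite lt0n.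
have [i [j [pi pj ij]]] : exists i j, [/\ 0 < bead_mass b i, 0 < bead_mass b j &
    bead_pos b i < bead_pos b j].
  have [h|h|/bead_pos_inj//] := ltgtP (bead_pos b 0%N) (bead_pos b 1%N).
    by exists 0%N, 1%N.
  by exists 1%N, 0%N.
have [x xij] := rat_in_itvoo ij; exists x; move: xij; rewrite in_itv /= => /andP[ix xj].
have mL : measurable (`]-oo, ratr x] : set (measurableTypeR R)) by [].
have mU : measurable (`]ratr x, +oo[ : set (measurableTypeR R)) by [].
have hi : bead_mass b i <= fine (bead_law b `]-oo, ratr x]%classic).
  by apply: bead_law_point_le => //; rewrite /= in_itv /= ltW.
have hj : bead_mass b j <= fine (bead_law b `]ratr x, +oo[%classic).
  by apply: bead_law_point_le => //; rewrite /= in_itv /= xj.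
have tot : fine (bead_law b `]-oo, ratr x]%classic) + fine (bead_law b `]ratr x, +oo[%classic) = 1.
  have U : `]-oo, ratr x]%classic `|` `]ratr x, +oo[%classic = setT :> set R.
    apply/seteqP; split => // y _; rewrite /= !in_itv /= andbT.
    by case: (leP y (ratr x)) => ?; [left|right].
  have D : `]-oo, ratr x]%classic `&` `]ratr x, +oo[%classic = set0 :> set R.
    by apply/seteqP; split => // y []; rewrite /= !in_itv /= andbT leNgt => /negP.
  rewrite -fineD ?bead_law_fin// -measureU// U.
  by rewrite -[RHS]/(fine 1%E) -(bead_image_setT b (id : R -> measurableTypeR R)).
by rewrite gt_max; apply/andP; split; lra.
Qed.

Lemma measurable_eval (A : set (measurableTypeR R)) : measurable A ->
  measurable_fun setT (fun mu : pprobability (measurableTypeR R) R => mu A).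
Proof.
move=> mA.
exact: (measurable_kernel (kprobability (@measurable_id _ (pprobability (measurableTypeR R) R) setT)) A mA).
Qed.

Lemma measurable_larger_side x :
  measurable_fun setT (fun mu : pprobability (measurableTypeR R) R => larger_side x mu).
Proof.
by apply: measurable_maxr; apply: measurableT_comp => //; exact: measurable_eval.
Qed.

(** The right end of the support. Rational cuts make it measurable in the law, and an arbitrary law
    can have unbounded support, whence the extended reals. *)
Definition law_len (mu : set (measurableTypeR R) -> \bar R) : \bar R :=
  ereal_sup [set (ratr r : R)%:E | r in [set r : rat | mu `]ratr r, +oo[%classic != 0%E]].

Lemma law_lenE b : law_len (bead_law b) = (bead_len b)%:E.
Proof.
have pos r : (bead_law b `]ratr r, +oo[%classic != 0%E) = (ratr r < bead_len b).
  by rewrite -bead_law_gt_len -ltNge.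
apply/eqP; rewrite eq_le; apply/andP; split.
  by apply: ge_ereal_sup => _ [r /= + <-]; rewrite pos lee_fin => /ltW.
rewrite leNgt; apply/negP => lt_sup.
have [r r1 r2] : exists2 r : rat, (law_len (bead_law b) < (ratr r)%:E)%E & ratr r < bead_len b.
  move: lt_sup; case: (law_len _) => [y| |]; rewrite ?lte_fin//.
    by move=> /rat_in_itvoo[r]; rewrite in_itv /= => /andP[? ?]; exists r.
  move=> _; have /rat_in_itvoo[r] : bead_len b - 1 < bead_len b by lra.
  by rewrite in_itv /= => /andP[? ?]; exists r => //; exact: ltNyr.
move: r1; apply/negP; rewrite -leNgt; apply: ereal_sup_ubound; exists r => //=.
by rewrite pos.
Qed.

Lemma measurable_law_len :
  measurable_fun setT (fun mu : pprobability (measurableTypeR R) R => law_len mu).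
Proof.
apply: (measurability _ (ErealGenOInfty.measurableE R)) => // _ [_ [y ->] <-].
rewrite setTI (_ : _ @^-1` _ = \bigcup_(r : rat) (if y < ratr r
  then (fun mu : pprobability (measurableTypeR R) R => mu `]ratr r, +oo[%classic) @^-1` [set~ 0%E]
  else set0)).
  apply: bigcupT_measurable_rat => r; case: ifPn => // _.
  rewrite -[X in measurable X]setTI; apply: measurable_eval => //.
  exact: measurableC.
apply/seteqP; split => mu /=; rewrite in_itv /= andbT.
  move=> /ereal_sup_gt[_ [r /= r0 <-] yr]; exists r => //.
  by rewrite lte_fin in yr; rewrite yr /=; apply/eqP.
move=> [r _]; case: ifPn => // yr /= r0; apply: (@lt_le_trans _ _ (ratr r)%:E).
  by rewrite lte_fin.
by apply: ereal_sup_ubound; exists r => //=; apply/eqP.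
Qed.

End sides.

Section random_trees.
Context {R : realType} d (Omega : measurableType d) (P : probability Omega R).
Variables (p beta : R) (xi : nat -> Omega -> beads R) (J : nat -> Omega -> nat * R).
Hypotheses (hp : 1 <= p) (hbeta : 1 / p < beta).
Hypothesis hxi : bead_copies P xi.
Hypothesis hJ : picked_from_mass P xi J.
Hypothesis hindep : independent_copies P xi J.

Local Notation q := (beta * p)%R.
Local Notation Law := (pprobability (measurableTypeR R) R).

Definition history_gen m n : set (set Omega) :=
  [set E | (exists2 j, (j < m)%N &
                 exists2 A, measurable A & E = bead_event xi j A) \/
               (exists2 i, (i < n)%N &
                 exists2 B : set (nat * measurableTypeR R),
                   measurable B & E = J i @^-1` B)].

(** The sample space with the smaller sigma-algebra: a variable depends measurably on the past when
    it is measurable as a map from this type. *)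
Definition past m n := g_sigma_algebraType (history_gen m n).

Lemma historyE m n (E : set Omega) : history xi J m n E = measurable (E : set (past m n)).
Proof. by []. Qed.

Lemma measurable_law j : measurable_fun setT (fun w => bead_law (xi j w) : Law).
Proof. by move=> _ A mA; rewrite setTI; exact: hxi.1. Qed.

Lemma measurable_pick i : measurable_fun setT (J i : Omega -> nat * measurableTypeR R).
Proof. exact: (hJ i).1. Qed.

Lemma history_measurable m n (E : set Omega) : history xi J m n E -> measurable E.
Proof.
apply: smallest_sub; first exact: sigma_algebra_measurable.
move=> _ [[j _ [A mA ->]]|[i _ [B mB ->]]]; first exact: hxi.1.
by rewrite -[X in measurable X]setTI; exact: measurable_pick.
Qed.

Lemma measurable_past m n : measurable_fun setT (id : Omega -> past m n).
Proof. by move=> _ E hE; rewrite setTI; exact: history_measurable hE. Qed.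

Lemma past_measurable_law m n j : (j < m)%N ->
  measurable_fun setT (fun w : past m n => bead_law (xi j w) : Law).
Proof.
move=> jm _ A mA; rewrite setTI; apply: sub_sigma_algebra; left.
by exists j => //; exists A.
Qed.

Lemma past_measurable_pick m n i : (i < n)%N ->
  measurable_fun setT (J i : past m n -> nat * measurableTypeR R).
Proof.
move=> im _ A mA; rewrite setTI; apply: sub_sigma_algebra; right.
by exists i => //; exists A.
Qed.

Lemma q_gt1 : 1 < q.
Proof.
by move: hbeta; rewrite ltr_pdivrMr// (lt_le_trans _ hp).
Qed.

Local Open Scope ereal_scope.

Lemma integral_law (h : Law -> \bar R) j : measurable_fun setT h ->
  (forall mu, 0 <= h mu) ->
  \int[P]_w h (bead_law (xi j w)) = \int[P]_w h (bead_law (xi 0%N w)).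
Proof.
move=> mh h0.
pose Y i : {mfun Omega >-> Law} :=
  HB.pack (fun w => bead_law (xi i w) : Law) (isMeasurableFun.Build _ _ _ _ _ (measurable_law i)).
transitivity (\int[distribution P (Y j)]_mu h mu); first by rewrite ge0_integral_distribution.
transitivity (\int[distribution P (Y 0%N)]_mu h mu); last by rewrite ge0_integral_distribution.
by apply: eq_measure_integral => A mA _; exact: hxi.2.
Qed.

Lemma integral_past_law k (f : Omega -> \bar R) (h : Law -> \bar R) :
  measurable_fun setT (f : past k.+1 k.+1 -> \bar R) -> measurable_fun setT h ->
  (forall w, 0 <= f w) -> (forall mu, 0 <= h mu) ->
  \int[P]_w (f w * h (bead_law (xi k.+1 w))) =
  (\int[P]_w f w) * (\int[P]_w h (bead_law (xi 0%N w))).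
Proof.
move=> mf mh f0 h0.
rewrite -(integral_law k.+1)//.
apply: (@integral_indep_prod _ _ _ P _ _ (past k.+1 k.+1) Law id
  (fun w => bead_law (xi k.+1 w))) => //.
- exact: measurable_past.
- exact: measurable_law.
- by move=> E A hE mA; exact: hindep.
Qed.

Definition side x (mu : Law) : \bar R := (larger_side x mu `^ (q - 1))%:E.

Lemma measurable_side x : measurable_fun setT (side x).
Proof.
apply/measurable_EFinP.
apply: (measurableT_comp (f := fun y : R => (y `^ (q - 1))%R)); first exact: measurable_powR.
exact: measurable_larger_side.
Qed.

Lemma side_ge0 x mu : 0 <= side x mu.
Proof. by rewrite lee_fin powR_ge0. Qed.

Lemma side_le1 x b : side x (bead_law b) <= 1.
Proof.
have e1 : (1 `^ (q - 1) = 1 :> R)%R by rewrite powR1.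
rewrite lee_fin -[leRHS]e1 ge0_ler_powR ?nnegrE ?larger_side_ge0 ?larger_side_le1//.
by rewrite subr_ge0 ltW// q_gt1.
Qed.

(** Otherwise, for every rational cut, the larger side has mass 1 almost surely. There are countably
    many rationals, so almost surely this holds for all of them at once, against
    [larger_side_lt1]. *)
Lemma side_exists : exists x, \int[P]_w side x (bead_law (xi 0%N w)) < 1.
Proof.
apply: contrapT => /forallNP h.
have mside x : measurable_fun setT (fun w => side x (bead_law (xi 0%N w))).
  exact: (measurableT_comp (measurable_side x) (measurable_law 0)).
have le1 x : \int[P]_w side x (bead_law (xi 0%N w)) = 1.
  apply/eqP; rewrite eq_le; apply/andP; split; last by rewrite leNgt; apply/negP; exact: h.
  rewrite -[leRHS](@probability_setT _ _ _ P) -[leRHS]mul1e -integral_cst//.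
  apply: ge0_le_integral => //; first by move=> w _; exact: side_ge0.
  by move=> w _; exact: side_le1.
have null (r : rat) : P.-negligible [set w | (larger_side (ratr r) (bead_law (xi 0%N w)) < 1)%R].
  have m1 : measurable_fun setT (fun w => 1 - side (ratr r) (bead_law (xi 0%N w))).
    by apply: emeasurable_funB.
  have : \int[P]_w `|1 - side (ratr r) (bead_law (xi 0%N w))| = 0.
    have /eqP : \int[P]_w (1 - side (ratr r) (bead_law (xi 0%N w))) +
        \int[P]_w side (ratr r) (bead_law (xi 0%N w)) = 1.
      rewrite -ge0_integralD//; last 2 first.
      - by move=> w _; rewrite sube_ge0 ?side_le1.
      - by move=> w _; exact: side_ge0.
      rewrite -[RHS](@probability_setT _ _ _ P) -[RHS]mul1e -integral_cst//.
      by apply: eq_integral => w _; rewrite subeK.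
    rewrite le1 => /eqP e.
    transitivity (\int[P]_w (1 - side (ratr r) (bead_law (xi 0%N w)))).
      by apply: eq_integral => w _; rewrite gee0_abs// sube_ge0 ?side_le1.
    move: e; set I1 := \int[P]_w (1 - _); case: I1 => [x [] e|//|//].
    by congr (_%:E); lra.
  move=> /(ae_eq_integral_abs _ measurableT m1)[N [mN N0 hN]].
  exists N; split => // w /= w1; apply: hN => /= /(_ I).
  move=> [e].
  have : (larger_side (ratr r) (bead_law (xi 0 w)) `^ (q - 1) < 1 `^ (q - 1))%R.
    rewrite gt0_ltr_powR ?nnegrE ?larger_side_ge0//.
    by rewrite subr_gt0 q_gt1.
  by rewrite powR1; lra.
have : P.-negligible (\bigcup_n (if unpickle n is Some r then
    [set w | (larger_side (ratr r) (bead_law (xi 0%N w)) < 1)%R] else set0)).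
  apply: negligible_bigcup => n; case: (unpickle n) => [r|]; first exact: null.
  exact: negligible_set0.
move=> [N [mN N0 hN]]; have : P setT <= P N.
  apply: le_measure; rewrite ?inE// => w _; apply: hN.
  by have [r rP] := larger_side_lt1 (xi 0 w); exists (pickle r); rewrite ?pickleK.
by rewrite probability_setT N0 leNgt lte01.
Qed.

Definition moment (mu : Law) : \bar R := (fine (law_len mu) `^ p)%:E.

Lemma measurable_moment : measurable_fun setT moment.
Proof.
apply/measurable_EFinP.
apply: (measurableT_comp (f := fun y : R => (y `^ p)%R)); first exact: measurable_powR.
by apply: measurableT_comp => //; exact: measurable_law_len.
Qed.

Lemma momentE b : moment (bead_law b) = (bead_len b `^ p)%:E.
Proof. by rewrite /moment law_lenE. Qed.

Hypothesis hL : 'E_P[fun w => (bead_len (xi 0%N w) `^ p)%R] < +oo.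

Local Notation Psi theta k := (fun w => offspring q theta (xi^~ w) (J^~ w) k).

Lemma past_measurable_offspring theta k :
  measurable_fun setT (Psi theta k : past k.+1 k.+1 -> R).
Proof.
apply: measurable_funM.
  apply: (@measurable_exp_generation _ _ (past k.+1 k.+1) _ k.+1) => // i ik.
  exact: past_measurable_pick.
apply: (measurableT_comp (f := fun y : R => (y `^ q)%R)); first exact: measurable_powR.
apply: (@measurable_weight _ _ (past k.+1 k.+1) _ _ k.+1 k.+1) => // i ik.
  exact: past_measurable_law.
exact: past_measurable_pick.
Qed.

Lemma measurable_offspring theta k : measurable_fun setT (Psi theta k).
Proof.
move=> _ B mB; have := @past_measurable_offspring theta k measurableT B mB.
by rewrite !setTI; exact: history_measurable.
Qed.

Section theta.
Variable theta : R.
Hypothesis theta1 : (1 <= theta)%R.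

Local Notation a k := (\int[P]_w (Psi theta k w)%:E).

Lemma generation_leq (K : nat -> nat * R) j : (generation K j <= j)%N.
Proof.
elim/ltn_ind: j => -[|j] IH //; rewrite generationS ltnS.
by apply: leq_trans (IH _ _) (geq_minl _ _); rewrite ltnS geq_minl.
Qed.

(** Generations are at most k + 1 and weights at most 1. Finiteness is what allows the inequality
    for the partial sums to be solved. *)
Lemma integral_offspring_fin k : a k \is a fin_num.
Proof.
rewrite ge0_fin_numE; last by apply: integral_ge0 => w _; rewrite lee_fin offspring_ge0.
apply: (@le_lt_trans _ _ (\int[P]_w (theta ^+ k.+1)%:E)).
  apply: ge0_le_integral => //.
  - by move=> w _; rewrite lee_fin offspring_ge0.
  - by apply/measurable_EFinP; exact: measurable_offspring.
  - move=> w _; rewrite lee_fin /offspring -[leRHS]mulr1 ler_pM ?powR_ge0//.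
    + by rewrite exprn_ge0// (le_trans ler01).
    + by rewrite ler_weXn2l// generation_leq.
    + have e1 : (1 `^ q = 1 :> R)%R by rewrite powR1.
      rewrite -[leRHS]e1 ge0_ler_powR ?nnegrE ?weight_ge0 ?weight_le1//.
      by rewrite (le_trans ler01)// ltW// q_gt1.
by rewrite integral_cst// [X in _ * X](@probability_setT _ _ _ P) mule1 ltry.
Qed.

(** The expectation of the pathwise balance: [offspring k] is a function of the past and the next
    string is independent of it, so that a partial sum A satisfies [A <= theta + theta * r * A]. *)
Lemma sum_integral_offspring x r n : \int[P]_w side x (bead_law (xi 0%N w)) = r%:E ->
  (r <= 1)%R -> (theta * r < 1)%R ->
  \sum_(k < n) a k <= (theta / (1 - theta * r))%:E.
Proof.
move=> hr r1 tr1; have t0 : (0 <= theta)%R := le_trans ler01 theta1.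
have mside j : measurable_fun setT (fun w => side x (bead_law (xi j w))).
  exact: (measurableT_comp (measurable_side x) (measurable_law j)).
have mPsi k : measurable_fun setT (fun w => (Psi theta k w)%:E).
  by apply/measurable_EFinP; exact: measurable_offspring.
have key : \sum_(k < n) a k <= theta%:E + \sum_(k < n) (theta * r)%:E * a k.
  apply: (@le_trans _ _ (\int[P]_w (theta%:E * side x (bead_law (xi 0%N w)) +
      \sum_(k < n) theta%:E * ((Psi theta k w)%:E * side x (bead_law (xi k.+1 w)))))).
    rewrite -ge0_integral_sum//; last by move=> k w _; rewrite lee_fin offspring_ge0.
    apply: ge0_le_integral => //.
    - by move=> w _; apply: sume_ge0 => k _; rewrite lee_fin offspring_ge0.
    - by apply: emeasurable_sum => k.
    - apply: emeasurable_funD; first exact: measurable_funeM.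
      apply: emeasurable_sum => k; apply: measurable_funeM.
      exact: emeasurable_funM.
    move=> w _.
    have rhoP j : (bead_mass (xi j w) 0 `^ (q - 1) <=
        larger_side x (bead_law (xi j w)) `^ (q - 1))%R.
      rewrite ge0_ler_powR ?nnegrE ?bead_mass_ge0 ?larger_side_ge0 ?larger_side_ge//.
      by rewrite subr_ge0 ltW// q_gt1.
    have h := @sum_offspring_le _ q theta (xi^~ w) (J^~ w) q_gt1 theta1 _ rhoP n.
    rewrite sumEFin; apply: le_trans (le_trans h _).
      by rewrite leeDl.
    rewrite EFinD EFinM -sumEFin; apply: leeD => //; apply: lee_sum => k _.
    by rewrite -mulrA !EFinM.
  rewrite ge0_integralD//; last 4 first.
  - by move=> w _; rewrite mule_ge0 ?lee_fin ?powR_ge0.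
  - exact: measurable_funeM.
  - move=> w _; apply: sume_ge0 => k _; rewrite !mule_ge0 ?lee_fin ?powR_ge0 ?offspring_ge0//.
  - apply: emeasurable_sum => k; apply: measurable_funeM; exact: emeasurable_funM.
  apply: leeD.
    rewrite ge0_integralZl// ?lee_fin//; last by move=> w _; rewrite lee_fin powR_ge0.
    by rewrite hr -EFinM lee_fin ler_piMr.
  rewrite ge0_integral_sum//; last 2 first.
  - by move=> k; apply: measurable_funeM; exact: emeasurable_funM.
  - by move=> k w _; rewrite !mule_ge0 ?lee_fin ?powR_ge0 ?offspring_ge0.
  apply: lee_sum => k _; rewrite ge0_integralZl//; last 2 first.
  - exact: emeasurable_funM.
  - by move=> w _; rewrite !mule_ge0 ?lee_fin ?powR_ge0 ?offspring_ge0.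
  rewrite (@integral_past_law k (fun w => (Psi theta k w)%:E) (side x))//.
  - by rewrite hr EFinM muleAC muleA.
  - by apply/measurable_EFinP; exact: past_measurable_offspring.
  - exact: measurable_side.
  - by move=> w; rewrite lee_fin offspring_ge0.
  - by move=> mu; exact: side_ge0.
pose al k := fine (a k).
have aE k : a k = (al k)%:E by rewrite fineK// integral_offspring_fin.
move: key; under eq_bigr do rewrite aE; under [X in _ + X]eq_bigr do rewrite aE -EFinM.
rewrite !sumEFin -EFinD !lee_fin -mulr_sumr ler_pdivlMr ?subr_gt0//.
by move: (\sum_(k < n) al k)%R => A; lra.
Qed.

Lemma offspring_summable x r : \int[P]_w side x (bead_law (xi 0%N w)) = r%:E ->
  (r <= 1)%R -> (theta * r < 1)%R -> \sum_(k <oo) a k < +oo.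
Proof.
move=> hr r1 tr1; apply: (@le_lt_trans _ _ (theta / (1 - theta * r))%:E); last exact: ltry.
apply: lime_le.
  by apply: is_cvg_nneseries => k _ _; apply: integral_ge0 => w _; rewrite lee_fin offspring_ge0.
by apply: nearW => n; rewrite big_mkord; exact: sum_integral_offspring hr r1 tr1.
Qed.

Lemma ae_offspring_len : \sum_(k <oo) a k < +oo ->
  {ae P, forall w, \sum_(k <oo) (Psi theta k w * bead_len (xi k.+1 w) `^ p)%:E < +oo}.
Proof.
move=> afin.
have mlen k : measurable_fun setT (fun w => moment (bead_law (xi k w))).
  exact: (measurableT_comp measurable_moment (measurable_law k)).
have mPsi k : measurable_fun setT (fun w => (Psi theta k w)%:E).
  by apply/measurable_EFinP; exact: measurable_offspring.
pose F k w := (Psi theta k w)%:E * moment (bead_law (xi k.+1 w)).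
have F0 k w : 0 <= F k w by rewrite mule_ge0// lee_fin ?offspring_ge0 ?powR_ge0.
have mF k : measurable_fun setT (F k) by exact: emeasurable_funM.
have : \int[P]_w (\sum_(k <oo) F k w) < +oo.
  rewrite (integral_nneseries P measurableT (f := F) mF (fun k w _ => F0 k w)).
  have E k : \int[P]_w F k w = (\int[P]_w moment (bead_law (xi 0%N w))) * a k.
    rewrite muleC (@integral_past_law k (fun w => (Psi theta k w)%:E) moment)//.
    - by apply/measurable_EFinP; exact: past_measurable_offspring.
    - exact: measurable_moment.
    - by move=> w; rewrite lee_fin offspring_ge0.
    - by move=> mu; rewrite lee_fin powR_ge0.
  have mom : \int[P]_w moment (bead_law (xi 0%N w)) \is a fin_num.
    rewrite ge0_fin_numE; last by apply: integral_ge0 => w _; rewrite lee_fin powR_ge0.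
    by move: hL; rewrite unlock; under eq_integral do rewrite -momentE.
  under eq_eseriesr do rewrite E -(fineK mom).
  rewrite nneseriesZl; last by move=> k _; apply: integral_ge0 => w _; rewrite lee_fin offspring_ge0.
  rewrite lte_mul_pinfty// lee_fin fine_ge0//.
  by apply: integral_ge0 => w _; rewrite lee_fin powR_ge0.
move=> hF; have mS : measurable_fun setT (fun w => \sum_(k <oo) F k w).
  by apply: ge0_emeasurable_sum.
have : P.-integrable setT (fun w => \sum_(k <oo) F k w).
  apply/integrableP; split => //.
  by under eq_integral do rewrite gee0_abs ?nneseries_ge0//.
move=> /(integrable_ae measurableT); apply: filterS => w /(_ I) /=.
rewrite ge0_fin_numE; last exact: nneseries_ge0.
by under eq_eseriesr do rewrite /F momentE.
Qed.

End theta.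

End random_trees.

Lemma nneseries_term_lt (R : realType) (u : nat -> R) (c : R) :
  (forall n, 0 <= u n) -> (\sum_(n <oo) (u n)%:E < +oo)%E -> 0 < c ->
  exists N, forall n, (N <= n)%N -> u n < c.
Proof.
move=> u0 uoo c0.
have := @nneseries_tail_cvg R (EFin \o u) predT uoo (fun n _ => u0 n).
move=> /(_ _ (@open_ereal_lt' R 0%E c%:E _)); rewrite lte_fin c0 => /(_ isT) [N _ hN].
exists N => n Nn; rewrite -lte_fin; apply: le_lt_trans (hN n Nn).
apply: le_trans (nneseries_lim_ge n.+1 _); last by move=> k _ _; rewrite lee_fin.
by rewrite big_nat1.
Qed.

Section offspring_good.
Context {R : realType}.
Variables (p beta theta : R) (s : nat -> beads R) (J : nat -> nat * R).
Hypotheses (p1 : 1 <= p) (theta1 : 1 < theta).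

Let p0 : 0 < p. Proof. exact: lt_le_trans ltr01 p1. Qed.
Let t0 : 0 < theta. Proof. exact: lt_trans ltr01 theta1. Qed.

(** The ratio [eta] of the geometric control, chosen so that its p-th power is the inverse of
    [theta]. *)
Definition decay_rate := theta `^ (- p^-1).

Lemma decay_rate01 : 0 < decay_rate < 1.
Proof.
rewrite powR_gt0//= /decay_rate powRN invf_lt1 ?powR_gt0//.
have e1 : 1 `^ p^-1 = 1 :> R by rewrite powR1.
by rewrite -[ltLHS]e1 gt0_ltr_powR ?invr_gt0 ?nnegrE ?ler01 ?ltW.
Qed.

Lemma decay_rate_powR n : (decay_rate ^+ n) `^ p * theta ^+ n = 1.
Proof.
have /andP[d0 _] := decay_rate01.
have -> : (decay_rate ^+ n) `^ p = (theta ^+ n)^-1.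
  have dp : decay_rate `^ p = theta^-1.
    by rewrite /decay_rate -powRrM mulNr mulVf ?gt_eqF// powR_inv1// ltW.
  rewrite -[decay_rate ^+ n]powR_mulrn ?(ltW d0)// powRAC dp.
  by rewrite powR_mulrn ?invr_ge0 ?ltW// exprVn.
by rewrite mulVf// gt_eqF// exprn_gt0.
Qed.

(** The p-th power of a height is its term of the series divided by [theta ^ g], that is, multiplied
    by the p-th power of [eta ^ g]. From some index on, the terms are less than the p-th power of
    [e * (1 - eta)], which is the control required. *)
Lemma offspring_good :
  (\sum_(k <oo) (offspring (beta * p) theta s J k * bead_len (s k.+1) `^ p)%:E < +oo)%E ->
  good decay_rate beta s J.
Proof.
move=> fin e e0; have /andP[d0 d1] := decay_rate01.
have c0 : 0 < e * (1 - decay_rate) by rewrite mulr_gt0// subr_gt0.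
have [|N hN] := nneseries_term_lt _ fin (powR_gt0 p c0).
  move=> n; rewrite mulr_ge0 ?powR_ge0// offspring_ge0//.
  exact: ltW.
exists N => -[//|j]; rewrite ltnS => Nj; rewrite leNgt; apply/negP => hj.
have := hN j Nj; apply/negP; rewrite -leNgt.
have g0 : 0 < decay_rate ^+ generation J j.+1 by rewrite exprn_gt0.
have h0 : 0 <= height beta s J j.+1.
  by rewrite mulr_ge0 ?scale_ge0// ltW// bead_len_gt0.
have := @gt0_ltr_powR _ p p0 _ _ _ _ hj.
rewrite !nnegrE (ltW (mulr_gt0 c0 g0)) h0 => /(_ isT isT) /ltW.
have -> : height beta s J j.+1 `^ p = scale beta s J j.+1 `^ p * bead_len (s j.+1) `^ p.
  by rewrite powRM ?scale_ge0// ltW// bead_len_gt0.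
rewrite (powRM _ (ltW c0) (ltW g0)).
rewrite /offspring powRrM -/(scale beta s J j.+1) => h.
have th0 : 0 <= theta ^+ generation J j.+1 by rewrite exprn_ge0// ltW.
have := ler_wpM2r th0 h.
rewrite -(mulrA _ ((decay_rate ^+ _) `^ p)) decay_rate_powR mulr1 => /le_trans; apply.
by rewrite mulrC mulrA.
Qed.

End offspring_good.

(** * Disappearance of the atoms *)

Section atoms.
Context {R : realType} d (Omega : measurableType d) (P : probability Omega R).
Variables (p beta : R) (xi : nat -> Omega -> beads R) (J : nat -> Omega -> nat * R).
Hypotheses (hp : 1 <= p) (hbeta : 1 / p < beta).
Hypothesis hxi : bead_copies P xi.
Hypothesis hJ : picked_from_mass P xi J.

Local Notation mu w k := (tree_mu (xi^~ w) (J^~ w) k).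
Local Notation place := (nat * measurableTypeR R)%type.

Lemma measurable_random_mu k (B : set place) : measurable B ->
  measurable_fun setT (fun w => mu w k B).
Proof.
move=> mB; apply: (@measurable_tree_mu _ _ Omega _ _ k.+1 k) => // i _.
  exact: measurable_law hxi i.
exact: measurable_pick hJ i.
Qed.

Section heavy_atoms.
Variables (k : nat) (e : R).
Hypothesis e0 : 0 < e.

Definition heavy_cell n c : set Omega := [set w | (e%:E < mu w k (cell n c))%E].

Lemma history_heavy_cell n c : history xi J k.+1 k (heavy_cell n c).
Proof.
rewrite historyE.
have mm : measurable_fun setT (fun w : past xi J k.+1 k => mu w k (cell n c)).
  apply: (@measurable_tree_mu _ _ (past xi J k.+1 k) _ _ k.+1 k) => //.
  - by move=> j jk; exact: past_measurable_law.
  - by move=> i ik; exact: past_measurable_pick.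
  - exact: measurable_cell.
rewrite (_ : heavy_cell n c = setT `&` (fun w => mu w k (cell n c)) @^-1` `]e%:E, +oo[%classic).
  by apply: mm => //; exact: emeasurable_itv.
by apply/seteqP; split => w /=; rewrite in_itv /= andbT // => -[].
Qed.

Lemma measurable_heavy_cell n c : measurable (heavy_cell n c).
Proof. exact: history_measurable hxi hJ _ _ _ (history_heavy_cell n c). Qed.

Definition heavy_pick n : set Omega :=
  [set w | heavy_cell n (cell_index n (J k w)) w].

Lemma heavy_pickE n :
  heavy_pick n = \bigcup_c (heavy_cell n c `&` J k @^-1` cell n c).
Proof.
apply/seteqP; split => w; first by move=> h; exists (cell_index n (J k w)).
by move=> [c _ [h kc]]; rewrite /heavy_pick /= (kc : cell_index n (J k w) = c).
Qed.

Let pick_cell n m : set Omega :=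
  if @pickle_inv (nat * int)%type m is Some c then heavy_cell n c `&` J k @^-1` cell n c else set0.

Let measurable_pick_cell n m : measurable (pick_cell n m).
Proof.
rewrite /pick_cell; case: pickle_inv => // c; apply: measurableI.
  exact: measurable_heavy_cell.
by rewrite -[X in measurable X]setTI; apply: (measurable_pick hJ) => //; exact: measurable_cell.
Qed.

Let heavy_pick_bigcup n : heavy_pick n = \bigcup_m pick_cell n m.
Proof.
rewrite heavy_pickE; apply/seteqP; split => w; rewrite /pick_cell.
  by move=> [c _ h]; exists (pickle c) => //; rewrite pickleK_inv.
by move=> [m _]; case: pickle_inv => // c h; exists c.
Qed.

Lemma measurable_heavy_pick n : measurable (heavy_pick n).
Proof. by rewrite heavy_pick_bigcup; apply: bigcupT_measurable. Qed.

(** A measurable event that contains, by [heavy_atomP], the existence of an atom of mass more than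
    e, without a union over all places. *)
Definition heavy_atom : set Omega :=
  \bigcap_n \bigcup_c heavy_cell n c.

Lemma heavy_atomP w u : (e%:E < mu w k [set u])%E -> heavy_atom w.
Proof.
move=> h n _; exists (cell_index n u) => //; apply: lt_le_trans h _.
by apply: tree_mu_le => _ ->.
Qed.

Lemma measurable_heavy_cells n : measurable (\bigcup_c heavy_cell n c).
Proof.
apply: countable_bigcupT_measurable => [|c]; first exact: countableP.
exact: measurable_heavy_cell.
Qed.

Lemma measurable_heavy_atom : measurable heavy_atom.
Proof. by apply: bigcapT_measurable => n; exact: measurable_heavy_cells. Qed.

(* Given the past, [J k] falls in a cell of mass more than [e] with probability
   more than [e]. *)
Lemma heavy_pick_ge n : (e%:E * P heavy_atom <= P (heavy_pick n))%E.
Proof.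
apply: (@le_trans _ _ (e%:E * P (\bigcup_c heavy_cell n c))%E).
  apply: lee_wpmul2l; [by rewrite lee_fin ltW|apply: le_measure]; rewrite ?inE.
  - exact: measurable_heavy_atom.
  - exact: measurable_heavy_cells.
  - by apply: bigcap_inf.
rewrite heavy_pick_bigcup measure_bigcup//; last first.
  apply/trivIsetP => i j _ _ ij; rewrite -subset0 => w [].
  rewrite /pick_cell.
  case ei : pickle_inv => [c|//]; case ej : pickle_inv => [c'|//] [_ h] [_ h'].
  have ii := @pickle_invK (nat * int)%type i; have jj := @pickle_invK (nat * int)%type j.
  rewrite ei ej /= in ii jj; move/eqP: ij; apply; rewrite -ii -jj.
  by rewrite -h -h'.
pose E m : set Omega := if @pickle_inv (nat * int)%type m is Some c then heavy_cell n c else set0.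
have mE m : measurable (E m).
  by rewrite /E; case: pickle_inv => // c; exact: measurable_heavy_cell.
apply: (@le_trans _ _ (e%:E * \sum_(m <oo) P (E m))%E).
  apply: lee_wpmul2l; first by rewrite lee_fin ltW.
  apply: measure_sigma_subadditive => //; first exact: measurable_heavy_cells.
  by move=> w [c _ h]; exists (pickle c) => //; rewrite /E pickleK_inv.
rewrite -nneseriesZl//; under [leRHS]eq_eseriesl do rewrite in_setT.
apply: lee_nneseries => m _; first by rewrite mule_ge0// lee_fin ltW.
rewrite /E /pick_cell; case: pickle_inv => [c|]; last by rewrite measure0 mule0.
rewrite [leRHS](_ : _ = \int[P]_(w in heavy_cell n c) mu w k (cell n c))%E; last first.
  by apply: (hJ k).2; [exact: history_heavy_cell|exact: measurable_cell].
rewrite -integral_cst; last exact: measurable_heavy_cell.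
apply: ge0_le_integral => //.
- exact: measurable_heavy_cell.
- by move=> w _; rewrite lee_fin ltW.
- apply: measurable_funTS; apply: measurable_random_mu; exact: measurable_cell.
- by move=> w /ltW.
Qed.

(** The bound of [heavy_pick_ge] is uniform in the mesh, so it passes to the event that [J k] lies
    in a heavy cell for infinitely many meshes. There, the mass of [J k] is a limit of masses
    exceeding e infinitely often, hence is at least e. *)
Lemma heavy_atom_le :
  (e%:E * P heavy_atom <= P [set w | (e <= weight (xi^~ w) (J^~ w) k.+1)%R])%E.
Proof.
have mW : measurable_fun setT (fun w => weight (xi^~ w) (J^~ w) k.+1).
  apply: (@measurable_weight _ _ Omega _ _ k.+1 k.+1) => // i _.
    exact: measurable_law hxi i.
  exact: measurable_pick hJ i.
have mL : measurable (lim_sup_set heavy_pick).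
  apply: bigcapT_measurable => n; apply: bigcup_measurable => j _.
  exact: measurable_heavy_pick.
apply: (@le_trans _ _ (P (lim_sup_set heavy_pick))).
  have h := lim_sup_set_cvg P _ measurable_heavy_pick.
  apply: (cvge_to_ge (h _)).
    apply: le_lt_trans (ltry 1); apply: probability_le1.
    by apply: bigcup_measurable => j _; exact: measurable_heavy_pick.
  apply: nearW => n; apply: le_trans (heavy_pick_ge n) _.
  apply: le_measure; rewrite ?inE; first exact: measurable_heavy_pick.
    by apply: bigcup_measurable => j _; exact: measurable_heavy_pick.
  by move=> w h'; exists n => /=.
apply: le_measure; rewrite ?inE//.
  rewrite -[X in measurable X]setTI.
  rewrite (_ : [set w | _] = (fun w => weight (xi^~ w) (J^~ w) k.+1) @^-1` `[e, +oo[%classic).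
    exact: mW.
  by apply/seteqP; split => w /=; rewrite in_itv /= andbT.
move=> w hw /=; rewrite -lee_fin weightE leNgt; apply/negP => lt.
have c := @cell_mass_cvg _ (mu w k) (J k w).
have {c} : (fun n => mu w k (cell n (cell_index n (J k w)))) @ \oo --> mu w k [set J k w].
  by apply: c; rewrite tree_mu_setT ltry.
move=> /(_ _ (@open_ereal_lt' R _ e%:E _)) => /(_ lt)[N _ hN].
have [n /= Nn] := hw N I; rewrite /heavy_pick /heavy_cell /= => /lt_trans/(_ (hN n Nn)).
by rewrite ltxx.
Qed.

End heavy_atoms.

Lemma ae_no_atoms theta : 1 <= theta ->
  (\sum_(k <oo) \int[P]_w (offspring (beta * p) theta (xi^~ w) (J^~ w) k)%:E < +oo)%E ->
  {ae P, forall w, no_atoms (xi^~ w) (J^~ w)}.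
Proof.
move=> theta1 fin.
have q0 : 0 < beta * p := lt_trans ltr01 (q_gt1 hp hbeta).
have light e : 0 < e -> P (lim_sup_set (fun k => heavy_atom k e)) = 0%E.
  move=> e0; apply: lim_sup_set_cvg0 => [k|]; first exact: measurable_heavy_atom.
  (* One factor e comes from [heavy_atom_le], the power of e from Markov's inequality for the weight
     to the power [beta * p]. *)
  pose c := (e * e `^ (beta * p)); have c0 : 0 < c by rewrite mulr_gt0// powR_gt0.
  have : (c%:E * \sum_(k <oo) P (heavy_atom k e) < +oo)%E.
    rewrite -nneseriesZl//; apply: le_lt_trans fin.
    apply: lee_nneseries => k _; first by rewrite mule_ge0// lee_fin ltW.
    rewrite /c mulrC EFinM -muleA.
    apply: (@le_trans _ _ ((e `^ (beta * p))%:E *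
        P [set w | (e <= weight (xi^~ w) (J^~ w) k.+1)%R]))%E.
      by rewrite lee_wpmul2l ?lee_fin ?powR_ge0// heavy_atom_le.
    have mPsi : measurable_fun setT
        (fun w => (offspring (beta * p) theta (xi^~ w) (J^~ w) k)%:E).
      by apply/measurable_EFinP; exact: (measurable_offspring p beta hxi hJ).
    have mE : measurable [set w | (e <= weight (xi^~ w) (J^~ w) k.+1)%R].
      rewrite -[X in measurable X]setTI.
      rewrite (_ : [set w | _] = (fun w => weight (xi^~ w) (J^~ w) k.+1) @^-1` `[e, +oo[%classic).
        apply: (@measurable_weight _ _ Omega _ _ k.+1 k.+1) => // i _.
          exact: measurable_law hxi i.
        exact: measurable_pick hJ i.
      by apply/seteqP; split => w /=; rewrite in_itv /= andbT.
    rewrite -integral_cst//.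
    apply: (@le_trans _ _ (\int[P]_(w in [set w | (e <= weight (xi^~ w) (J^~ w) k.+1)%R])
       (offspring (beta * p) theta (xi^~ w) (J^~ w) k)%:E)%E).
      apply: ge0_le_integral => //.
      - by move=> w _; rewrite lee_fin powR_ge0.
      - exact: measurable_funTS.
      - move=> w /= ew; rewrite lee_fin /offspring -[leLHS]mul1r ler_pM ?powR_ge0//.
          exact: exprn_ege1.
        by rewrite ge0_ler_powR ?nnegrE ?weight_ge0// ltW.
    apply: ge0_subset_integral => //.
    by move=> w _; rewrite lee_fin offspring_ge0.
  move=> h; rewrite ltNge leye_eq; apply/negP => /eqP E; move: h.
  by rewrite E gt0_muley ?lte_fin// ltxx.
have : P.-negligible (\bigcup_m lim_sup_set (fun k => heavy_atom k m.+1%:R^-1)).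
  apply: negligible_bigcup => m; exists (lim_sup_set (fun k => heavy_atom k m.+1%:R^-1)).
  split => //; last exact: light.
  apply: bigcapT_measurable => n; apply: bigcup_measurable => j _.
  exact: measurable_heavy_atom.
apply: negligibleS => w /= nw.
apply: contrapT => h; apply: nw => e e0.
have [m _ mP] := near_infty_natSinv_lt (PosNum e0).
apply: contrapT => /forallNP h2; apply: h; exists m => // k _.
have /existsNP[u /negP] := h2 k; rewrite -ltNge => hu; exists k => //=.
apply: (@heavy_atomP _ _ _ u); apply: lt_trans hu; rewrite lte_fin.
exact: mP (leqnn m).
Qed.

End atoms.

(** * Measurability of the limit tree *)

Section perturbation.
Context {R : realType}.
Variables (beta : R) (s s' : nat -> beads R) (J J' : nat -> nat * R).
Variables (k : nat) (b r : R).
Hypothesis beta0 : 0 <= beta.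
Hypothesis sc2 : forall j, (j <= k)%N -> `|scale beta s J j - scale beta s' J' j| <= r.

Definition matching (u u' : nat * R) :=
  [/\ u.1 = u'.1, `|u.2 - u'.2| <= r & `|u.2| <= b].

Lemma scale_le1 j : scale beta s J j <= 1.
Proof.
have e1 : 1 `^ beta = 1 :> R by rewrite powR1.
by rewrite -[leRHS]e1 ge0_ler_powR ?nnegrE ?weight_ge0 ?weight_le1.
Qed.

Lemma perturb_strand j (x y x' y' : R) : (j <= k)%N ->
  `|x - x'| <= r -> `|y - y'| <= r -> `|x| <= b -> `|y| <= b ->
  scale beta s' J' j <= 1 ->
  `|scale beta s J j * `|x - y| - scale beta s' J' j * `|x' - y'| | <= 2 * b * r + 2 * r.
Proof.
move=> jk xx yy xb yb s1; have h := sc2 jk.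
set c := scale beta s J j in h *; set c' := scale beta s' J' j in h s1 *.
have c'0 : 0 <= c' := scale_ge0 _ _ _ _.
have -> : c * `|x - y| - c' * `|x' - y'| =
  (c - c') * `|x - y| + c' * (`|x - y| - `|x' - y'|) by lra.
apply: le_trans (ler_normD _ _) _; apply: lerD.
  rewrite normrM normr_id mulrC; apply: ler_pM => //.
  by apply: le_trans (ler_normB _ _) _; lra.
rewrite normrM ger0_norm//; apply: le_trans (ler_piMl (normr_ge0 _) s1) _.
apply: le_trans (ler_dist_dist _ _) _.
have -> : x - y - (x' - y') = (x - x') - (y - y') by lra.
by apply: le_trans (ler_normB _ _) _; lra.
Qed.

Lemma perturb_tip j (x x' : R) : (j <= k)%N ->
  `|x - x'| <= r -> `|x| <= b -> scale beta s' J' j <= 1 ->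
  `|scale beta s J j * x - scale beta s' J' j * x'| <= 2 * b * r + 2 * r.
Proof.
move=> jk xx xb s1; have h := sc2 jk.
set c := scale beta s J j in h *; set c' := scale beta s' J' j in h s1 *.
have c'0 : 0 <= c' := scale_ge0 _ _ _ _.
have -> : c * x - c' * x' = (c - c') * x + c' * (x - x') by lra.
apply: le_trans (ler_normD _ _) _.
have h1 : `|(c - c') * x| <= b * r by rewrite normrM mulrC ler_pM.
have h2 : `|c' * (x - x')| <= r.
  by rewrite normrM ger0_norm//; apply: le_trans (ler_piMl (normr_ge0 _) s1) xx.
have : 0 <= b * r by exact: le_trans h1.
have : 0 <= r by exact: le_trans h2.
lra.
Qed.

End perturbation.

(** Each of the k + 1 stages of the recursion contributes at most one error: [2 * b * r] from the
    scales, on distances at most [2 * b], and [2 * r] from the positions, the scales being at most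
    1. *)
Lemma tree_dist_perturb (R : realType) (beta : R) (s s' : nat -> beads R)
    (J J' : nat -> nat * R) k (b r : R) : 0 <= b -> 0 <= r -> 0 <= beta ->
  (forall i, (i < k)%N -> matching b r (J i) (J' i)) ->
  (forall j, (j <= k)%N -> `|scale beta s J j - scale beta s' J' j| <= r) ->
  forall u v u' v', matching b r u u' -> matching b r v v' ->
  `|tree_dist beta s J k u v - tree_dist beta s' J' k u' v'| <=
    k.+1%:R * (2 * b * r + 2 * r).
Proof.
move=> b0 r0 beta0; have c0 : 0 <= 2 * b * r + 2 * r.
  by rewrite addr_ge0 ?mulr_ge0.
elim: k => [|k IH] JJ sc2 u v u' v' [u1 u2 ub] [v1 v2 vb].
  rewrite mul1r /=; apply: le_trans (ler_dist_dist _ _) _.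
  have -> : u.2 - v.2 - (u'.2 - v'.2) = (u.2 - u'.2) - (v.2 - v'.2) by lra.
  have br : 0 <= b * r by exact: mulr_ge0.
  by apply: le_trans (ler_normB _ _) _; lra.
have {}IH := IH (fun i h => JJ i (leqW h)) (fun j h => sc2 j (leqW h)).
have JJk : matching b r (J k) (J' k) by exact: JJ.
have sc1 := @scale_le1 _ beta s' J' beta0 k.+1.
rewrite !tree_distS -u1 -v1 -[k.+2]addn1 natrD mulrDl mul1r.
have d0 : 0 <= k.+1%:R * (2 * b * r + 2 * r) by rewrite mulr_ge0.
case: eqP => eu; case: eqP => ev.
- apply: le_trans (perturb_strand sc2 _ u2 v2 ub vb sc1) _ => //.
  by rewrite lerDr.
- have h := perturb_tip sc2 (leqnn _) u2 ub sc1.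
  have h' := IH _ _ _ _ JJk (And3 v1 v2 vb).
  rewrite opprD addrACA addrC; apply: le_trans (ler_normD _ _) _.
  exact: lerD.
- have h := perturb_tip sc2 (leqnn _) v2 vb sc1.
  have h' := IH _ _ _ _ (And3 u1 u2 ub) JJk.
  rewrite opprD addrACA; apply: le_trans (ler_normD _ _) _.
  exact: lerD.
- apply: le_trans (IH _ _ _ _ _ _) _ => //.
  by rewrite lerDl.
Qed.

Section grid.
Context {R : realType}.
Variables (eta beta : R) (s : nat -> beads R) (J : nat -> nat * R).
Variables (n k : nat).

Local Notation pts := (tree_pts s J).
Local Notation dist := (tree_dist beta s J).
Local Notation w := (weight s J).

Lemma tree_dist_leq j m u v : (j <= m)%N -> pts j u -> pts j v -> dist m u v = dist j u v.
Proof.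
move=> /subnKC <-; elim: (m - j)%N => [|i IH] hu hv; first by rewrite addn0.
by rewrite addnS tree_dist_stable ?IH//; apply: (@tree_pts_leq _ _ _ j); rewrite ?leq_addr.
Qed.

Definition grid_pos (i : int) : R := i%:~R / n.+1%:R.

Definition grid_valid (c : nat * int) : bool :=
  [&& (c.1 <= k)%N, 0 <= c.2, grid_pos c.2 <= bead_len (s c.1) & 0 < w c.1].

(** The left grid point serves as centre of a cell, and the root replaces it when it is not in the
    tree. Whether it is there depends on comparisons that a code can record. *)
Definition grid_place c : nat * R :=
  if grid_valid c then emb J c.1 (grid_pos c.2) else (0%N, 0).

Lemma grid_pos_ge0 i : 0 <= i -> 0 <= grid_pos i.
Proof. by move=> i0; rewrite divr_ge0// ler0z. Qed.

Lemma grid_place_pts c : pts k (grid_place c).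
Proof.
rewrite /grid_place; case: ifPn => [/and4P[ck c0 cl w0]|_]; last exact: tree_pts_root.
by apply: (tree_pts_leq ck); apply: emb_pts => //; rewrite grid_pos_ge0.
Qed.

Lemma cell_index_valid u : pts k u -> grid_valid (cell_index n u) /\
  0 <= u.2 - grid_pos (cell_index n u).2 <= n.+1%:R^-1.
Proof.
move=> [uk /andP[u0 ul] uw]; have n0 : 0 < n.+1%:R :> R by [].
have /andP[f0 f1] := floor_itv (u.2 * n.+1%:R).
have h : 0 <= u.2 - grid_pos (cell_index n u).2 <= n.+1%:R^-1.
  rewrite subr_ge0 ler_pdivrMr// f0 /= lerBlDr.
  rewrite -[X in X + _]mul1r -mulrDl ler_pdivlMr//.
  by rewrite intrD in f1; apply: ltW; rewrite addrC.
split => //; apply/and4P; split => //=.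
- by rewrite floor_ge0 mulr_ge0.
- by apply: le_trans ul; rewrite -subr_ge0; case/andP: h.
- by case: (posnP u.1) => [->|/uw[]].
Qed.

Lemma grid_place_dist u : 0 <= beta -> pts k u ->
  dist k u (grid_place (cell_index n u)) <= n.+1%:R^-1.
Proof.
move=> beta0 hu; have [uv /andP[u0 un]] := cell_index_valid hu.
rewrite /grid_place uv; move: (uv) => /and4P[uk c0 cl w0].
have uE : u = emb J u.1 u.2.
  case: hu => _ _ uw; move: uw; case: (u) => -[|j] t //= /(_ isT)[t0 _].
  by rewrite gt_eqF.
have tI : 0 <= u.2 <= bead_len (s u.1) by case: hu.
have cI : 0 <= grid_pos (cell_index n u).2 <= bead_len (s (cell_index n u).1).
  by rewrite cl grid_pos_ge0.
rewrite [X in dist k X]uE (tree_dist_leq uk) ?emb_dist//; try exact: emb_pts.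
rewrite ger0_norm//; apply: le_trans un.
by apply: ler_piMl => //; exact: scale_le1.
Qed.

Variables (eta01 : 0 < eta < 1) (g : good eta beta s J).
Local Notation T := (limit_tree eta01 g).

Definition grid_node c : T := node_of eta01 g k (grid_place c).

Lemma grid_node_dist (x : T) c : 0 <= beta -> 0 <= c -> controlled eta beta s J k c ->
  mdist x (grid_node (cell_index n (sval x k))) <= c + n.+1%:R^-1.
Proof.
move=> beta0 c0 kc; apply: le_trans (metric_triangle x (retract k x) _) _.
apply: lerD; first exact: mdist_retract.
have hx := limit_coherent x k.
rewrite /grid_node (node_ofE _ _ (grid_place_pts _)) node_dist.
exact: grid_place_dist.
Qed.

Lemma grid_node_root : grid_node (0%N, 0) = point.
Proof.
rewrite /grid_node /grid_place.
have -> : (if grid_valid (0%N, 0) then emb J 0 (grid_pos 0) else (0%N, 0)) = (0%N, 0 : R).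
  by case: ifP => _ //; rewrite /grid_pos mul0r.
rewrite (node_ofE _ _ (tree_pts_root s J k)); apply: limit_eqP => m.
rewrite limit_pointE /=; have [km|mk] := leqP k m; first by rewrite ancestors_geq.
by rewrite /ancestors (down_old _ (tree_pts_root s J m)).
Qed.

End grid.

Section finite_cells.
Context {R : realType}.
Variables (n k N : nat).

(** With bounded lengths only these cells carry mass, so that finitely many unions of cells account
    for all the masses in the Prokhorov distance. *)
Definition finite_cells (A : {set 'I_k.+1 * 'I_N.+1}) : set (nat * int) :=
  [set c | exists2 x, x \in A & c = (x.1 : nat, (x.2 : nat)%:Z)].

Lemma tree_mu_finite_cells (s : nat -> beads R) (J : nat -> nat * R) (S : set (nat * int)) :
  (forall u, tree_pts s J k u -> u.2 * n.+1%:R < N.+1%:R) ->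
  tree_mu s J k (cell_index n @^-1` S) =
  tree_mu s J k (cell_index n @^-1` finite_cells
    [set x : 'I_k.+1 * 'I_N.+1 | `[< S (x.1 : nat, (x.2 : nat)%:Z) >]]).
Proof.
move=> hN; rewrite tree_mu_pts [in RHS]tree_mu_pts; congr (tree_mu s J k _).
apply/seteqP; split => u [hS hu]; split => //; last first.
  by move: hS => [x + /= ->]; rewrite inE => /asboolP.
have [/and4P[uk u0 _ _] _] := cell_index_valid n hu.
have uN : (`|(cell_index n u).2| < N.+1)%N.
  rewrite -ltz_nat gez0_abs//= -(ltr_int R).
  by apply: le_lt_trans (hN _ hu); exact: floor_le.
have uk' : ((cell_index n u).1 < k.+1)%N by [].
have e : cell_index n u = (Ordinal uk' : nat, (Ordinal uN : nat)%:Z).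
  by rewrite /= gez0_abs.
exists (Ordinal uk', Ordinal uN) => //.
by rewrite inE; apply/asboolP; rewrite -e.
Qed.

End finite_cells.

(** Both limit trees are compared through the cells of level k. The radius [dlt] of a cell is shared
    equally by the retraction and the mesh, and the centres match with distortion at most [dlt] by
    [tree_dist_perturb]. *)
Lemma limit_dGHP_close (R : realType) (eta beta : R) (s s' : nat -> beads R)
    (J J' : nat -> nat * R) (eta01 : 0 < eta < 1)
    (g : good eta beta s J) (g' : good eta beta s' J')
    (k n b : nat) (dlt r : R) :
  0 <= beta -> 0 < dlt -> 0 <= r ->
  k.+1%:R * (2 * b%:R * r + 2 * r) <= dlt -> n.+1%:R^-1 <= dlt / 2 ->
  controlled eta beta s J k (dlt / 2) -> controlled eta beta s' J' k (dlt / 2) ->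
  (forall i, (i < k)%N -> matching b%:R r (J i) (J' i)) ->
  (forall j, (j <= k)%N -> `|scale beta s J j - scale beta s' J' j| <= r) ->
  (forall j, (j <= k)%N -> (0 < weight s J j) = (0 < weight s' J' j)) ->
  (forall j, (j <= k)%N -> bead_len (s j) <= b%:R /\ bead_len (s' j) <= b%:R) ->
  (forall j i, (j <= k)%N -> (i <= b * n.+1)%N ->
    ((grid_pos n i : R) <= bead_len (s j)) = ((grid_pos n i : R) <= bead_len (s' j))) ->
  (forall A : {set 'I_k.+1 * 'I_(b * n.+1).+1},
    `|fine (tree_mu s J k (cell_index n @^-1` finite_cells A)) -
      fine (tree_mu s' J' k (cell_index n @^-1` finite_cells A))| <= dlt) ->
  (dGHP (limit_ctree eta01 g) (limit_ctree eta01 g') <= (4 * dlt)%:E)%E.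
Proof.
move=> beta0 d0 r0 rd nd ks ks' JJ scsc ww lenb len_len mumu.
have d2 : 0 <= dlt / 2 by rewrite divr_ge0// ltW.
have valid c : grid_valid s J n k c = grid_valid s' J' n k c.
  rewrite /grid_valid; case: (leqP c.1 k) => //= ck.
  case: (c) ck => j [i|i] //= jk; rewrite ww//; congr (_ && _).
  have [ib|bi] := leqP i (b * n.+1); first exact: len_len.
  have out t : bead_len (t j) <= b%:R -> ((grid_pos n i : R) <= bead_len (t j)) = false.
    move=> tb; apply/negbTE; rewrite -ltNge; apply: le_lt_trans tb _.
    by rewrite ltr_pdivlMr// -natrM -[ltRHS]/(i%:R) ltr_nat.
  by have [h h'] := lenb j jk; rewrite !out.
have match_root : matching b%:R r (0%N, 0 : R) (0%N, 0).
  by split; rewrite /= ?subr0 ?normr0.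
have match_place c : matching b%:R r (grid_place s J n k c) (grid_place s' J' n k c).
  rewrite /grid_place -valid; case: ifPn => [/and4P[ck c0 cl w0]|_]; last exact: match_root.
  have mc : matching b%:R r (c.1, grid_pos n c.2) (c.1, grid_pos n c.2).
    split => //=; first by rewrite subrr normr0.
    by rewrite ger0_norm ?grid_pos_ge0// (le_trans cl)//; case: (lenb c.1 ck).
  case: (c.1) ck mc => [|j] // jk mc; rewrite /emb; case: ifP => _ //.
  exact: JJ.
have lt_cells (t : nat -> beads R) K u : (forall j, (j <= k)%N -> bead_len (t j) <= b%:R) ->
    tree_pts t K k u -> u.2 * n.+1%:R < (b * n.+1).+1%:R.
  move=> tb [uk /andP[_ ul] _]; apply: (@le_lt_trans _ _ ((b * n.+1)%:R)); last by rewrite ltr_nat.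
  by rewrite natrM ler_wpM2r// (le_trans ul)// tb.
apply: (@dGHP_cells R (limit_ctree eta01 g) (limit_ctree eta01 g') (nat * int)
  (grid_node n k eta01 g) (grid_node n k eta01 g')
  (fun x => cell_index n (sval x k)) (fun x => cell_index n (sval x k))
  (fun S => tree_mu s J k (cell_index n @^-1` S))
  (fun S => tree_mu s' J' k (cell_index n @^-1` S)) (0%N, 0)) => //.
- move=> c c'; rewrite /grid_node !node_of_dist; try exact: grid_place_pts.
  by apply: le_trans (tree_dist_perturb _ r0 beta0 JJ scsc (match_place c) (match_place c')) rd.
- exact: grid_node_root.
- exact: grid_node_root.
- by move=> x; apply: le_trans (grid_node_dist n x beta0 d2 ks) _; apply: le_trans (lerD (lexx _) nd) _; lra.
- by move=> x; apply: le_trans (grid_node_dist n x beta0 d2 ks') _; apply: le_trans (lerD (lexx _) nd) _; lra.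
- move=> B S mB; split => h; first exact: limit_mass_le.
  by apply: limit_mass_ge.
- move=> B S mB; split => h; first exact: limit_mass_le.
  by apply: limit_mass_ge.
- move=> S; pose A : {set 'I_k.+1 * 'I_(b * n.+1).+1} := [set x : 'I_k.+1 * 'I_(b * n.+1).+1 | `[< S (x.1 : nat, (x.2 : nat)%:Z) >]]%SET.
  rewrite (tree_mu_finite_cells (N := b * n.+1) S); last first.
    by move=> u; apply: lt_cells => j jk; case: (lenb j jk).
  rewrite (tree_mu_finite_cells (s := s') (N := b * n.+1) S); last first.
    by move=> u; apply: lt_cells => j jk; case: (lenb j jk).
  have := mumu A; rewrite -(fineK (tree_mu_fin s J k _)) -(fineK (tree_mu_fin s' J' k _)).
  rewrite -!EFinD !lee_fin /=; set x := fine _; set y := fine _ => h.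
  by rewrite ler_distl in h; case/andP: h; split; lra.
Qed.

Section measurable_fibres.
Context d (Omega : measurableType d).

Definition measurable_fibres (C : Type) (f : Omega -> C) :=
  forall c, measurable (f @^-1` [set c]).

Lemma measurable_fibres_pair (C D : Type) (f : Omega -> C) (g : Omega -> D) :
  measurable_fibres f -> measurable_fibres g -> measurable_fibres (fun w => (f w, g w)).
Proof.
move=> mf mg [c e].
rewrite (_ : _ @^-1` _ = f @^-1` [set c] `&` g @^-1` [set e]).
  exact: measurableI.
by apply/seteqP; split => w /= [-> ->].
Qed.

Lemma measurable_fibres_ffun (F : finType) (C : Type) (f : F -> Omega -> C) :
  (forall i, measurable_fibres (f i)) -> measurable_fibres (fun w => [ffun i => f i w]).
Proof.
move=> mf c.
rewrite (_ : _ @^-1` _ = \bigcap_(i in [set: F]) (f i @^-1` [set c i])).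
  by apply: fin_bigcap_measurable => [|i _]; [exact: finite_finset|exact: mf].
apply/seteqP; split => [w /= <- i _|w h]; first by rewrite ffunE.
by apply/ffunP => i; rewrite ffunE; exact: h.
Qed.

Lemma measurable_fibres_bool (b : Omega -> bool) :
  measurable [set w | b w] -> measurable_fibres b.
Proof.
move=> mb [].
  by rewrite (_ : _ @^-1` _ = [set w | b w])//; apply/seteqP; split => w.
rewrite (_ : _ @^-1` _ = ~` [set w | b w]); first exact: measurableC.
by apply/seteqP; split => w /=; [move=> ->|move/negP/negbTE].
Qed.

Lemma measurable_fibres_le (R : realType) (f g : Omega -> R) :
  measurable_fun setT f -> measurable_fun setT g -> measurable_fibres (fun w => f w <= g w).
Proof.
move=> mf mg; apply: measurable_fibres_bool.
by rewrite -[X in measurable X]setTI; exact: measurable_fun_le.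
Qed.

Lemma measurable_fibres_floor (R : realType) (f : Omega -> R) (c : R) :
  measurable_fun setT f -> measurable_fibres (fun w => Num.floor (f w * c)).
Proof.
move=> mf i.
rewrite (_ : _ @^-1` _ = (fun w => f w * c) @^-1` `[i%:~R, (i + 1)%:~R[%classic).
  by rewrite -[X in measurable X]setTI; apply: measurable_funM.
apply/seteqP; split => w /=; rewrite in_itv /=; last exact: floor_def.
by move=> <-; exact: floor_itv.
Qed.

(* A GHP-open set pulls back to the union of the fibres of the codes that it
   contains, of which there are countably many. *)
Lemma random_tree_fibres (R : realType) (T : Omega -> compact_tree R) (G : set Omega)
    (X0 : compact_tree R) (I : countType) (C : I -> countType)
    (code : forall i, Omega -> C i) :
  measurable G -> (forall w, ~ G w -> T w = X0) ->
  (forall i, measurable_fibres (code i)) ->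
  (forall w e, G w -> 0 < e -> exists i, forall w', G w' -> code i w' = code i w ->
     (dGHP (T w) (T w') < e%:E)%E) ->
  random_tree T.
Proof.
move=> mG TX mcode close U oU.
pose V i (c : C i) : set Omega :=
  if pselect (G `&` code i @^-1` [set c] `<=` T @^-1` U) then G `&` code i @^-1` [set c] else set0.
have mV i c : measurable (@V i c).
  by rewrite /V; case: pselect => [h|_] /=; [apply: measurableI => //; exact: mcode|exact: measurable0].
rewrite (_ : T @^-1` U = (\bigcup_i \bigcup_c (@V i c)) `|` (~` G `&` [set _ | U X0])).
  apply: measurableU.
    apply: countable_bigcupT_measurable => [|i]; first exact: countableP.
    by apply: countable_bigcupT_measurable => [|c]; first exact: countableP.
  apply: measurableI; first exact: measurableC.
  have [UX|UX] := pselect (U X0).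
    by rewrite (_ : mkset _ = setT)//; apply/seteqP; split.
  by rewrite (_ : mkset _ = set0)//; apply/seteqP; split.
apply/seteqP; split => [w Uw|w].
  have [Gw|nGw] := pselect (G w); last by right; split => //=; rewrite -(TX w).
  left; have [e e0 eU] := oU _ Uw; have [i iP] := close w e Gw e0.
  exists i => //; exists (code i w) => //; rewrite /V; case: pselect => // h.
  by exfalso; apply: h => w' [Gw' e']; apply: eU; exact: iP.
move=> [[i _ [c _]]|[nG UX]]; last by rewrite /= TX.
by rewrite /V; case: pselect => // h /h.
Qed.

End measurable_fibres.

Section code.
Context {R : realType} d (Omega : measurableType d).
Variables (eta beta : R) (xi : nat -> Omega -> beads R) (J : nat -> Omega -> nat * R).
Hypothesis mxi : forall j, measurable_fun setT (fun w => bead_law (xi j w)).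
Hypothesis mJ : forall i, measurable_fun setT (J i : Omega -> nat * measurableTypeR R).

Lemma measurable_scale j :
  measurable_fun setT (fun w => scale beta (xi^~ w) (J^~ w) j).
Proof.
apply: (measurableT_comp (f := fun y : R => y `^ beta)); first exact: measurable_powR.
by apply: (@measurable_weight _ _ Omega _ _ j j).
Qed.

Lemma measurable_controlled k c :
  measurable [set w | controlled eta beta (xi^~ w) (J^~ w) k c].
Proof.
rewrite (_ : mkset _ = \bigcap_(j in [set j | (k < j)%N]) [set w |
  height beta (xi^~ w) (J^~ w) j <= c * (1 - eta) * eta ^+ generation (J^~ w) j]).
  apply: bigcap_measurable => [|j _]; first by exists k.+1 => /=.
  rewrite -[X in measurable X]setTI; apply: measurable_fun_le => //.
    apply: measurable_funM; first exact: measurable_scale.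
    by apply: (@measurable_bead_len _ _ Omega _ j.+1).
  apply: measurable_funM => //.
  by apply: (@measurable_exp_generation _ _ Omega _ j).
by apply/seteqP; split => w.
Qed.

Definition code_pick (k b K : nat) w : {ffun 'I_k -> nat * int * bool} :=
  [ffun i : 'I_k => ((J i w).1, Num.floor ((J i w).2 * K%:R), `|(J i w).2| <= b%:R)].

Definition code_bead (k n b K : nat) w :
    {ffun 'I_k.+1 -> int * bool * bool * {ffun 'I_(b * n.+1).+1 -> bool}} :=
  [ffun j : 'I_k.+1 => (Num.floor (scale beta (xi^~ w) (J^~ w) j * K%:R),
    weight (xi^~ w) (J^~ w) j <= 0, bead_len (xi j w) <= b%:R,
    [ffun i : 'I_(b * n.+1).+1 => grid_pos n (i : nat)%:Z <= bead_len (xi j w)])].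

Definition code_mass (k n b K : nat) w : {ffun {set 'I_k.+1 * 'I_(b * n.+1).+1} -> int} :=
  [ffun A => Num.floor (fine (tree_mu (xi^~ w) (J^~ w) k (cell_index n @^-1` finite_cells A)) * K%:R)].

(** The mesh is [1/(2 (m+1))], half of the precision [1/(m+1)]. *)
Definition code_grid m := (2 * m)%N.+1.

(** With r the inverse of this number, the perturbation bound [(k+1) (2 b r + 2 r)] equals
    [1/(m+1)]. *)
Definition code_mesh m k b := (k.+1 * (2 * b).+2 * m.+1)%N.

(** Recording the control makes level k accurate for every outcome that shares the code of a
    controlled one. *)
Definition code_tail (m k : nat) w : bool :=
  `[< controlled eta beta (xi^~ w) (J^~ w) k (m.+1%:R^-1 / 2) >].

Definition tree_code m k b w := (code_pick k b (code_mesh m k b) w,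
  code_bead k (code_grid m) b (code_mesh m k b) w,
  code_mass k (code_grid m) b (code_mesh m k b) w, code_tail m k w).

Lemma measurable_fibres_tree_code m k b : measurable_fibres (tree_code m k b).
Proof.
have mJ1 i : measurable_fun setT (fun w => (J i w).1).
  exact: (measurableT_comp (@measurable_fst _ _ nat (measurableTypeR R)) (mJ i)).
have mJ2 i : measurable_fun setT (fun w => (J i w).2).
  exact: (measurableT_comp (@measurable_snd _ _ nat (measurableTypeR R)) (mJ i)).
have mlen j : measurable_fun setT (fun w => bead_len (xi j w)).
  by apply: (@measurable_bead_len _ _ Omega _ j.+1).
have mle := @measurable_fibres_le _ Omega R.
apply: measurable_fibres_pair; last first.
  apply: measurable_fibres_bool.
  rewrite (_ : mkset _ = [set w | controlled eta beta (xi^~ w) (J^~ w) k (m.+1%:R^-1 / 2)]).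
    exact: measurable_controlled.
  by apply/seteqP; split => w /asboolP.
apply: measurable_fibres_pair; last first.
  apply: measurable_fibres_ffun => A; apply: measurable_fibres_floor.
  apply: measurableT_comp => //; apply: (@measurable_tree_mu _ _ Omega _ _ k.+1 k) => //.
  rewrite (_ : _ @^-1` _ = \bigcup_(c in finite_cells A) cell (code_grid m) c).
    rewrite bigcup_mkcond; apply: countable_bigcupT_measurable => [|c]; first exact: countableP.
    by case: ifP => // _; exact: measurable_cell.
  apply/seteqP; split => u; first by move=> h; exists (cell_index (code_grid m) u).
  by move=> [c h uc]; rewrite /= (uc : cell_index (code_grid m) u = c).
apply: measurable_fibres_pair; apply: measurable_fibres_ffun => i; last first.
  apply: measurable_fibres_pair; last first.
    by apply: measurable_fibres_ffun => j; apply: mle.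
  apply: measurable_fibres_pair; last exact: mle.
  apply: measurable_fibres_pair; last first.
    by apply: mle => //; apply: (@measurable_weight _ _ Omega _ _ i i).
  exact/measurable_fibres_floor/measurable_scale.
apply: measurable_fibres_pair; last first.
  by apply: mle => //; exact: measurableT_comp.
apply: measurable_fibres_pair; last exact/measurable_fibres_floor.
by move=> c; rewrite -[X in measurable X]setTI; exact: mJ1.
Qed.

End code.

Lemma floor_mulr_dist (R : realType) (x y : R) K : (0 < K)%N ->
  Num.floor (x * K%:R) = Num.floor (y * K%:R) -> `|x - y| <= K%:R^-1.
Proof.
move=> K0 /floor_eq_dist; rewrite -mulrBl normrM (ger0_norm (ler0n _ _)).
by rewrite -ltr_pdivlMr ?ltr0n// div1r => /ltW.
Qed.

Section code_close.
Context {R : realType} d (Omega : measurableType d).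
Variables (eta beta : R) (xi : nat -> Omega -> beads R) (J : nat -> Omega -> nat * R).
Hypotheses (eta01 : 0 < eta < 1) (beta0 : 0 <= beta).

Lemma limit_dGHP_code m k b w w' (g : good eta beta (xi^~ w) (J^~ w))
    (g' : good eta beta (xi^~ w') (J^~ w')) :
  controlled eta beta (xi^~ w) (J^~ w) k (m.+1%:R^-1 / 2) ->
  (forall i, (i < k)%N -> `|(J i w).2| <= b%:R) ->
  (forall j, (j <= k)%N -> bead_len (xi j w) <= b%:R) ->
  tree_code eta beta xi J m k b w' = tree_code eta beta xi J m k b w ->
  (dGHP (limit_ctree eta01 g) (limit_ctree eta01 g') <= (4 / m.+1%:R)%:E)%E.
Proof.
move=> kc Jb lenb; rewrite /tree_code; set K := code_mesh m k b; set n := code_grid m.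
have K0 : (0 < K)%N by [].
have m0 : 0 < m.+1%:R :> R by [].
move=> [/ffunP cp /ffunP cb /ffunP cm ct].
have pickE i : (i < k)%N -> [/\ (J i w).1 = (J i w').1,
    `|(J i w).2 - (J i w').2| <= K%:R^-1 & `|(J i w').2| <= b%:R].
  move=> ik; have := cp (Ordinal ik); rewrite !ffunE /= => -[e1 e2 e3].
  by split => //; [exact/floor_mulr_dist|rewrite e3 Jb].
have beadE j : (j <= k)%N ->
    [/\ `|scale beta (xi^~ w) (J^~ w) j - scale beta (xi^~ w') (J^~ w') j| <= K%:R^-1,
      (0 < weight (xi^~ w) (J^~ w) j) = (0 < weight (xi^~ w') (J^~ w') j),
      bead_len (xi j w') <= b%:R &
      forall i, (i <= b * n.+1)%N ->
        ((grid_pos n i : R) <= bead_len (xi j w)) = ((grid_pos n i : R) <= bead_len (xi j w'))].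
  rewrite -ltnS => jk; have := cb (Ordinal jk); rewrite !ffunE /= => -[e1 e2 e3 /ffunP e4].
  split; first exact/floor_mulr_dist.
  - by rewrite !ltNge e2.
  - by rewrite e3 lenb.
  - by move=> i; rewrite -ltnS => ib; have := e4 (Ordinal ib); rewrite !ffunE.
apply: (@limit_dGHP_close R eta beta _ _ _ _ eta01 g g' k n b m.+1%:R^-1 K%:R^-1) => //.
- have -> : k.+1%:R * (2 * b%:R * K%:R^-1 + 2 * K%:R^-1) = m.+1%:R^-1 :> R; last by [].
  rewrite -mulrDl mulrA; have -> : 2 * b%:R + 2 = (2 * b)%N.+2%:R :> R.
    by rewrite -(addn2 (2 * b)%N) natrD natrM.
  rewrite /K /code_mesh !natrM invfM mulrA divff ?mul1r//.
- by rewrite -invfM lef_pV2 ?posrE ?mulr_gt0// -natrM ler_nat /n /code_grid mulnC mulnS add2n.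
- by apply: (elimT (asboolP (controlled eta beta (xi^~ w') (J^~ w') k (m.+1%:R^-1 / 2)))); rewrite (ct : asbool _ = asbool _); exact/asboolP.
- by move=> i ik; have [] := pickE i ik; split => //; exact: Jb.
- by move=> j /beadE[].
- by move=> j /beadE[].
- by move=> j jk; split; [exact: lenb|have [] := beadE j jk].
- by move=> j i jk ib; have [_ _ _] := beadE j jk; exact.
- move=> A; have := cm A; rewrite !ffunE => /esym/floor_mulr_dist h.
  apply: le_trans (h K0) _; rewrite lef_pV2 ?posrE ?ltr0n// ler_nat /K /code_mesh.
  by rewrite leq_pmull.
Qed.

(** The level k and the bound b suitable for a given precision depend on the outcome, so the codes
    are indexed by all triples (m, k, b), still countably many. *)
Lemma random_limit_tree (G : set Omega) (T : Omega -> compact_tree R) (X0 : compact_tree R) :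
  (forall j, measurable_fun setT (fun w => bead_law (xi j w))) ->
  (forall i, measurable_fun setT (J i : Omega -> nat * measurableTypeR R)) ->
  measurable G -> (forall w, ~ G w -> T w = X0) ->
  (forall w, G w -> exists g : good eta beta (xi^~ w) (J^~ w), T w = limit_ctree eta01 g) ->
  random_tree T.
Proof.
move=> mxi mJ mG TX TG.
apply: (@random_tree_fibres _ _ _ T G X0 (nat * nat * nat)%type _
  (fun i => tree_code eta beta xi J i.1.1 i.1.2 i.2)) => //.
  by move=> i; exact: measurable_fibres_tree_code.
move=> w e Gw e0; have [g Tw] := TG w Gw.
have [m _ mP] := near_infty_natSinv_lt (PosNum (divr_gt0 e0 (ltr0n R 4))).
have {mP} me : m.+1%:R^-1 < e / 4 by exact: mP (leqnn m).
have m2 : 0 < m.+1%:R^-1 / 2 :> R by rewrite divr_gt0.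
have [k kc] := g _ m2.
pose b := maxn (\max_(i < k) Num.bound `|(J i w).2|) (\max_(j < k.+1) Num.bound (bead_len (xi j w))).
exists (m, k, b) => w' Gw' cw; have [g' Tw'] := TG w' Gw'; rewrite Tw Tw'.
apply: le_lt_trans (limit_dGHP_code (m := m) (k := k) (b := b) g g' kc _ _ cw) _.
- move=> i ik; apply: le_trans (ltW (archi_boundP _)) _ => //.
  rewrite ler_nat (leq_trans _ (leq_maxl _ _))//.
  exact: (leq_bigmax (Ordinal ik)).
- move=> j jk; apply: le_trans (ltW (archi_boundP (ltW (bead_len_gt0 _)))) _.
  rewrite ler_nat (leq_trans _ (leq_maxr _ _))//.
  exact: (leq_bigmax (Ordinal (jk : (j < k.+1)%N))).
- by rewrite lte_fin mulrC -ltr_pdivlMr.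
Qed.

End code_close.

Lemma cvge_to0 (R : realType) (u : nat -> \bar R) : (forall k, (0 <= u k)%E) ->
  (forall e, 0 < e -> exists N, forall k, (N <= k)%N -> (u k <= e%:E)%E) ->
  u k @[k --> \oo] --> 0%E.
Proof.
move=> u0 ue; apply/fine_cvgP; split.
  have [N hN] := ue 1 ltr01; exists N => // k /= Nk.
  by rewrite ge0_fin_numE// (le_lt_trans (hN _ Nk))// ltry.
apply/cvgrPdist_le => e e0; have [N hN] := ue e e0; exists N => // k /= Nk.
have := hN k Nk; have := u0 k; case: (u k) => [x||]//=; rewrite !lee_fin => x0 xe.
by rewrite sub0r normrN ger0_norm.
Qed.

Lemma limit_dGHP_cvg (R : realType) (eta beta : R) (s : nat -> beads R)
    (J : nat -> nat * R) (eta01 : 0 < eta < 1) (g : good eta beta s J) :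
  dGHP (tree beta s J k) (limit_ctree eta01 g) @[k --> \oo] --> 0%E.
Proof.
apply: cvge_to0 => [k|e e0]; first exact: dGHP_ge0.
have e2 : 0 < e / 2 by rewrite divr_gt0.
have [N Nc] := g _ e2; exists N => k Nk.
have -> : e = 2 * (e / 2) by lra.
by apply: limit_dGHP => // j kj; apply: Nc; exact: leq_ltn_trans kj.
Qed.

Unset Implicit Arguments.

Theorem corollary1p2 (R : realType) (d : measure_display)
  (Omega : measurableType d) (P : probability Omega R)
  (p beta : R) (hp : 1 <= p) (hbeta : 1 / p < beta)
  (xi : nat -> Omega -> beads R) (J : nat -> Omega -> nat * R)
  (hxi : bead_copies P xi)
  (hL : ('E_P[fun w => (bead_len (xi 0%N w) `^ p)%R] < +oo)%E)
  (hJ : picked_from_mass P xi J)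
  (hindep : independent_copies P xi J) :
  exists T : Omega -> compact_tree R,
    [/\ random_tree T,
        {ae P, forall w, continuum_tree (T w)} &
        {ae P, forall w,
           dGHP (tree beta (fun j => xi j w) (fun i => J i w) k) (T w)
             @[k --> \oo] --> 0%E}].
Proof.
have p0 : 0 < p := lt_le_trans ltr01 hp.
have beta0 : 0 <= beta by apply/ltW; apply: le_lt_trans hbeta; rewrite divr_ge0// ltW.
have [x side1] := side_exists hp hbeta hxi.
have side0 : (0 <= \int[P]_w side p beta x (bead_law (xi 0%N w)))%E.
  by apply: integral_ge0 => w _; exact: side_ge0.
pose r := fine (\int[P]_w side p beta x (bead_law (xi 0%N w)))%E.
have sideE : (\int[P]_w side p beta x (bead_law (xi 0%N w)) = r%:E)%E.
  by rewrite fineK// ge0_fin_numE// (lt_trans side1)// ltry.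
rewrite sideE lte_fin in side1; rewrite sideE lee_fin in side0.
have r0 : 0 < 1 + r by lra.
(* As r < 1, this is more than 1 while [theta * r] is less than 1. *)
pose theta := 2 / (1 + r).
have theta1 : 1 < theta by rewrite ltr_pdivlMr//; lra.
have theta_r : theta * r < 1 by rewrite mulrAC ltr_pdivrMr//; lra.
have summ := offspring_summable hp hbeta hxi hJ hindep (ltW theta1) sideE (ltW side1) theta_r.
have eta01 := decay_rate01 hp theta1.
have [N [mN N0 hN]] : {ae P, forall w,
    good (decay_rate p theta) beta (xi^~ w) (J^~ w) /\ no_atoms (xi^~ w) (J^~ w)}.
  have ae1 := ae_offspring_len hxi hJ hindep hL (ltW theta1) summ.
  have ae2 := ae_no_atoms hp hbeta hxi hJ (ltW theta1) summ.
  by apply: filterS2 ae1 ae2 => w h1 h2; split => //; exact: offspring_good h1.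
have hG w : (~` N) w ->
    good (decay_rate p theta) beta (xi^~ w) (J^~ w) /\ no_atoms (xi^~ w) (J^~ w).
  by move=> Nw; apply: contrapT => /hN.
(* The limit tree of one outcome outside the null set N serves as the value of T on N. *)
have [w0 Gw0] : exists w, (~` N) w.
  apply: contrapT => /forallNP h; have := probability_setT P.
  rewrite (_ : setT = N) ?N0 => [/eqP|]; first by rewrite eqe eq_sym oner_eq0.
  by apply/seteqP; split => // w _; apply: contrapT; exact: (h w).
pose X0 := limit_ctree eta01 (hG w0 Gw0).1.
pose T w := if pselect ((~` N) w) is left h then limit_ctree eta01 (hG w h).1 else X0.
have TG w : (~` N) w -> exists2 g : good (decay_rate p theta) beta (xi^~ w) (J^~ w),
    no_atoms (xi^~ w) (J^~ w) & T w = limit_ctree eta01 g.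
  rewrite /T; case: pselect => // h _; exists (hG w h).1 => //.
  exact: (hG w h).2.
exists T; split.
- apply: (@random_limit_tree _ _ _ _ _ _ _ eta01 beta0 (~` N) T X0).
  + exact: measurable_law hxi.
  + exact: measurable_pick hJ.
  + exact: measurableC.
  + by move=> w; rewrite /T; case: pselect.
  + by move=> w /TG[g _ ->]; exists g.
- exists N; split => // w /= nT; apply: contrapT => /TG[g na Tw]; apply: nT.
  by rewrite Tw; exact: limit_continuum.
- exists N; split => // w /= nT; apply: contrapT => /TG[g _ Tw]; apply: nT.
  by rewrite Tw; exact: limit_dGHP_cvg.
Qed.
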